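(* Let $\{i_1,\dots,i_s\}$ be a type with $i_1+\dots+i_s=n$ and $s>1$. Then $$\mathrm{sh}_{\{i_1,\dots,i_s\}}\setminus G\cdot[v_{\{i_1,\dots,i_s\}}]=\bigcup_{\alpha=1}^{s-1}N_{i_1+\dots+i_\alpha}(\{i_1,\dots,i_s\}).$$
   Context: Everything is over $\mathbb{C}$; $x_k:=x\otimes t^k$ for $x\in\mathfrak{sl}_2$, and $e,h,f$ is the standard basis of $\mathfrak{sl}_2$. Fusion product: for positive integers $A=(a_1,\dots,a_n)$ choose pairwise distinct $z_1,\dots,z_n\in\mathbb{C}$ and let $\mathbb{C}^{a_i}(z_i)$ be the evaluation module of $\mathfrak{sl}_2\otimes\mathbb{C}[t]$, i.e. the irreducible $a_i$-dimensional $\mathfrak{sl}_2$-module on which $x_k$ acts as $z_i^k x$. The tensor product $V=\bigotimes_i\mathbb{C}^{a_i}(z_i)$ is cyclic, generated by the tensor product $v$ of lowest weight vectors. Filter $V$ by the subspaces $V^{(m)}$ spanned by $x^{(1)}_{k_1}\cdots x^{(r)}_{k_r}v$ with $x^{(l)}\in\mathfrak{sl}_2$ and $k_1+\dots+k_r\le m$. The fusion product $M^A$ is the associated graded $\mathfrak{sl}_2\otimes\mathbb{C}[t]$-module; it is (known to be) independent of the $z_i$ and is an $\mathfrak{sl}_2\otimes(\mathbb{C}[t]/t^n)$-module. Let $v_A\in M^A$ be the image of $v$. $G=\mathrm{SL}_2(\mathbb{C}[t]/t^n)$ acts on $\mathbb{P}(M^A)$, and for $2\le a_1\le\dots\le a_n$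 one puts $\mathrm{sh}_A=\overline{G\cdot[v_A]}\subset\mathbb{P}(M^A)$, $[v_A]=\mathbb{C}v_A$. A type is an ordered tuple $\{i_1,\dots,i_s\}$ of positive integers with sum $n$. Let $A_{\{i_1,\dots,i_s\}}=(2^{i_1}3^{i_2}\cdots(s+1)^{i_s})$ ($i_1$ entries equal to $2$, then $i_2$ entries equal to $3$, etc.), $\mathrm{sh}_{\{i_1,\dots,i_s\}}=\mathrm{sh}_{A_{\{i_1,\dots,i_s\}}}$, and let $[v_{\{i_1,\dots,i_s\}}]$ be its base point. Realization: put $n_1=n$ and $n_k=n-i_1-\dots-i_{k-1}$ for $2\le k\le s$, and write $v_{(2^m)}$ for the cyclic vector of $M^{(2^m)}=M^{(2,\dots,2)}$ ($m$ twos). There is an embedding of $\mathfrak{sl}_2\otimes(\mathbb{C}[t]/t^n)$-modules $M^{A_{\{i_1,\dots,i_s\}}}\hookrightarrow M^{(2^{n_1})}\otimes\dots\otimes M^{(2^{n_s})}$ sending the cyclic vector to $v_{(2^{n_1})}\otimes\dots\otimes v_{(2^{n_s})}$; thus $\mathrm{sh}_{\{i_1,\dots,i_s\}}$ is regarded as a subvariety of $\mathbb{P}(M^{(2^{n_1})}\otimes\dots\otimes M^{(2^{n_s})})$. The subvarieties $N_j$: for $1\le\alpha\le s-1$ and $j=i_1+\dots+i_\alpha$ put $$w_\alpha=(e_{n_1-1}v_{(2^{n_1})})\otimes\dots\otimes(e_{n_\alpha-1}v_{(2^{n_\alpha})})\otimes v_{(2^{n_{\alpha+1}})}\otimes\dots\otimes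 v_{(2^{n_s})},$$ and let $e^{(2)}_k$ denote the operator $e_k$ acting only on the tensor product of the last $s-\alpha$ factors (identity on the first $\alpha$ factors), while $e_k$ acts on the whole tensor product. Then $$N_j(\{i_1,\dots,i_s\})=\overline{\Big\{\exp\Big(\sum_{l=0}^{n-1}z_le_l+z\,e^{(2)}_{n-j-1}\Big)\cdot[w_\alpha]:\ z_l,z\in\mathbb{C}\Big\}}.$$ *)

(* Defs.v *)
From HB Require Import structures.
From mathcomp Require Import all_boot all_order all_algebra.
From mathcomp Require Import boolp classical_sets.
From mathcomp Require Import mpoly.

Set Implicit Arguments.
Unset Strict Implicit.
Unset Printing Implicit Defensive.

Import GRing.Theory.

Local Open Scope classical_set_scope.
Local Open Scope ring_scope.

Section Defs.
Context {K : fieldType}.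

(* The tensor product of a finite family of finite-dimensional spaces,
   realised as the free vector space on the product of the chosen bases. *)

Section Tensor.
Context {I : finType} (M : I -> vectType K).

Definition tidx : finType := {dffun forall i : I, 'I_(\dim {:M i})}.

Definition tensor : vectType K := {ffun tidx -> K^o}.

Definition tens (u : forall i, M i) : tensor :=
  [ffun J : tidx => \prod_(i : I) (coord (vbasis {:M i}) (J i) (u i) : K)].

Definition tbasis (J : tidx) (i : I) : M i := (vbasis {:M i})`_(J i).

Implicit Types (u : forall i, M i).

Lemma tens_dfwith u i (x : M i) J :
  tens (dfwith u x) J = coord (vbasis {:M i}) (J i) x *
    \prod_(j | j != i) coord (vbasis {:M j}) (J j) (u j) :> K.
Proof.
rewrite ffunE (bigD1 i) //= dfwith_in; congr (_ * _).
by apply: eq_bigr => j ji; rewrite dfwith_out // eq_sym.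
Qed.

Lemma tens_linear u i : linear (fun x : M i => tens (dfwith u x)).
Proof.
move=> a x y; apply/ffunP => J.
have -> : (a *: tens (dfwith u x) + tens (dfwith u y)) J =
    a * tens (dfwith u x) J + tens (dfwith u y) J by rewrite !ffunE.
by rewrite !tens_dfwith linearP mulrDl -mulrA.
Qed.

Definition tlift_fun (i : I) (X : 'End(M i)) (phi : tensor) : tensor :=
  \sum_(J : tidx) (phi J : K) *: tens (dfwith (tbasis J) (X (tbasis J i))).

Lemma tlift_fun_is_linear i (X : 'End(M i)) : linear (tlift_fun X).
Proof.
move=> a x y; rewrite scaler_sumr -big_split /=; apply: eq_bigr => J _.
by rewrite !ffunE scalerDl scalerA.
Qed.

HB.instance Definition _ i (X : 'End(M i)) :=
  GRing.isLinear.Build K tensor tensor _ (tlift_fun X)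
    (tlift_fun_is_linear X).

(* [tlift X] is the identity on every factor but the [i]-th one, where it is
   [X]; see [tlift_tens]. *)
Definition tlift (i : I) (X : 'End(M i)) : 'End(tensor) :=
  linfun (tlift_fun X).

Lemma tliftE i (X : 'End(M i)) (phi : tensor) : tlift X phi = tlift_fun X phi.
Proof. exact: (lfunE (tlift_fun X)). Qed.

Lemma tlift_tens i (X : 'End(M i)) u :
  tlift X (tens u) = tens (dfwith u (X (u i))).
Proof.
have coordb (j : I) k l : coord (vbasis {:M j}) l (vbasis {:M j})`_k =
    (k == l :> nat)%:R.
  case: (ltnP k (size (vbasis {:M j}))) => kl; last first.
    rewrite nth_default // linear0; case: eqP => // e.
    by move: kl; rewrite size_tuple e leqNgt ltn_ord.
  rewrite size_tuple in kl.
  by rewrite -[k]/(nat_of_ord (Ordinal kl)) coord_free ?(basis_free (vbasisP _)) // eq_sym.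
apply/ffunP => J; rewrite tens_dfwith tliftE /tlift_fun sum_ffunE.
have E (c : K) (phi : tensor) : (c *: phi) J = c * phi J by rewrite !ffunE.
rewrite (partition_big (fun J' : tidx => J' i) predT) //=.
rewrite [in RHS](coord_vbasis (memvf (u i))) !linear_sum mulr_suml.
apply: eq_bigr => l _.
pose J0 : tidx := [ffun j => dfwith (fun k => J k) l j].
have J0i : J0 i = l by rewrite ffunE dfwith_in.
have J0j j : j != i -> J0 j = J j by move=> ji; rewrite ffunE dfwith_out // eq_sym.
rewrite (bigD1 J0) /=; last by rewrite J0i.
rewrite [X in _ + X]big1 ?addr0 => [|J' /andP[/eqP J'i J'N]]; last first.
  have [j ji jJ] : exists2 j, j != i & J' j != J j.
    apply/exists_inP; rewrite -[X in is_true X]negbK; apply: contra J'N.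
    rewrite negb_exists_in => /forall_inP Jj; apply/eqP/ffunP => j.
    have [->|ji] := eqVneq j i; first by rewrite J0i.
    by rewrite J0j //; apply/eqP; rewrite -[_ == _]negbK Jj.
  rewrite E tens_dfwith (bigD1 j) //= /tbasis coordb val_eqE (negbTE jJ).
  by rewrite mul0r mulr0 mulr0.
rewrite E tens_dfwith {1}/tbasis J0i !linearZ /=.
rewrite [X in _ * (_ * X)]big1 => [|j ji]; last first.
  by rewrite /tbasis coordb J0j // eqxx.
rewrite mulr1 ffunE (bigD1 i) //= J0i.
rewrite (eq_bigr (fun j => coord (vbasis {:M j}) (J j) (u j) : K)) => [|j ji]; last first.
  by rewrite J0j.
by rewrite mulrAC.
Qed.

End Tensor.

(* sl_2 is the space of trace-zero matrices ['M[K]_2]; an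
   [sl_2 (x) K[t]]-module is given by its operators [act x k], the action of
   [x (x) t^k]. *)

Definition sl2_e : 'M[K]_2 := delta_mx 0 1.
Definition sl2_f : 'M[K]_2 := delta_mx 1 0.

(* The irreducible [a]-dimensional module, in a basis u_0, ..., u_(a-1) of
   weight vectors with u_0 of lowest weight:
   e u_j = u_(j+1),  f u_j = j (a - j) u_(j-1),  h u_j = (2 j + 1 - a) u_j.
   Matrices act on column vectors, so the entry (i, j) is the coefficient of
   u_i in the image of u_j. *)
Definition irr_e a : 'M[K]_a := \matrix_(i, j) ((i == j.+1 :> nat)%:R).
Definition irr_f a : 'M[K]_a :=
  \matrix_(i, j) ((j == i.+1 :> nat)%:R * (j * (a - j))%:R).
Definition irr_h a : 'M[K]_a :=
  \matrix_(i, j) ((i == j)%:R * ((2 * j + 1)%:R - a%:R)).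

Definition irr_mx a (x : 'M[K]_2) : 'M[K]_a :=
  x 0 1 *: irr_e a + x 0 0 *: irr_h a + x 1 0 *: irr_f a.

Definition irr_act a (x : 'M[K]_2) : 'End('cV[K]_a) :=
  linfun (mulmx (irr_mx a x)).

Definition irr_low a : 'cV[K]_a := \col_i ((i == 0%N :> nat)%:R).

(* The filtered cyclic module V = (x)_i K^(a_i)(z_i). *)

Section Evaluation.
Context (A : seq nat) (z : 'I_(size A) -> K).

Definition ev_factor (i : 'I_(size A)) : vectType K := 'cV[K]_(nth 0%N A i).

Definition ev_space : vectType K := tensor ev_factor.

Definition ev_act (x : 'M[K]_2) (k : nat) : 'End(ev_space) :=
  \sum_(i < size A)
     z i ^+ k *: tlift (i := i) (irr_act (nth 0%N A i) x : 'End(ev_factor i)).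

Definition ev_low : ev_space :=
  tens (fun i : 'I_(size A) => irr_low (nth 0%N A i) : ev_factor i).

(* A word [:: (x1, k1); ...; (xr, kr)] stands for x1_k1 ... xr_kr. *)
Definition word_le (m : nat) (w : seq ('M[K]_2 * nat)) : bool :=
  all (fun xk => \tr xk.1 == 0) w && (sumn [seq xk.2 | xk <- w] <= m)%N.

Definition word_app (w : seq ('M[K]_2 * nat)) : ev_space :=
  foldr (fun xk u => ev_act xk.1 xk.2 u) ev_low w.

Definition ev_fil (m : nat) (u : ev_space) : Prop :=
  exists2 ws : seq (seq ('M[K]_2 * nat)),
    all (word_le m) ws & u \in <<[seq word_app w | w <- ws]>>%VS.

(* The step of index [m - 1], with the convention V^(-1) = 0. *)
Definition ev_fil_pred (m : nat) (u : ev_space) : Prop :=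
  if m is m'.+1 then ev_fil m' u else u = 0.

End Evaluation.

(* [fusion_product A] is the type of (models of) the associated graded module
   of such a V: [symb m] induces an isomorphism of V^(m) / V^(m-1) onto the
   component of degree m, and x (x) t^k sends the class of u in degree m to
   the class of x_k u in degree m + k.  The values of [symb m] outside V^(m),
   and those of [fp_act x] when x is not in sl_2, are irrelevant.  Models
   exist for all distinct z_i: see [fusion_product_exists]. *)
Record fusion_product (A : seq nat) := FusionProduct {
  fp_pt : 'I_(size A) -> K;
  fp_space :> vectType K;
  fp_symb : nat -> 'Hom(ev_space A, fp_space);
  fp_act : 'M[K]_2 -> nat -> 'End(fp_space);
  fp_pt_inj : injective fp_pt;
  fp_symb_eq0 : forall m u, ev_fil fp_pt m u ->
    fp_symb m u = 0 <-> ev_fil_pred fp_pt m u;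
  fp_symb_direct : forall N (u : nat -> ev_space A),
    (forall m, ev_fil fp_pt m (u m)) ->
    \sum_(m < N) fp_symb m (u m) = 0 ->
    forall m, (m < N)%N -> fp_symb m (u m) = 0;
  fp_symb_span : forall w : fp_space, exists N (u : nat -> ev_space A),
    (forall m, ev_fil fp_pt m (u m)) /\ w = \sum_(m < N) fp_symb m (u m);
  fp_actE : forall x k m u, \tr x = 0 -> ev_fil fp_pt m u ->
    fp_act x k (fp_symb m u) = fp_symb (m + k)%N (ev_act fp_pt x k u) }.

Lemma ex_vspace (V : vectType K) (P : V -> Prop) :
  P 0 -> (forall a u v, P u -> P v -> P (a *: u + v)) ->
  exists U : {vspace V}, forall u, u \in U <-> P u.
Proof.
move=> P0 PL.
pose Q d := `[< exists U : {vspace V}, (forall u, u \in U -> P u) /\ \dim U = d >].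
have exQ : exists d, Q d.
  exists 0%N; apply/asboolP; exists 0%VS; split; last exact: dimv0.
  by move=> u; rewrite memv0 => /eqP ->.
have leQ d : Q d -> (d <= \dim {:V})%N.
  by move=> /asboolP[U [_ <-]]; exact: dimvS (subvf _).
case: (ex_maxnP exQ leQ) => d /asboolP[U [UP dU]] dmax.
exists U => u; split=> [|Pu]; first exact: UP.
have : Q (\dim (U + <[u]>)%VS).
  apply/asboolP; exists (U + <[u]>)%VS; split=> // w /memv_addP[x xU [y /vlineP[a ->] ->]].
  by rewrite addrC; apply: PL => //; exact: UP.
move=> /dmax; rewrite -dU => le; have /eqP -> : (U == U + <[u]>)%VS.
  by rewrite eqEdim addvSl.
exact: subvP (addvSr _ _) _ (memv_line u).
Qed.

Section Existence.
Context (A : seq nat) (z : 'I_(size A) -> K).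
Local Notation V := (ev_space A).

Lemma ev_fil0 m : ev_fil z m 0.
Proof. by exists [::]; rewrite //= mem0v. Qed.

Lemma ev_filL m a u v : ev_fil z m u -> ev_fil z m v -> ev_fil z m (a *: u + v).
Proof.
move=> [s1 h1 u1] [s2 h2 u2]; exists (s1 ++ s2); first by rewrite all_cat h1.
rewrite map_cat span_cat memv_add // memvZ //.
Qed.

Lemma ev_filS m n u : (m <= n)%N -> ev_fil z m u -> ev_fil z n u.
Proof.
move=> mn [s h us]; exists s => //; apply: sub_all h => w /andP[h1 h2].
by rewrite /word_le h1 (leq_trans h2).
Qed.

Lemma ev_fil_act m x k u : \tr x = 0 -> ev_fil z m u ->
  ev_fil z (m + k) (ev_act z x k u).
Proof.
move=> tx [s h us]; exists [seq (x, k) :: w | w <- s].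
  rewrite all_map; apply: sub_all h => w /andP[h1 h2].
  by rewrite /word_le /= tx eqxx h1 /= addnC leq_add2r.
rewrite -map_comp; have -> : [seq word_app z ((x, k) :: w) | w <- s] =
    [seq ev_act z x k v | v <- [seq word_app z w | w <- s]].
  by rewrite -map_comp.
by rewrite -limg_span memv_img.
Qed.

Lemma fusion_product_exists : injective z ->
  exists M : fusion_product A, fp_pt M = z.
Proof.
move=> zi.
have /choice[U UP] m := ex_vspace (ev_fil0 m) (@ev_filL m).
pose Up m := if m is m'.+1 then U m' else 0%VS.
have UpP m u : u \in Up m <-> ev_fil_pred z m u.
  by case: m => [|m] /=; [rewrite memv0; split=> /eqP | exact: UP].
have US m n : (m <= n)%N -> (U m <= U n)%VS.
  by move=> mn; apply/subvP => u /UP fu; apply/UP; exact: ev_filS fu.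
have UpU m : (Up m <= U m)%VS by case: m => [|m]; [exact: sub0v | exact: US].
have UUp m n : (m < n)%N -> (U m <= Up n)%VS by case: n => // n mn; exact: US.
have Uact m x k u : \tr x = 0 -> u \in U m -> ev_act z x k u \in U (m + k)%N.
  by move=> tx /UP fu; apply/UP; exact: ev_fil_act.
have Upact m x k u : \tr x = 0 -> u \in Up m -> ev_act z x k u \in Up (m + k)%N.
  case: m => [|m] tx; last exact: Uact.
  by rewrite memv0 => /eqP ->; rewrite linear0 mem0v.
have [N UN] : exists N, forall m, (N <= m)%N -> U m = U N.
  pose Q d := `[< exists m, \dim (U m) = d >].
  have exQ : exists d, Q d by exists (\dim (U 0)); apply/asboolP; exists 0%N.
  have leQ d : Q d -> (d <= \dim {:V})%N.
    by move=> /asboolP[m <-]; exact: dimvS (subvf _).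
  case: (ex_maxnP exQ leQ) => d /asboolP[N dN] dmax; exists N => m Nm.
  apply/eqP; rewrite eq_sym eqEdim US //= dN dmax //; apply/asboolP.
  by exists m.
have ULN m : (U m <= U N)%VS.
  by have [h|h] := leqP m N; [exact: US | rewrite (UN m (ltnW h))].
pose C m := (U m :\: Up m)%VS.
have CUp m : (C m :&: Up m)%VS = 0%VS by exact: capv_diff.
have CD m : (C m + Up m)%VS = U m.
  rewrite -[RHS](addv_diff_cap (U m) (Up m)); congr (_ + _)%VS.
  by symmetry; apply/capv_idPr.
have CU m : (C m <= U m)%VS by rewrite -CD addvSl.
pose s m : 'End(V) := daddv_pi (C m) (Up m).
have sC m u : s m u \in C m by exact: memv_pi.
have sUp m u : u \in U m -> u - s m u \in Up m.
  rewrite -CD => uU; rewrite -{1}(daddv_pi_add (CUp m) uU) addrAC subrr add0r.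
  exact: memv_pi.
have s0 m u : u \in Up m -> s m u = 0.
  move=> uU; apply/eqP; rewrite -memv0 -(CUp m) memv_cap sC /=.
  rewrite -[s m u](subKr u) memvB // sUp //; exact: subvP (UpU m) _ uU.
have sE m u : u \in U m -> s m u = 0 -> u \in Up m.
  by move=> uU su; rewrite -[u]subr0 -su sUp.
have sid m u : u \in C m -> s m u = u by exact: daddv_pi_id.
have sL m u : s m u \in U N by exact: subvP (subv_trans (CU m) (ULN m)) _ (sC m u).
(* independence *)
have dir n (c : nat -> V) : (forall m, c m \in C m) -> \sum_(m < n) c m = 0 ->
    forall m, (m < n)%N -> c m = 0.
  move=> cC; elim: n => // n IH; rewrite big_ord_recr /= => e.
  have cn : c n = 0.
    apply/eqP; rewrite -memv0 -(CUp n) memv_cap cC /=.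
    have -> : c n = - \sum_(m < n) c m by apply/eqP; rewrite -addr_eq0 addrC e.
    rewrite memvN; apply: memv_suml => m _.
    exact: subvP (subv_trans (CU m) (UUp _ _ (ltn_ord m))) _ (cC m).
  move: e; rewrite cn addr0 => /IH e m; rewrite ltnS leq_eqVlt.
  by case/orP=> [/eqP ->|/e].
have span m w : w \in U m -> exists u : nat -> V,
    (forall l, u l \in U l) /\ w = \sum_(l < m.+1) s l (u l).
  elim: m w => [|m IH] w wU.
    exists (fun l => if l == 0%N then w else 0); split=> [l|].
      by case: eqP => [->|_] //; exact: mem0v.
    rewrite big_ord1 /=; apply/eqP; rewrite -subr_eq0 -memv0.
    exact: (sUp 0%N).
  have [u [uU e]] := IH _ (sUp _ _ wU).
  exists (fun l => if l == m.+1 then w else u l); split=> [l|].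
    by case: eqP => [->|].
  rewrite big_ord_recr /= eqxx -[LHS](subrK (s m.+1 w)) e; congr (_ + _).
  by apply: eq_bigr => l _; rewrite ltn_eqF.
pose pi (m : nat) : 'End(V) :=
  sumv_pi_for (erefl (\sum_(i < N.+1) C i)%VS) (inord m : 'I_N.+1).
have piE m l u : (m <= N)%N -> (l <= N)%N -> u \in C l ->
    pi m u = if m == l then u else 0.
  move=> mN lN uC; have uS : u \in (\sum_(i < N.+1) C i)%VS.
    by apply: subvP uC; rewrite -[l]/(val (Ordinal (lN : (l < N.+1)%N))) (sumv_sup (Ordinal (lN : (l < N.+1)%N))).
  have e : \sum_(i < N.+1) pi i u = u.
    rewrite -[RHS](sumv_pi_sum (erefl (\sum_(i < N.+1) C i)%VS) uS).
    by apply: eq_bigr => i _; rewrite /pi inord_val.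
  pose c i := pi i u - (if i == l then u else 0).
  have cC i : (i <= N)%N -> c i \in C i.
    move=> iN; rewrite memvB //; last by case: eqP => [->|_] //; exact: mem0v.
    have := memv_sum_pi (erefl (\sum_(i < N.+1) C i)%VS) (inord i) u.
    by rewrite inordK.
  apply/eqP; rewrite -subr_eq0; apply/eqP.
  have := dir N.+1 (fun i => if (i <= N)%N then c i else 0) _ _ m mN.
  rewrite mN; apply.
    by move=> i; case: ifP => [/cC//|_]; exact: mem0v.
  rewrite (eq_bigr (fun i : 'I_N.+1 => pi i u - (if i == l :> nat then u else 0))).
    rewrite sumrB e (bigD1 (Ordinal (lN : (l < N.+1)%N))) //= eqxx.
    rewrite big1 ?addr0 ?subrr // => i.
    by rewrite -val_eqE /= => /negbTE ->.
  by move=> i _; rewrite -ltnS ltn_ord.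
pose W := subvs_of (U N).
pose symb m : 'Hom(V, W) := (linfun (vsproj (U N)) \o s m)%VF.
have symbE m u : vsval (symb m u) = s m u.
  by rewrite comp_lfunE lfunE /= vsprojK.
pose iW : 'Hom(W, V) := linfun (vsval : W -> V).
pose act (x : 'M[K]_2) k : 'End(W) :=
  \sum_(m < N.+1) (symb (m + k)%N \o ev_act z x k \o pi m \o iW)%VF.
have symb_eq0 m u : ev_fil z m u -> symb m u = 0 <-> ev_fil_pred z m u.
  move=> /UP uU; split=> [e|/UpP/s0 e].
    by apply/UpP/sE => //; rewrite -symbE e.
  by apply: val_inj; rewrite /= symbE.
have symb_direct n (u : nat -> V) : (forall m, ev_fil z m (u m)) ->
    \sum_(m < n) symb m (u m) = 0 -> forall m, (m < n)%N -> symb m (u m) = 0.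
  move=> uU e m mn; apply: val_inj; rewrite /= symbE.
  apply: (dir n (fun m => s m (u m))) => //.
  have e' : vsval (\sum_(i < n) symb i (u i)) = 0 by rewrite e linear0.
  rewrite linear_sum in e'; rewrite -[RHS]e'.
  by apply: eq_bigr => i _; exact/esym/symbE.
have symb_span (w : W) : exists n (u : nat -> V),
    (forall m, ev_fil z m (u m)) /\ w = \sum_(m < n) symb m (u m).
  have [u [uU e]] := span N (vsval w) (subvsP w).
  exists N.+1, u; split=> [m|]; first exact/UP.
  apply: val_inj; rewrite /= e linear_sum.
  by apply: eq_bigr => i _; exact/esym/symbE.
have actD m x k w : (symb (m + k)%N \o ev_act z x k \o pi m \o iW)%VF w =
    symb (m + k)%N (ev_act z x k (pi m (vsval w))).
  rewrite 3!comp_lfunE (_ : iW w = vsval w) //; exact: lfunE.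
have actE x k m u : \tr x = 0 -> ev_fil z m u ->
    act x k (symb m u) = symb (m + k)%N (ev_act z x k u).
  move=> tx fu; have /UP uU := fu; rewrite /act sum_lfunE.
  have [mN|Nm] := leqP m N; last first.
    have uUp : u \in Up m.
      by apply: subvP (UUp N m Nm) _ _; rewrite -(UN m (ltnW Nm)).
    rewrite (_ : symb m u = 0); last by apply/symb_eq0/UpP.
    rewrite big1 => [|i _]; last by rewrite linear0.
    by apply: val_inj; rewrite /= symbE s0 // Upact.
  rewrite (bigD1 (Ordinal (mN : (m < N.+1)%N))) //= big1 ?addr0 => [|i].
    rewrite actD symbE. rewrite (piE m m) //. rewrite eqxx.
    apply: subvs_inj; rewrite !symbE; apply/eqP.
    rewrite -subr_eq0 (_ : _ - _ = s (m + k)%N (ev_act z x k (s m u - u))).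
      rewrite (s0 (m + k)%N) //; apply: Upact => //.
      by rewrite -memvN opprB sUp.
    by rewrite !linearB.
  rewrite -val_eqE /= => /negbTE im.
  rewrite actD symbE (piE i m) // ?im ?linear0 //.
  by rewrite -ltnS.
by exists (FusionProduct zi symb_eq0 symb_direct symb_span actE).
Qed.

End Existence.

Definition fp_vec A (M : fusion_product A) : M := fp_symb M 0 (ev_low A).

(* A point of P(V) is a line of V. *)

Definition vanishes_on (V : vectType K) (p : {mpoly K[\dim {:V}]})
    (L : {vspace V}) : Prop :=
  forall u, u \in L -> p.@[fun i => coord (vbasis {:V}) i u] = 0.

Definition zariski_closure (V : vectType K) (S : set {vspace V}) :
    set {vspace V} :=
  [set L | \dim L = 1%N /\
     forall d (p : {mpoly K[\dim {:V}]}), p \is d.-homog ->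
       (forall L', S L' -> vanishes_on p L') -> vanishes_on p L].

(* The exponential of a nilpotent operator. *)
Definition nexp (V : vectType K) (X : 'End(V)) : 'End(V) :=
  linfun (fun u : V =>
    \sum_(k < (\dim {:V}).+1) (k`!%:R : K)^-1 *: iter k X u).

Section GroupAction.
Context (n : nat) (V : vectType K) (act : 'M[K]_2 -> nat -> 'End(V)).

(* The action of x (x) p for p in K[t]/t^n. *)
Definition trunc_act (x : 'M[K]_2) (p : {poly %/ ('X^n : {poly K})}) :
    'End(V) :=
  \sum_(k < n) (p : {poly K})`_k *: act x k.

(* The action of SL_2(K[t]/t^n) integrating that of its Lie algebra: since
   K[t]/t^n is local, SL_2(K[t]/t^n) is generated by the elementary matrices
   1 + p e = exp (p e) and 1 + p f = exp (p f). [SL2_act g T] means that [g]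
   acts as [T]. *)
Inductive SL2_act : 'M[{poly %/ ('X^n : {poly K})}]_2 -> 'End(V) -> Prop :=
| SL2_act_1 : SL2_act 1%:M \1%VF
| SL2_act_e p g T : SL2_act g T ->
    SL2_act ((1%:M + p *: delta_mx 0 1) *m g)
            (nexp (trunc_act sl2_e p) \o T)%VF
| SL2_act_f p g T : SL2_act g T ->
    SL2_act ((1%:M + p *: delta_mx 1 0) *m g)
            (nexp (trunc_act sl2_f p) \o T)%VF.

Definition SL2_orbit (v : V) : set {vspace V} :=
  [set L | exists g T, [/\ \det g = 1, SL2_act g T & L = <[T v]>%VS]].

End GroupAction.

Definition fp_orbit A (M : fusion_product A) : set {vspace M} :=
  SL2_orbit (size A) (fp_act M) (fp_vec M).

Arguments fp_orbit [A] M _.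

Definition sh A (M : fusion_product A) : set {vspace M} :=
  zariski_closure (fp_orbit M).

Arguments sh [A] M _.

(* The type {i_1, ..., i_s} is the sequence [ty], numbered from 0, so that
   A = (2^(ty_0) 3^(ty_1) ...) and [twos ty k] is the multiplicity n_(k+1). *)

Definition typeA (ty : seq nat) : seq nat :=
  flatten [seq nseq (nth 0%N ty k) k.+2 | k <- iota 0 (size ty)].

Definition twos (ty : seq nat) (k : nat) : nat :=
  (sumn ty - sumn (take k ty))%N.

Section Embedding.
Context (ty : seq nat).
Context (M : forall k : 'I_(size ty), fusion_product (nseq (twos ty k) 2%N)).

Definition prod_space : vectType K := tensor (fun k => M k : vectType K).

Definition prod_act (x : 'M[K]_2) (k : nat) : 'End(prod_space) :=
  \sum_(i < size ty) tlift (fp_act (M i) x k).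

(* The operator acting only on the factors after the first [alpha] ones. *)
Definition prod_act2 (alpha : nat) (x : 'M[K]_2) (k : nat) :
    'End(prod_space) :=
  \sum_(i < size ty | (alpha <= i)%N) tlift (fp_act (M i) x k).

Definition prod_vec : prod_space := tens (fun k => fp_vec (M k)).

Definition is_embedding A (MA : fusion_product A)
    (iota : 'Hom(MA, prod_space)) : Prop :=
  [/\ injective iota,
      forall x k u, \tr x = 0 -> iota (fp_act MA x k u) = prod_act x k (iota u)
    & iota (fp_vec MA) = prod_vec].

Definition w_ (alpha : nat) : prod_space :=
  tens (fun k : 'I_(size ty) =>
    if (k < alpha)%N then fp_act (M k) sl2_e (twos ty k - 1)%N (fp_vec (M k))
    else fp_vec (M k)).

(* N_j for j = i_1 + ... + i_alpha. *)
Definition N_ (alpha : nat) : set {vspace prod_space} :=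
  let n := sumn ty in
  let j := sumn (take alpha ty) in
  zariski_closure
    [set L | exists (z : 'I_n -> K) (z' : K),
       let X : 'End(prod_space) :=
         \sum_(l < n) z l *: prod_act sl2_e l
         + z' *: prod_act2 alpha sl2_e (n - j - 1) in
       L = <[nexp X (w_ alpha)]>%VS].

End Embedding.

End Defs.

Arguments fusion_product : clear implicits.
Arguments prod_space {K ty} M.
Arguments fp_orbit {K A} M _.
Arguments sh {K A} M _.
Arguments N_ {K ty} M alpha _.

(* Main.v *)
(** Embed [M^(2^N)] in the exterior power [Λ^N ((O/t^N)^2)], where [O = K[t]],
    so that the cyclic vector becomes the Plücker vector of the lattice
    [O (1, 0) + t^N O^2].  A point [exp (e (x) p) v] becomes the Plücker vector
    of [O (1, p) + t^N O^2], and the points of [sh] become tuples of [t]-stable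
    lattices [L_k] of colength [n_k], each containing the previous
    one.  By Nakayama's lemma such a tuple consists of members
    [Lambda_m = kappa_0 D kappa_1 D ... kappa_(m-1) D O^2] of one chain, where
    [D = diag (1, t)] and each [kappa_i] is either lower unitriangular or the
    transposition [w].  Moving all letters to generic ones puts the chain in
    the orbit of the base point, so that every tuple lies in the closure; it
    lies in the orbit itself exactly when [L_1] is not contained in [t O^2].
    Otherwise some inner letter is [w]; since [D w D = t w], that part of the
    chain is [t] times a chain whose lengths are smaller by two, and moving the
    letters of this contracted chain to generic ones, the tuple is seen to be a
    limit of points of one of the [N_j].  Conversely the points of [N_j] are such
    tuples, on which the coordinates detecting [L_1] outside [t O^2] vanish. *)


From HB Require Import structures.
Require Import Defs.
From mathcomp Require Import all_boot all_order all_algebra.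
From mathcomp Require Import classical_sets reals complex.
From mathcomp Require Import boolp mpoly zify fingroup perm ring.
Set Implicit Arguments.
Unset Strict Implicit.
Unset Printing Implicit Defensive.
Import GRing.Theory.

(** * Minors and Plücker coordinates *)

Section Minors.
Local Open Scope ring_scope.

(** No embedding of [M^(2^N)] in an exterior power is built. What is used is a family of linear
    forms [phi f], one per choice of columns, without common zero, for which the operators act
    column by column ([slot_op]); the exponential of such an operator multiplies the matrix of a
    decomposable vector by [1 + A], as [A] has square 0. The forms come from minors over K[t] / prod
    (t - z_i), whose extremal degree descends to the graded module. They have no common zero because
    2^N minors of (1, p) are independent as functions of p, while dim M <= 2^N.

    Closed conditions are checked in a chart where one coordinate is nonzero; membership in a
    closure is shown by a polynomial curve of matrices, each letter A becoming A + x E_00.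

    The parameter z of N_j comes from truncation. Contraction around w merges three letters into one
    at position j, but a lattice of colength j + 1 stops before w and sees only the first of them.
    So one lattice may have a last letter of its own, and after perturbation this changes the slope
    p by a multiple of t^(N al - 1). *)

Definition upd (T : Type) n (f : 'I_n -> T) (j : 'I_n) (c : T) : 'I_n -> T :=
  fun l => if l == j then c else f l.

(** The column choice [f] need not be increasing or injective, so a single column can be replaced
    freely. *)
Definition pluck (R : comNzRingType) n p (B : 'M[R]_(n, p)) (f : 'I_n -> 'I_p) : R :=
  \det (colsub f B).

Lemma pluck_mul (R : comNzRingType) n p (C : 'M[R]_n) (B : 'M[R]_(n, p)) f :
  pluck (C *m B) f = \det C * pluck B f.
Proof.
rewrite /pluck -det_mulmx; congr (\det _).
by apply/matrixP => i j; rewrite !mxE; apply: eq_bigr => k _; rewrite !mxE.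
Qed.

Lemma pluck_map (R S : comNzRingType) (h : {rmorphism R -> S}) n p
    (B : 'M[R]_(n, p)) f : pluck (map_mx h B) f = h (pluck B f).
Proof.
rewrite /pluck -det_map_mx; congr (\det _).
by apply/matrixP => i j; rewrite !mxE.
Qed.

Definition row_repl (R : comNzRingType) n (A C : 'M[R]_n) (i : 'I_n) : 'M[R]_n :=
  \matrix_(a, b) (if a == i then C a b else A a b).

(** Both sides are the coordinate [f] of the derivation induced by [X] on the n-th exterior power,
    applied to the product of the rows of [B]: the left side replaces columns, the right side
    replaces one row b_i by b_i X. In the Leibniz expansion of a permutation [s], column [j] is
    matched with row s^-1 j. *)
Lemma sum_pluck_upd (R : comNzRingType) n p (B : 'M[R]_(n, p)) (X : 'M_p) f :
  \sum_j \sum_c pluck B (upd f j c) * X c (f j) =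
  \sum_i \det (row_repl (colsub f B) (colsub f (B *m X)) i).
Proof.
have E j : \sum_c pluck B (upd f j c) * X c (f j) =
    \sum_(s : 'S_n) (-1) ^+ s * \prod_a
      (if s a == j then (B *m X) a (f j) else B a (f (s a))).
  rewrite (eq_bigr (fun c => \sum_(s : 'S_n) (-1) ^+ s *
     (\prod_a B a (upd f j c (s a)) * X c (f j)))); last first.
    move=> c _; rewrite /pluck /determinant mulr_suml; apply: eq_bigr => s _.
    by rewrite -mulrA; congr (_ * (_ * _)); apply: eq_bigr => a _; rewrite !mxE.
  rewrite exchange_big; apply: eq_bigr => s _; rewrite -mulr_sumr; congr (_ * _).
  have sj : s (s^-1%g j) = j by rewrite permKV.
  rewrite [RHS](bigD1 (s^-1%g j)) //= sj eqxx mxE mulr_suml.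
  apply: eq_bigr => c _; rewrite (bigD1 (s^-1%g j)) //= sj /upd eqxx mulrAC.
  congr (_ * _); apply: eq_bigr => a aj.
  by case: (s a =P j) aj => // <-; rewrite permK eqxx.
rewrite (eq_bigr _ (fun j _ => E j)) exchange_big.
rewrite /determinant [RHS]exchange_big; apply: eq_bigr => s _.
rewrite -!mulr_sumr; congr (_ * _).
rewrite (reindex_inj (@perm_inj _ s)); apply: eq_bigr => i _.
by apply: eq_bigr => a _; rewrite !mxE (inj_eq perm_inj); case: eqP => // ->.
Qed.

Lemma deriv_prod (R : comNzRingType) (I : finType) (F : I -> {poly R}) :
  (\prod_i F i)^`() = \sum_i \prod_j (if j == i then (F j)^`() else F j).
Proof.
have H (r : seq I) : uniq r -> (\prod_(i <- r) F i)^`() =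
    \sum_(i <- r) \prod_(j <- r) (if j == i then (F j)^`() else F j).
  elim: r => [|x r IH] /=; first by rewrite !big_nil -polyC1 derivC.
  case/andP=> xr /IH {}IH; rewrite big_cons derivM IH big_cons big_cons eqxx.
  congr (_ * _ + _).
    rewrite !big_seq; apply: eq_bigr => j jr.
    by case: eqP => // e; rewrite -e jr in xr.
  rewrite mulr_sumr !big_seq; apply: eq_bigr => j jr; rewrite big_cons.
  by case: eqP => // e; rewrite e jr in xr.
by apply: H; exact: index_enum_uniq.
Qed.

Lemma deriv_det (R : comNzRingType) n (A : 'M[{poly R}]_n) :
  (\det A)^`() = \sum_i \det (row_repl A (map_mx (@deriv R) A) i).
Proof.
rewrite /determinant raddf_sum exchange_big; apply: eq_bigr => s _ /=.
rewrite -mulr_sumr (_ : (-1) ^+ s = ((-1) ^+ s)%:P :> {poly R}); last first.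
  by rewrite rmorphXn rmorphN1.
rewrite mul_polyC derivZ -mul_polyC deriv_prod; congr (_ * _).
by apply: eq_bigr => i _; apply: eq_bigr => a _; rewrite !mxE.
Qed.

(* As X ^ 2 = 0, the derivative of 1 + s X is (1 + s X) X. *)
Lemma deriv_pluck_exp (R : comNzRingType) n p (B : 'M[R]_(n, p)) (X : 'M_p) f :
    X *m X = 0 ->
  let Bs := map_mx polyC B + 'X *: map_mx polyC (B *m X) in
  (pluck Bs f)^`() = \sum_j \sum_c pluck Bs (upd f j c) * (X c (f j))%:P.
Proof.
move=> X2 Bs.
have -> : \sum_j \sum_c pluck Bs (upd f j c) * (X c (f j))%:P =
   \sum_j \sum_c pluck Bs (upd f j c) * (map_mx polyC X) c (f j).
  by apply: eq_bigr => j _; apply: eq_bigr => c _; rewrite mxE.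
rewrite sum_pluck_upd /pluck deriv_det; apply: eq_bigr => i _; congr (\det _).
have BX : Bs *m map_mx polyC X = map_mx polyC (B *m X).
  by rewrite mulmxDl -scalemxAl -!map_mxM -mulmxA X2 mulmx0 map_mx0 scaler0 addr0.
apply/matrixP => a b; rewrite !mxE; case: eqP => // _.
rewrite -[LHS]/(_^`()) derivD derivM derivX mul1r !derivC mulr0 addr0 add0r.
by move/matrixP: BX => /(_ a (f b)); rewrite !mxE => ->.
Qed.

Lemma size_pluck_exp (R : idomainType) n p (B C : 'M[R]_(n, p)) f :
  (size (pluck (map_mx polyC B + 'X *: map_mx polyC C) f) <= n.+1)%N.
Proof.
apply: leq_trans (size_sum _ _ _) _; apply/bigmax_leqP => s _.
rewrite -[-1]/(- 1%:P) -polyCN -polyC_exp mul_polyC.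
apply: leq_trans (size_scale_leq _ _) _.
apply: leq_trans (size_poly_prod_leq _ _) _; rewrite card_ord.
set S := \sum_(i < n) _.
suff : (S <= n * 2)%N by lia.
rewrite -[n in (n * _)%N]card_ord -sum_nat_const; apply: leq_sum => i _.
rewrite !mxE; apply: leq_trans (size_polyD _ _) _; rewrite geq_max.
rewrite (leq_trans (size_polyC_leq1 _)) //=.
apply: leq_trans (size_polyMleq _ _) _; rewrite size_polyX.
by rewrite ltnS size_polyC_leq1.
Qed.
End Minors.

(** * Exponentials of operators acting column by column *)

Section Exponential.
Local Open Scope ring_scope.
Context {K : fieldType}.

Lemma iter_lfun0 (V : vectType K) (X : 'End(V)) k : iter k X 0 = 0.
Proof. by elim: k => //= k ->; rewrite linear0. Qed.

Lemma iter_lfun_eq0 (V : vectType K) (X : 'End(V)) m k u :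
  iter m X u = 0 -> (m <= k)%N -> iter k X u = 0.
Proof. by move=> h mk; rewrite -(subnK mk) iterD h iter_lfun0. Qed.

(** Up to its first zero the trajectory u, X u, ... is free, so its length is at most the dimension.
    Hence [nexp], truncated at the dimension, is exact at every vector killed by some power of
    [X]. *)
Lemma iter_dim_eq0 (V : vectType K) (X : 'End(V)) m u :
  iter m X u = 0 -> iter (\dim {:V}) X u = 0.
Proof.
move=> h; apply/eqP; apply: contraT => d0.
have exm : exists m, iter m X u == 0 by exists m; apply/eqP.
case: (ex_minnP exm) => j /eqP j0 jmin.
have dj : (\dim {:V} < j)%N.
  by rewrite ltnNge; apply: contra d0 => le; apply/eqP; apply: iter_lfun_eq0 le.
case: j j0 jmin dj => // j j0 jmin dj.
have fr : free (traject X u j.+1).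
  have {jmin} : iter j X u != 0 by apply/negP => /jmin; rewrite ltnn.
  elim: j u j0 {d0 h exm dj} => [|j IH] u j0 jn /=.
    by rewrite free_cons nil_free span_nil memv0 jn.
  rewrite free_cons; apply/andP; split; last first.
    by apply: IH; rewrite -iterSr.
  apply: contra jn => uS.
  (* [Y] is X^(j+1) as a linear map: it kills the span of X u, X^2 u, ... and would therefore kill
     [u]. *)
  pose Y := iter j.+1 (comp_lfun X) \1%VF.
  have YE v : Y v = iter j.+1 X v.
    by rewrite /Y; elim: j.+1 v => [|k IHk] v /=; rewrite ?id_lfunE // comp_lfunE IHk.
  rewrite -YE -memv_ker; apply: subvP uS; apply/span_subvP => v.
  rewrite -[_ :: _]/(traject X (X u) j.+1) => /trajectP[k kj ->]; rewrite memv_ker YE -iterSr -iterD.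
  by apply/eqP; apply: iter_lfun_eq0 j0 _; rewrite addSn addnS; lia.
have := dimvS (subvf <<traject X u j.+1>>%VS).
by rewrite (eqnP fr) size_traject leqNgt dj.
Qed.

Lemma sum_ord_vanish (V : nmodType) (F : nat -> V) a b : (a <= b)%N ->
  (forall k, (a <= k)%N -> F k = 0) -> \sum_(k < b) F k = \sum_(k < a) F k.
Proof.
move=> ab F0; rewrite -!(big_mkord xpredT F) (big_cat_nat (leq0n a) ab) /=.
by rewrite [X in _ + X]big_nat [X in _ + X]big1 ?addr0 // => k /andP[/F0].
Qed.

Lemma nexp_sum (V : vectType K) (X : 'End(V)) m u : iter m X u = 0 ->
  nexp X u = \sum_(k < m) (k`!%:R)^-1 *: iter k X u.
Proof.
move=> h.
(* [linfun] computes only functions known to be linear; [Y] is the same sum written with linear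
   maps. *)
pose Y : 'End(V) := \sum_(k < (\dim {:V}).+1) (k`!%:R : K)^-1 *: iter k (comp_lfun X) \1%VF.
have YE v : Y v = \sum_(k < (\dim {:V}).+1) (k`!%:R : K)^-1 *: iter k X v.
  rewrite sum_lfunE; apply: eq_bigr => k _; rewrite scale_lfunE; congr (_ *: _).
  by elim: (k : nat) v => [|j IH] v /=; rewrite ?id_lfunE // comp_lfunE IH.
have -> : nexp X = Y.
  apply/lfunP => v; rewrite /nexp (_ : (fun u : V => _) = Y) ?lfunE //.
  by apply/funext => w; rewrite YE.
rewrite YE; pose F k := (k`!%:R : K)^-1 *: iter k X u.
rewrite -/(\sum_(k < (\dim {:V}).+1) F k) -/(\sum_(k < m) F k).
have Fm k : (m <= k)%N -> F k = 0.
  by move=> mk; rewrite /F (iter_lfun_eq0 h mk) scaler0.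
have Fd k : ((\dim {:V}).+1 <= k)%N -> F k = 0.
  by move=> mk; rewrite /F (iter_lfun_eq0 (iter_dim_eq0 h) (ltnW mk)) scaler0.
by case: (leqP m (\dim {:V}).+1) => [|/ltnW] le; [|symmetry]; exact: sum_ord_vanish.
Qed.

(** The two exponentials are truncated at the dimensions of different spaces; nilpotency at [h u]
    makes both equal to the sum up to [m]. *)
Lemma nexp_morph (V W : vectType K) (h : 'Hom(V, W)) (X : 'End(V)) (Y : 'End(W)) m u :
    injective h -> (forall v, h (X v) = Y (h v)) -> iter m Y (h u) = 0 ->
  h (nexp X u) = nexp Y (h u).
Proof.
move=> hi hXY Ym; have it k : h (iter k X u) = iter k Y (h u).
  by elim: k => //= k <-.
rewrite (nexp_sum Ym) (nexp_sum (m := m)) ?linear_sum.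
  by apply: eq_bigr => k _; rewrite linearZ /= it.
by apply: hi; rewrite it Ym linear0.
Qed.

Context (I : finType) (N : I -> nat).

(** Index of a Plücker coordinate on a tensor product of exterior powers, the i-th one being of
    order [N i] on a space of dimension 2 [N i]. *)
Definition colfam := forall i, 'I_(N i) -> 'I_(N i + N i).

Definition updf (f : colfam) i (j : 'I_(N i)) c : colfam :=
  dfwith f (upd (f i) j c).

Lemma prod_updf (R : comNzRingType) (F : forall i, ('I_(N i) -> 'I_(N i + N i)) -> R)
    f i j c :
  \prod_l F l (@updf f i j c l) =
  F i (upd (f i) j c) * \prod_(l | l != i) F l (f l).
Proof.
rewrite (bigD1 i) //= /updf dfwith_in; congr (_ * _).
by apply: eq_bigr => l li; rewrite dfwith_out // eq_sym.
Qed.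

Context (U : vectType K) (phi : colfam -> 'Hom(U, K^o)).

(** In the coordinates [phi], the operator [X] is the sum over [i] of the derivations induced by
    [A i] on the i-th exterior power, in the column form of [sum_pluck_upd]. *)
Definition slot_op (X : 'End(U)) (A : forall i, 'M[K]_(N i + N i)) :=
  forall f u, phi f (X u) =
    \sum_i \sum_j \sum_c (phi (@updf f i j c) u : K) * A i c (f i j).

Definition has_plucker (u : U) (B : forall i, 'M[K]_(N i, N i + N i)) :=
  exists2 c : K, c != 0 & forall f, (phi f u : K) = c * \prod_i pluck (B i) (f i).

Context (char0 : [pchar K] =i pred0).
Context (phi_inj : forall u, (forall f, phi f u = 0) -> u = 0).

Let size_bound := (\sum_i N i).+1.

(** [Q f] is the product of the minors of B_i (1 + s A_i), a polynomial in s. By [deriv_pluck_exp],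
    [X] acts on coordinates as d/ds, so the m-th iterate has coordinates m! times the coefficient of
    s^m, and the exponential is the value at s = 1. *)
Lemma slot_op_iter X A B u (c : K) : slot_op X A -> (forall i, A i *m A i = 0) ->
    (forall f, (phi f u : K) = c * \prod_i pluck (B i) (f i)) ->
  exists Q : colfam -> {poly K},
    [/\ forall f, (size (Q f) <= size_bound)%N,
        forall f m, (phi f (iter m X u) : K) = c * (Q f)`_m * m`!%:R
      & forall f, (Q f).[1] = \prod_i pluck (B i *m (1%:M + A i)) (f i)].
Proof.
move=> XA A2 uB.
pose Bs i := map_mx polyC (B i) + 'X *: map_mx polyC (B i *m A i).
pose Q (f : colfam) := \prod_i pluck (Bs i) (f i).
have dQ f : (Q f)^`() = \sum_i \sum_j \sum_c Q (@updf f i j c) * (A i c (f i j))%:P.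
  rewrite deriv_prod; apply: eq_bigr => i _.
  rewrite (bigD1 i) //= eqxx deriv_pluck_exp //.
  rewrite (eq_bigr (fun j => pluck (Bs j) (f j))); last by move=> j /negbTE ->.
  rewrite mulr_suml; apply: eq_bigr => j _; rewrite mulr_suml; apply: eq_bigr => k _.
  by rewrite /Q (prod_updf (fun i => pluck (Bs i))) mulrAC.
exists Q; split.
- move=> f; apply: leq_trans (size_poly_prod_leq _ _) _.
  set S := (\sum_(_ | _) _)%N.
  rewrite -[#|_|]/(#|I|).
  suff : (S <= (\sum_i N i) + #|I|)%N by rewrite /size_bound; lia.
  rewrite -sum1_card -big_split /=; apply: leq_sum => i _.
  by rewrite addn1 size_pluck_exp.
- move=> f m; elim: m f => [|m IH] f.
    rewrite /= uB mulr1; congr (_ * _).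
    rewrite -horner_coef0 horner_prod; apply: eq_bigr => i _.
    have -> : (pluck (Bs i) (f i)).[0] = horner_eval 0 (pluck (Bs i) (f i)) by [].
    rewrite -pluck_map; congr (pluck _ _); apply/matrixP => a b.
    by rewrite !mxE /= /horner_eval !hornerE.
  rewrite /= XA factS natrM mulrA.
  have -> : c * (Q f)`_m.+1 * m.+1%:R = c * ((Q f)^`())`_m.
    by rewrite coef_deriv mulr_natr mulrnAr.
  rewrite dQ coef_sum mulr_sumr mulr_suml; apply: eq_bigr => i _.
  rewrite coef_sum mulr_sumr mulr_suml; apply: eq_bigr => j _.
  rewrite coef_sum mulr_sumr mulr_suml; apply: eq_bigr => k _.
  by rewrite IH coefMC mulrA mulrAC.
- move=> f; rewrite horner_prod; apply: eq_bigr => i _.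
  have -> : (pluck (Bs i) (f i)).[1] = horner_eval 1 (pluck (Bs i) (f i)) by [].
  rewrite -pluck_map mulmxDr mulmx1; congr (pluck _ _); apply/matrixP => a b.
  by rewrite !mxE /= /horner_eval !hornerE.
Qed.

Lemma slot_op_nilp X A B u : slot_op X A -> (forall i, A i *m A i = 0) ->
  has_plucker u B -> iter size_bound X u = 0.
Proof.
move=> XA A2 [c c0 uB]; have [Q [Qs QX _]] := slot_op_iter XA A2 uB.
by apply: phi_inj => f; rewrite QX nth_default ?mulr0 ?mul0r.
Qed.

Lemma slot_op_exp X A B u (c : K) : slot_op X A -> (forall i, A i *m A i = 0) ->
    (forall f, (phi f u : K) = c * \prod_i pluck (B i) (f i)) ->
  forall f, (phi f (\sum_(k < size_bound) (k`!%:R)^-1 *: iter k X u) : K) =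
    c * \prod_i pluck (B i *m (1%:M + A i)) (f i).
Proof.
move=> XA A2 uB f; have [Q [Qs QX Q1]] := slot_op_iter XA A2 uB.
rewrite linear_sum -Q1 (horner_coef_wide _ (Qs f)) mulr_sumr.
apply: eq_bigr => k _; rewrite linearZ /= QX expr1n mulr1.
rewrite -[LHS]/(_ * _) mulrC mulfK //.
by have /pcharf0P -> := char0; rewrite -lt0n fact_gt0.
Qed.

Lemma has_plucker_nexp X A B u : slot_op X A -> (forall i, A i *m A i = 0) ->
  has_plucker u B -> has_plucker (nexp X u) (fun i => B i *m (1%:M + A i)).
Proof.
move=> XA A2 uB; have Xn := slot_op_nilp XA A2 uB.
case: uB => c c0 uB; exists c => // f.
by rewrite (nexp_sum Xn) (slot_op_exp XA A2 uB).
Qed.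

End Exponential.

(** * Zariski closures *)

Lemma dep_choice (I : Type) (T : I -> Type) (Q : forall i, T i -> Prop) :
  (forall i, exists x, Q i x) -> exists f : forall i, T i, forall i, Q i (f i).
Proof. by move=> H; exists (fun i => sval (cid (H i))) => i; exact: svalP. Qed.

Section FunctionRings.
Local Open Scope ring_scope.
Context {K : fieldType} {T : Type}.

(** Serves for two rings: the polynomial functions of a parameter ([poly_fun]) and the regular
    functions on a chart ([chart_fun]). *)
Definition fun_subring (P : (T -> K) -> Prop) :=
  [/\ forall c, P (fun=> c),
      forall F G, P F -> P G -> P (fun t => F t + G t)
    & forall F G, P F -> P G -> P (fun t => F t * G t)].

Context (P : (T -> K) -> Prop) (PR : fun_subring P).

Lemma fun_subring_sum J (r : seq J) (Q : pred J) F : (forall j, P (F j)) ->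
  P (fun t => \sum_(j <- r | Q j) F j t).
Proof.
move=> PF; have [Pc PD PM] := PR; elim: r => [|j r IH].
  by rewrite (_ : (fun _ => _) = fun=> 0) //; apply/funext => t; rewrite big_nil.
case Qj : (Q j); last first.
  by rewrite (_ : (fun _ => _) = fun t => \sum_(j <- r | Q j) F j t) //;
     apply/funext => t; rewrite big_cons Qj.
rewrite (_ : (fun _ => _) = fun t => F j t + \sum_(j <- r | Q j) F j t); first exact: PD.
by apply/funext => t; rewrite big_cons Qj.
Qed.

Lemma fun_subring_prod J (r : seq J) (Q : pred J) F : (forall j, P (F j)) ->
  P (fun t => \prod_(j <- r | Q j) F j t).
Proof.
move=> PF; have [Pc PD PM] := PR; elim: r => [|j r IH].
  by rewrite (_ : (fun _ => _) = fun=> 1) //; apply/funext => t; rewrite big_nil.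
case Qj : (Q j); last first.
  by rewrite (_ : (fun _ => _) = fun t => \prod_(j <- r | Q j) F j t) //;
     apply/funext => t; rewrite big_cons Qj.
rewrite (_ : (fun _ => _) = fun t => F j t * \prod_(j <- r | Q j) F j t); first exact: PM.
by apply/funext => t; rewrite big_cons Qj.
Qed.

Lemma fun_subring_sub F G : P F -> P G -> P (fun t => F t - G t).
Proof.
have [Pc PD PM] := PR => PF PG.
rewrite (_ : (fun _ => _) = fun t => F t + (-1) * G t); first exact/PD/PM.
by apply/funext => t; rewrite mulN1r.
Qed.

Lemma fun_subring_exp F k : P F -> P (fun t => F t ^+ k).
Proof.
have [Pc PD PM] := PR => PF; elim: k => [|k IH].
  by rewrite (_ : (fun _ => _) = fun=> 1) //; apply/funext => t; rewrite expr0.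
rewrite (_ : (fun _ => _) = fun t => F t * F t ^+ k); first exact: PM.
by apply/funext => t; rewrite exprS.
Qed.

Lemma fun_subring_mulmx m n p (A : T -> 'M[K]_(m, n)) (B : T -> 'M[K]_(n, p)) :
  (forall i j, P (fun t => A t i j)) -> (forall i j, P (fun t => B t i j)) ->
  forall i j, P (fun t => (A t *m B t) i j).
Proof.
have [Pc PD PM] := PR => PA PB i j.
rewrite (_ : (fun _ => _) = fun t => \sum_k A t i k * B t k j).
  by apply: fun_subring_sum => k; exact: PM.
by apply/funext => t; rewrite mxE.
Qed.

Lemma fun_subring_pluck n p (B : T -> 'M[K]_(n, p)) f :
  (forall i j, P (fun t => B t i j)) -> P (fun t => pluck (B t) f).
Proof.
have [Pc PD PM] := PR => PB.
rewrite (_ : (fun _ => _) = fun t => \sum_(s : {perm 'I_n}) (-1) ^+ s * \prod_i B t i (f (s i))).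
  by apply: fun_subring_sum => s; apply: PM => //; apply: fun_subring_prod.
apply/funext => t; apply: eq_bigr => s _; congr (_ * _).
by apply: eq_bigr => i _; rewrite mxE.
Qed.

Lemma fun_subring_meval n (p : {mpoly K[n]}) (v : T -> 'I_n -> K) :
  (forall i, P (fun t => v t i)) -> P (fun t => p.@[v t]).
Proof.
have [Pc PD PM] := PR => Pv.
rewrite (_ : (fun _ => _) = fun t => \sum_(m <- msupp p) p@_m * \prod_i v t i ^+ m i).
  apply: fun_subring_sum => m; apply: PM => //.
  by apply: fun_subring_prod => i; exact: fun_subring_exp.
by apply/funext => t; rewrite mevalE.
Qed.

End FunctionRings.

Section PolyFun.
Local Open Scope ring_scope.
Context {K : fieldType} (char0 : [pchar K] =i pred0).

Definition poly_fun (F : K -> K) := exists q : {poly K}, forall x, F x = q.[x].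

Lemma poly_fun_subring : fun_subring poly_fun.
Proof.
split=> [c|F G [p Fp] [q Gq]|F G [p Fp] [q Gq]].
- by exists c%:P => x; rewrite hornerC.
- by exists (p + q) => x; rewrite hornerD Fp Gq.
- by exists (p * q) => x; rewrite hornerM Fp Gq.
Qed.

Lemma poly_eq0 (q : {poly K}) : (forall x, q.[x] = 0) -> q = 0.
Proof.
move=> q0; apply/eqP; apply: contraT => qn.
have natI : injective (fun k : nat => k%:R : K).
  have H a b : (a <= b)%N -> a%:R = b%:R :> K -> a = b.
    move=> ab /esym/eqP; rewrite -subr_eq0 -natrB //.
    by have /pcharf0P -> := char0; rewrite subn_eq0 => ba; apply/eqP; rewrite eqn_leq ab.
  by move=> a b; case/orP: (leq_total a b) => /H // h /esym/h.
have := max_poly_roots (rs := [seq k%:R | k <- iota 0 (size q)]) qn.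
rewrite map_inj_uniq // iota_uniq size_map size_iota ltnn => /(_ _ isT) H.
by have : false by apply: H; apply/allP => x _; rewrite /root q0.
Qed.

(** The product of [r] with the polynomial of [F] vanishes at every point, hence is zero since the
    field is infinite. *)
Lemma poly_fun_eq0 F r : poly_fun F -> r != 0 :> {poly K} ->
  (forall x, r.[x] != 0 -> F x = 0) -> forall x, F x = 0.
Proof.
move=> [q Fq] r0 H x; suff : r * q = 0.
  by move/eqP; rewrite mulf_eq0 (negbTE r0) Fq => /eqP ->; rewrite horner0.
apply: poly_eq0 => y; rewrite hornerM.
have [->|yn] := eqVneq r.[y] 0; first by rewrite mul0r.
by rewrite -Fq H ?mulr0.
Qed.

End PolyFun.

(** * Closures tested by homogeneous forms, charts and curves *)

Section Closure.
Local Open Scope ring_scope.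
Local Open Scope classical_set_scope.
Context {K : fieldType}.

Lemma lfun_of_linear (V W : vectType K) (f : V -> W) : linear f ->
  exists h : 'Hom(V, W), forall u, h u = f u.
Proof.
move=> fl; pose g : {linear V -> W} := HB.pack f (GRing.isLinear.Build K V W _ f fl).
by exists (linfun g) => u; rewrite lfunE.
Qed.

(** Evaluation by all the [psi f] is an injective map into K^F; composing [h] with a left inverse of
    it gives the coefficients. *)
Lemma joint_inj_span (U : vectType K) (F : finType) (psi : F -> 'Hom(U, K^o)) :
    (forall u, (forall f, psi f u = 0) -> u = 0) ->
  forall h : 'Hom(U, K^o), exists c : F -> K,
    forall u, (h u : K) = \sum_f c f * psi f u.
Proof.
move=> inj h.
have [G GE] : exists G : 'Hom(U, {ffun F -> K^o}), forall u, G u = [ffun f => psi f u].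
  apply: lfun_of_linear => a u v; apply/ffunP => f.
  by rewrite !ffunE linearP.
have Gi : lker G == 0%VS.
  apply/lker0P => u v /eqP; rewrite -subr_eq0 -linearB => /eqP e.
  apply/eqP; rewrite -subr_eq0; apply/eqP/inj => f.
  by move/ffunP: e => /(_ f); rewrite /= GE !ffunE.
pose d f : {ffun F -> K^o} := [ffun f' => (f' == f)%:R].
exists (fun f => h ((G^-1)%VF (d f))) => u.
rewrite -{1}[u](lker0_lfunK Gi).
have -> : G u = \sum_f (psi f u : K) *: d f.
  apply/ffunP => f; rewrite GE sum_ffunE ffunE (bigD1 f) //= big1 ?addr0.
    by rewrite !ffunE eqxx -[RHS]/(_ * _) mulr1.
  by move=> g gf; rewrite !ffunE eq_sym (negbTE gf) scaler0.
rewrite !linear_sum; apply: eq_bigr => f _; rewrite !linearZ /=.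
by rewrite mulrC.
Qed.

Section HomogFun.
Context (V : vectType K).

Definition hom_fun d (F : V -> K) :=
  exists2 p : {mpoly K[\dim {:V}]}, p \is d.-homog &
    forall u, F u = p.@[fun i => coord (vbasis {:V}) i u].

Lemma hom_fun_const c : hom_fun 0 (fun=> c).
Proof.
exists c%:MP => [|u]; last by rewrite mevalC.
by rewrite -alg_mpolyC dhomogZ // dhomog1.
Qed.

Lemma hom_funD d F G : hom_fun d F -> hom_fun d G -> hom_fun d (fun u => F u + G u).
Proof.
move=> [p hp Fp] [q hq Gq]; exists (p + q); first exact: dhomogD.
by move=> u; rewrite mevalD Fp Gq.
Qed.

Lemma hom_funM d e F G : hom_fun d F -> hom_fun e G ->
  hom_fun (d + e) (fun u => F u * G u).
Proof.
move=> [p hp Fp] [q hq Gq]; exists (p * q); first exact: dhomogM.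
by move=> u; rewrite mevalM Fp Gq.
Qed.

Lemma hom_fun_ext d F G : F =1 G -> hom_fun d F -> hom_fun d G.
Proof. by move=> FG [p hp Fp]; exists p => // u; rewrite -FG. Qed.

Lemma hom_fun_exp d F k : hom_fun d F -> hom_fun (d * k) (fun u => F u ^+ k).
Proof.
move=> hF; elim: k => [|k IH].
  by rewrite muln0; apply: hom_fun_ext (hom_fun_const 1) => u; rewrite expr0.
by rewrite mulnS; apply: hom_fun_ext (hom_funM hF IH) => u; rewrite exprS.
Qed.

Lemma hom_fun_sum d J (r : seq J) F : (forall j, hom_fun d (F j)) ->
  hom_fun d (fun u => \sum_(j <- r) F j u).
Proof.
move=> hF; elim: r => [|j r IH].
  by exists 0 => [|u]; rewrite ?dhomog0 // big_nil meval0.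
by apply: hom_fun_ext (hom_funD (hF j) IH) => u; rewrite big_cons.
Qed.

Lemma hom_fun_prod J (r : seq J) (d : J -> nat) F : (forall j, hom_fun (d j) (F j)) ->
  hom_fun (\sum_(j <- r) d j)%N (fun u => \prod_(j <- r) F j u).
Proof.
move=> hF; elim: r => [|j r IH].
  by rewrite big_nil; apply: hom_fun_ext (hom_fun_const 1) => u; rewrite big_nil.
by rewrite big_cons; apply: hom_fun_ext (hom_funM (hF j) IH) => u; rewrite big_cons.
Qed.

Lemma hom_fun_lin (h : 'Hom(V, K^o)) : hom_fun 1 h.
Proof.
apply: (@hom_fun_ext _ (fun u => \sum_(i < \dim {:V}) h (vbasis {:V})`_i * coord (vbasis {:V}) i u)).
  move=> u; rewrite {2}(coord_vbasis (memvf u)) linear_sum.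
  by apply: eq_bigr => i _; rewrite linearZ mulrC.
apply: hom_fun_sum => i; apply: (hom_funM (hom_fun_const _)).
exists 'X_i => [|u]; last by rewrite mevalXU.
by rewrite dhomogX /= mdeg1.
Qed.

End HomogFun.

Lemma hom_fun_comp (V W : vectType K) (h : 'Hom(V, W)) d F :
  hom_fun d F -> hom_fun d (F \o h).
Proof.
move=> [p hp Fp]; apply: (@hom_fun_ext _ _ (fun u => \sum_(m <- msupp p) p@_m *
   \prod_(i < \dim {:W}) coord (vbasis {:W}) i (h u) ^+ m i)).
  by move=> u; rewrite /= Fp mevalE.
have H m : mdeg m = d -> hom_fun d (fun u : V => p@_m *
   \prod_(i < \dim {:W}) coord (vbasis {:W}) i (h u) ^+ m i).
  move=> <-; rewrite mdegE -[X in hom_fun X]add0n; apply: (hom_funM (hom_fun_const _ _)).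
  apply: (@hom_fun_prod V _ _ (fun i => m i)) => i.
  rewrite -[X in hom_fun X]mul1n; apply: hom_fun_exp.
  have [g gE] : exists g : 'Hom(V, K^o), forall u, g u = coord (vbasis {:W}) i (h u).
    by apply: lfun_of_linear => a u v; rewrite !linearP.
  exact: hom_fun_ext gE (hom_fun_lin g).
have : all (fun m => mdeg m == d) (msupp p).
  by apply/allP => m mp; apply/eqP/(dhomog_mf hp).
elim: (msupp p) => [_|m r IH /= /andP[/eqP md] /IH {}IH].
  by exists 0 => [|u]; rewrite ?dhomog0 // big_nil meval0.
by apply: hom_fun_ext (hom_funD (H m md) IH) => u; rewrite big_cons.
Qed.

Section Closed.
Context (V : vectType K).
Implicit Types (S : set {vspace V}) (L : {vspace V}).

Lemma zariski_closureP S L : zariski_closure S L <->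
  \dim L = 1%N /\ forall d F, hom_fun d F ->
    (forall L' u, S L' -> u \in L' -> F u = 0) -> forall u, u \in L -> F u = 0.
Proof.
split=> -[d1 H]; split=> // d.
  move=> F [p hp Fp] SF u uL; rewrite Fp; apply: (H d p hp _ u uL) => L' SL' v vL'.
  by rewrite -Fp; exact: SF vL'.
move=> p hp Sp u uL; apply: (H d (fun u => p.@[fun i => coord (vbasis {:V}) i u]) _ _ u uL).
  by exists p.
by move=> L' v SL'; exact: Sp.
Qed.

Lemma zariski_closure_trans S S' : S `<=` zariski_closure S' ->
  zariski_closure S `<=` zariski_closure S'.
Proof.
move=> SS' L /zariski_closureP[d1 H]; apply/zariski_closureP; split=> // d F hF F0.
by apply: (H d F hF) => L' u /SS'/zariski_closureP[_ H'] ; exact: H' hF F0 u.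
Qed.

Lemma zariski_closure_lin S L (h : 'Hom(V, K^o)) :
    (forall L' u, S L' -> u \in L' -> h u = 0) ->
  zariski_closure S L -> forall u, u \in L -> h u = 0.
Proof.
by move=> h0 /zariski_closureP[_ H]; exact: H (hom_fun_lin h) h0.
Qed.

(* The functions u |-> F u / lambda u ^ d, F homogeneous of degree d: the
   regular functions of the chart lambda <> 0. *)
Definition chart_fun (lambda : 'Hom(V, K^o)) (G : V -> K) :=
  exists d, exists2 F, hom_fun d F &
    forall u, lambda u != 0 -> F u = G u * (lambda u : K) ^+ d.

Lemma chart_fun_subring lambda : fun_subring (chart_fun lambda).
Proof.
split=> [c|F G|F G].
- by exists 0%N, (fun=> c) => [|u _]; [exact: hom_fun_const | rewrite mulr1].
- move=> [d [F' hF FE]] [e [G' hG GE]].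
  exists (d + e)%N, (fun u => F' u * (lambda u : K) ^+ e + G' u * (lambda u : K) ^+ d).
    apply: hom_funD.
      by rewrite -[e in (_ + e)%N]mul1n; exact: hom_funM hF (hom_fun_exp _ (hom_fun_lin _)).
    by rewrite addnC -[d in (_ + d)%N]mul1n; exact: hom_funM hG (hom_fun_exp _ (hom_fun_lin _)).
  by move=> u l0; rewrite FE // GE // -!mulrA -!exprD [(e + d)%N]addnC mulrDl.
- move=> [d [F' hF FE]] [e [G' hG GE]].
  exists (d + e)%N, (fun u => F' u * G' u); first exact: hom_funM.
  by move=> u l0; rewrite FE // GE // exprD mulrACA.
Qed.

Lemma chart_fun_lin lambda (h : 'Hom(V, K^o)) :
  chart_fun lambda (fun u => (h u : K) / lambda u).
Proof.
exists 1%N, h => [|u l0]; first exact: hom_fun_lin.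
by rewrite expr1 divfK.
Qed.

Lemma chart_fun_closed S L lambda G : chart_fun lambda G ->
    (forall L' u, S L' -> u \in L' -> lambda u != 0 -> G u = 0) ->
  zariski_closure S L -> forall u, u \in L -> lambda u != 0 -> G u = 0.
Proof.
move=> [d [F hF FE]] G0 /zariski_closureP[_ H] u uL l0.
(* The extra factor [lambda] makes the form vanish also at the points of [S] where [lambda] is
   zero. *)
have := H (1 + d)%N (fun u => (lambda u : K) * F u) (hom_funM (hom_fun_lin _) hF) _ u uL.
move=> e; have /eqP : (lambda u : K) * F u = 0.
  apply: e => L' v SL' vL'; have [->|v0] := eqVneq (lambda v) 0; first exact: mul0r.
  by rewrite FE // (G0 _ _ SL' vL' v0) mul0r mulr0.
rewrite mulf_eq0 (negbTE l0) FE // mulf_eq0 expf_eq0 (negbTE l0) andbF orbF.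
by move/eqP.
Qed.

End Closed.

(** Linear forms that vanish on the image of [h] vanish on the closure, so its lines lie in the
    image; forms are then transported by [h] and its left inverse. *)
Lemma zariski_closure_inj (V W : vectType K) (h : 'Hom(V, W)) (S : set {vspace V}) :
    injective h ->
  [set (h @: L)%VS | L in zariski_closure S] =
  zariski_closure [set (h @: L)%VS | L in S].
Proof.
move=> hi; have hk : lker h == 0%VS by apply/lker0P.
have di L : \dim (h @: L)%VS = \dim L.
  by apply: limg_dim_eq; rewrite (eqP hk) capv0.
apply/seteqP; split=> [_ [L /zariski_closureP[d1 H] <-]|L' cl].
  apply/zariski_closureP; split; first by rewrite di.
  move=> d F hF F0 u /memv_imgP[v vL ->].
  apply: (H d (F \o h) (hom_fun_comp h hF) _ v vL) => L' w SL' wL' /=.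
  apply: (F0 (h @: L')%VS); first by exists L'.
  exact: memv_img.
have L'h : (L' <= limg h)%VS.
  apply/subvP => u uL; pose pr := projv (limg h).
  have e : forall u, u \in L' -> u - pr u = 0.
    move=> {uL}u uL; apply/eqP; apply: contraT => un.
    have [i ci] : exists i, coord (vbasis {:W}) i (u - pr u) != 0.
      apply/existsP; apply: contraNT un; rewrite negb_exists => /forallP c0.
      rewrite (coord_vbasis (memvf (u - pr u))) big1 // => i _.
      by have := c0 i; rewrite negbK => /eqP ->; rewrite scale0r.
    have [g gE] : exists g : 'Hom(W, K^o), forall u, g u = coord (vbasis {:W}) i (u - pr u).
      have [g gE] : exists g : 'Hom(W, K^o), forall u, g u = coord (vbasis {:W}) i ((\1 - pr)%VF u).
        by apply: lfun_of_linear => a x y; rewrite !linearP.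
      by exists g => x; rewrite gE add_lfunE opp_lfunE id_lfunE.
    rewrite -gE (zariski_closure_lin _ cl uL) ?eqxx // in ci.
    move=> _ w [L _ <-] wL; rewrite gE projv_id ?subrr ?linear0 //.
    by apply: subvP wL; rewrite limgS // subvf.
  have := e u uL => /eqP; rewrite subr_eq0 => /eqP ->; exact: memv_proj.
exists (h @^-1: L')%VS; last by rewrite lpreimK.
have hL : (h @: (h @^-1: L') = L')%VS by rewrite lpreimK.
case/zariski_closureP: cl => d1 H; apply/zariski_closureP; split.
  by rewrite -di hL.
move=> d F hF F0 u uL.
have -> : F u = (F \o (h^-1)%VF) (h u) by rewrite /= lker0_lfunK.
apply: (H d _ (hom_fun_comp _ hF)); last by rewrite -hL memv_img.
by move=> _ w [L SL <-] /memv_imgP[v vL ->] /=; rewrite lker0_lfunK //; exact: F0 vL.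
Qed.

Context (char0 : [pchar K] =i pred0).
Context (I : finType) (N : I -> nat) (U : vectType K) (phi : colfam N -> 'Hom(U, K^o)).
Context (phi_inj : forall u, (forall f, phi f u = 0) -> u = 0).

(** This is a limit at x = 0 of a curve of which only the matrices [B x] are polynomial in x; the
    vectors carry an uncontrolled scalar for each x. A form on [U], written in the coordinates
    [phi], becomes a polynomial in x, and the scalar is harmless because the form vanishes on the
    whole line. *)
Lemma zariski_closure_limit (S : set {vspace U}) (r : {poly K})
    (B : K -> forall i, 'M[K]_(N i, N i + N i)) w :
    r != 0 -> (forall i a b, poly_fun (fun x => B x i a b)) ->
    (forall x, r.[x] != 0 -> exists L u, [/\ S L, u \in L & has_plucker phi u (B x)]) ->
    w != 0 -> has_plucker phi w (B 0) ->
  zariski_closure S <[w]>%VS.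
Proof.
move=> r0 Bp BS w0 [c c0 wB].
(* A finite copy of [colfam N], over which sums can be taken. *)
pose F := {dffun forall i, {ffun 'I_(N i) -> 'I_(N i + N i)}}.
pose ext (f : F) : colfam N := fun i => f i.
have inj u : (forall f : F, phi (ext f) u = 0) -> u = 0.
  move=> h; apply: phi_inj => f.
  rewrite (_ : f = ext [ffun i => finfun (f i)]) //.
  by apply/functional_extensionality_dep => i; apply/funext => j; rewrite /ext !ffunE.
have coords i : exists k : F -> K, forall u : U,
    coord (vbasis {:U}) i u = \sum_f k f * phi (ext f) u.
  have [g gE] : exists g : 'Hom(U, K^o), forall u, g u = coord (vbasis {:U}) i u.
    by apply: lfun_of_linear => a x y; rewrite linearP.
  have [k kE] := joint_inj_span inj g.
  by exists k => u; rewrite -gE kE.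
have {coords}[k kE] := choice coords.
apply/zariski_closureP; split; first by rewrite dim_vline w0.
move=> d P [p hp Pp] P0 u /vlineP[a ->].
(* The value of [P] at the vector whose coordinates are a c times the products of minors of [B x];
   when r(x) is nonzero, such a vector lies on a line of [S]. *)
pose q x := p.@[fun i => \sum_f k i f * (a * c * \prod_l pluck (B x l) (f l))].
have [pc pD pM] := poly_fun_subring (K := K).
have qp : poly_fun q.
  apply: (fun_subring_meval poly_fun_subring) => i.
  apply: (fun_subring_sum poly_fun_subring) => f; apply: (pM _ _ (pc _)).
  apply: (pM _ _ (pc _)); apply: (fun_subring_prod poly_fun_subring) => l.
  exact: (fun_subring_pluck poly_fun_subring).
have -> : P (a *: w) = q 0.
  rewrite Pp /q; apply: meval_eq => i; rewrite kE; apply: eq_bigr => f _.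
  by rewrite linearZ /= -mulrA -wB.
apply: (poly_fun_eq0 char0 qp r0) => x /BS[L [v [SL vL [e e0 vB]]]].
suff <- : P ((a * c / e) *: v) = q x by apply: (P0 L) => //; exact: memvZ.
rewrite Pp /q; apply: meval_eq => i; rewrite kE; apply: eq_bigr => f _.
by rewrite linearZ /= -[_ *: _]/(_ * _) vB [_ * (e * _)]mulrA divfK.
Qed.

End Closure.

(** * Chains of lattices in K[t]^2 *)

Section Lattices.
Local Open Scope ring_scope.
Context {K : fieldType}.
Local Notation P := {poly K}.
Local Notation vec := 'cV[{poly K}]_2.

Lemma cV2P (R : Type) (y z : 'cV[R]_2) : y 0 0 = z 0 0 -> y 1 0 = z 1 0 -> y = z.
Proof.
move=> h0 h1; apply/matrixP => i j; rewrite !ord1; case: i => [[|[|//]] i] /=.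
  by rewrite (_ : Ordinal i = 0) //; exact: val_inj.
by rewrite (_ : Ordinal i = 1) //; exact: val_inj.
Qed.

Lemma mulmx2E (R : pzSemiRingType) n (A : 'M[R]_2) (B : 'M[R]_(2, n)) i j :
  (A *m B) i j = A i 0 * B 0 j + A i 1 * B 1 j.
Proof.
rewrite mxE !big_ord_recl big_ord0 addr0; congr (A i _ * B _ j + A i _ * B _ j); exact: val_inj.
Qed.

Lemma poly_split (p : P) : p = (p`_0)%:P + 'X * drop_poly 1 p.
Proof.
rewrite -{1}(poly_take_drop 1 p) mulrC expr1; congr (_ + _).
apply/polyP => i; rewrite coef_take_poly coefC; by case: i.
Qed.

(** Reduction modulo t^N: rows of length N + N stand for (O / t^N)^2. *)
Definition tau N (y : vec) : 'rV[K]_(N + N) :=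
  row_mx (poly_rV (y 0 0)) (poly_rV (y 1 0)).

Definition untau N (r : 'rV[K]_(N + N)) : vec :=
  \col_i rVpoly (if i == 0 then lsubmx r else rsubmx r).

Lemma tauD N y z : tau N (y + z) = tau N y + tau N z.
Proof. by rewrite /tau !mxE !linearD add_row_mx. Qed.

Lemma tauZ N c y : tau N (c%:P *: y) = c *: tau N y.
Proof. by rewrite /tau !mxE !mul_polyC !linearZ scale_row_mx. Qed.

Lemma tau0 N : tau N 0 = 0.
Proof. by rewrite /tau !mxE !linear0 row_mx0. Qed.

Lemma tau_sum N J (r : seq J) (F : J -> vec) :
  tau N (\sum_(j <- r) F j) = \sum_(j <- r) tau N (F j).
Proof. by elim: r => [|j r IH]; rewrite ?big_nil ?tau0 // !big_cons tauD IH. Qed.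

Lemma untauK N r : tau N (untau r) = r.
Proof. by rewrite /tau /untau !mxE /= !rVpolyK hsubmxK. Qed.

Lemma untauD N (r s : 'rV_(N + N)) : untau (r + s) = untau r + untau s.
Proof. by apply: cV2P; rewrite !mxE /= !linearD. Qed.

Lemma untauZ N c (r : 'rV_(N + N)) : untau (c *: r) = c%:P *: untau r.
Proof. by apply: cV2P; rewrite !mxE /= !linearZ /= mul_polyC. Qed.

Lemma untau0 N : untau (0 : 'rV_(N + N)) = 0.
Proof. by apply: cV2P; rewrite !mxE /= !linear0. Qed.

Lemma untau_sum N J (r : seq J) (F : J -> 'rV_(N + N)) :
  untau (\sum_(j <- r) F j) = \sum_(j <- r) untau (F j).
Proof. by elim: r => [|j r IH]; rewrite ?big_nil ?untau0 // !big_cons untauD IH. Qed.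

Lemma tau_coef N (y z : vec) : (forall k, (k < N)%N -> (y 0 0)`_k = (z 0 0)`_k) ->
  (forall k, (k < N)%N -> (y 1 0)`_k = (z 1 0)`_k) -> tau N y = tau N z.
Proof.
by move=> h0 h1; congr (row_mx _ _); apply/rowP => k; rewrite !mxE ?h0 ?h1.
Qed.

Lemma tau_eq_coef N (y z : vec) : tau N y = tau N z ->
  forall k, (k < N)%N -> (y 0 0)`_k = (z 0 0)`_k /\ (y 1 0)`_k = (z 1 0)`_k.
Proof.
move=> /eq_row_mx[/rowP e0 /rowP e1] k kN.
by have := e0 (Ordinal kN); have := e1 (Ordinal kN); rewrite !mxE /=.
Qed.

Lemma tau_Xn N n z : (N <= n)%N -> tau N ('X^n *: z) = 0.
Proof.
move=> Nn; rewrite -(tau0 N); apply: tau_coef => k kN; rewrite !mxE coefXnM coef0.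
  by rewrite (leq_trans kN Nn).
by rewrite (leq_trans kN Nn).
Qed.

Lemma tau_eq N y z : tau N y = tau N z -> exists x, y = z + 'X^N *: x.
Proof.
move=> /tau_eq_coef e; exists (\col_i drop_poly N ((y - z) i 0)).
have H i : (forall k, (k < N)%N -> ((y - z) i 0)`_k = 0) ->
    y i 0 = z i 0 + 'X^N * drop_poly N ((y - z) i 0).
  move=> h; have := poly_take_drop N ((y - z) i 0).
  rewrite (_ : take_poly _ _ = 0) ?add0r; last first.
    by apply/polyP => k; rewrite coef_take_poly coef0; case: ltnP => // /h ->.
  by rewrite mulrC => ->; rewrite !mxE [RHS]addrC subrK.
apply: cV2P; rewrite [RHS]mxE [X in _ + X]mxE [X in _ * X]mxE; apply: H => k /e[e0 e1].
  by rewrite !mxE coefB e0 subrr.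
by rewrite !mxE coefB e1 subrr.
Qed.

(** For N' <= N this is the matrix of [A] as a map from (O / t^N)^2 to (O / t^N')^2 ([tau_mulm]). It
    acts on rows from the right, so products are reversed in [mulm_mul]. *)
Definition mulm N N' (A : 'M[P]_2) : 'M[K]_(N + N, N' + N') :=
  \matrix_i tau N' (A *m untau (delta_mx 0 i)).

Lemma mul_mulm N N' A (r : 'rV[K]_(N + N)) :
  r *m mulm N N' A = tau N' (A *m untau r).
Proof.
rewrite [in RHS](row_sum_delta r) mulmx_sum_row untau_sum mulmx_sumr tau_sum.
by apply: eq_bigr => i _; rewrite untauZ -scalemxAr tauZ rowK.
Qed.

Lemma tau_mulm N N' A y : (N' <= N)%N -> tau N y *m mulm N N' A = tau N' (A *m y).
Proof.
move=> NN; rewrite mul_mulm.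
have [x ->] := tau_eq (untauK (tau N y)).
by rewrite mulmxDr -scalemxAr tauD tau_Xn // addr0.
Qed.

Lemma mulm_mul N N' N'' A A' : (N'' <= N')%N ->
  mulm N N' A *m mulm N' N'' A' = mulm N N'' (A' *m A).
Proof.
move=> NN; apply/row_matrixP => i.
by rewrite row_mul !rowK tau_mulm // mulmxA.
Qed.

Lemma mulmD N N' A A' : mulm N N' (A + A') = mulm N N' A + mulm N N' A'.
Proof. by apply/row_matrixP => i; rewrite linearD /= !rowK mulmxDl tauD. Qed.

Lemma mulmZ N N' c A : mulm N N' (c%:P *: A) = c *: mulm N N' A.
Proof. by apply/row_matrixP => i; rewrite linearZ /= !rowK -scalemxAl tauZ. Qed.

Lemma mulm0 N N' : mulm N N' 0 = 0.
Proof. by apply/row_matrixP => i; rewrite rowK mul0mx tau0 row0. Qed.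

Lemma mulm1 N : mulm N N 1%:M = 1%:M.
Proof. by apply/row_matrixP => i; rewrite rowK mul1mx untauK row1. Qed.

(* Words kappa_0 kappa_1 ... of constant matrices encode the chains of lattices
   Lambda_m = kappa_0 D ... kappa_(m-1) D O^2, where O = K[t], D = diag(1, t). *)
Definition Dmx : 'M[P]_2 := \matrix_(i, j) (if i == j then if i == 0 then 1 else 'X else 0).
Definition Dmx' : 'M[P]_2 := \matrix_(i, j) (if i == j then if i == 0 then 'X else 1 else 0).
Definition e1 : vec := delta_mx 0 0.
Definition e2 : vec := delta_mx 1 0.
Notation pm := (map_mx (@polyC K)).

Implicit Types (kap : nat -> 'M[K]_2).

Fixpoint gw kap m : 'M[P]_2 :=
  if m is m'.+1 then gw kap m' *m (pm (kap m') *m Dmx) else 1%:M.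

Definition in_lat kap m (y : vec) := exists x : vec, y = gw kap m *m x.

(** Since [D x] is congruent modulo t to a constant multiple of e1, for invertible letters
    Lambda_(i+1) = K gam_i + t Lambda_i. Iterating gives the rows of [lat_basis]. *)
Definition gam kap i : vec := gw kap i.+1 *m e1.

Definition lat_basis kap N : 'M[K]_(N, N + N) :=
  \matrix_i tau N ('X^(N - i.+1) *: gam kap i).

Lemma gw_ext kap kap' m : (forall l, (l < m)%N -> kap l = kap' l) ->
  gw kap m = gw kap' m.
Proof. by elim: m => //= m IH h; rewrite IH ?h // => l /ltnW; exact: h. Qed.

Lemma Dmx_e1 : Dmx *m e1 = e1.
Proof. by apply: cV2P; rewrite mulmx2E !mxE /= !Monoid.simpm. Qed.

Lemma Dmx_e2 : Dmx *m e2 = 'X *: e2.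
Proof. by apply: cV2P; rewrite mulmx2E !mxE /= !Monoid.simpm. Qed.

Lemma gamE kap i : gam kap i = gw kap i *m (pm (kap i) *m e1).
Proof. by rewrite /gam /= -!mulmxA Dmx_e1. Qed.

Lemma Dmx_adj : Dmx *m Dmx' = 'X%:M /\ Dmx' *m Dmx = 'X%:M.
Proof.
split; apply/matrixP => i j; rewrite mulmx2E !mxE;
by case: i => [[|[|//]] ?]; case: j => [[|[|//]] ?]; rewrite /= ?Monoid.simpm ?mulr1 ?mul1r ?mulr0 ?mul0r ?addr0 ?add0r ?mulr0n ?mulr1n.
Qed.

Lemma vec_split (x : vec) : exists x' : vec, Dmx *m x = ((x 0 0)`_0)%:P *: e1 + 'X *: x'.
Proof.
exists (\col_i (if i == 0 then drop_poly 1 (x 0 0) else x 1 0)).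
apply: cV2P; rewrite mulmx2E !mxE /= ?Monoid.simpm ?mulr1 ?mul1r ?mulr0 ?mul0r ?addr0 ?add0r //.
exact: poly_split.
Qed.

Section Word.
Context (kap : nat -> 'M[K]_2) (ku : forall l, kap l \in unitmx).

Lemma pm_inv l : pm (kap l) *m pm (invmx (kap l)) = 1%:M /\
  pm (invmx (kap l)) *m pm (kap l) = 1%:M.
Proof. by rewrite -!map_mxM mulmxV // mulVmx // !map_mx1. Qed.

Lemma gw_adj m : exists g' : 'M[P]_2,
  gw kap m *m g' = 'X^m%:M /\ g' *m gw kap m = 'X^m%:M.
Proof.
elim: m => [|m [g' [h1 h2]]] /=; first by exists 1%:M; rewrite mulmx1.
have [D1 D2] := Dmx_adj; have [k1 k2] := pm_inv m.
exists (Dmx' *m (pm (invmx (kap m)) *m g')); split.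
  rewrite -!mulmxA (mulmxA Dmx) D1 mul_scalar_mx -!scalemxAr.
  by rewrite (mulmxA (pm _)) k1 mul1mx h1 exprS scale_scalar_mx.
rewrite -!mulmxA (mulmxA g') h2 mul_scalar_mx -!scalemxAr.
by rewrite (mulmxA (pm _)) k2 mul1mx D2 scale_scalar_mx -exprSr.
Qed.

Lemma Xn_inj n (x y : vec) : 'X^n *: x = 'X^n *: y -> x = y.
Proof.
move=> e; apply/matrixP => i j; move/matrixP: e => /(_ i j); rewrite !mxE.
by apply: mulfI; rewrite expf_neq0 // polyX_eq0.
Qed.

Lemma gw_inj m (x y : vec) : gw kap m *m x = gw kap m *m y -> x = y.
Proof.
have [g' [_ h]] := gw_adj m => e; apply: (@Xn_inj m).
by rewrite -!mul_scalar_mx -h -!mulmxA e.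
Qed.

Lemma in_lat_Xn m z : in_lat kap m ('X^m *: z).
Proof.
have [g' [h _]] := gw_adj m.
by exists (g' *m z); rewrite mulmxA h mul_scalar_mx.
Qed.

Lemma in_latD m y z : in_lat kap m y -> in_lat kap m z -> in_lat kap m (y + z).
Proof. by move=> [x ->] [x' ->]; exists (x + x'); rewrite mulmxDr. Qed.

Lemma in_latZ m p y : in_lat kap m y -> in_lat kap m (p *: y).
Proof. by move=> [x ->]; exists (p *: x); rewrite scalemxAr. Qed.

Lemma in_latX m y : in_lat kap m y -> in_lat kap m.+1 ('X *: y).
Proof.
move=> [x ->]; have [D1 _] := Dmx_adj; have [k1 _] := pm_inv m.
exists (Dmx' *m (pm (invmx (kap m)) *m x)) => /=.
rewrite -!mulmxA (mulmxA Dmx) D1 mul_scalar_mx -!scalemxAr.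
by rewrite (mulmxA (pm _)) k1 mul1mx.
Qed.

Lemma in_lat_Xi m i y : in_lat kap m y -> in_lat kap (m + i) ('X^i *: y).
Proof.
move=> h; elim: i => [|i IH]; first by rewrite addn0 expr0 scale1r.
by rewrite addnS exprS -scalerA; exact: in_latX.
Qed.

Lemma in_latS m y : in_lat kap m.+1 y -> in_lat kap m y.
Proof. by move=> [x ->] /=; rewrite -mulmxA; eexists. Qed.

Lemma in_lat_le m n y : (m <= n)%N -> in_lat kap n y -> in_lat kap m y.
Proof.
move=> mn; rewrite -(subnK mn) addnC; elim: (n - m)%N => [|k IH]; first by rewrite addn0.
by rewrite addnS => /in_latS.
Qed.

Lemma in_lat_gam N i : (i < N)%N -> in_lat kap N ('X^(N - i.+1) *: gam kap i).
Proof. by move=> iN; rewrite -{1}(subnKC iN); apply: in_lat_Xi; exists e1. Qed.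

Lemma in_lat_decomp m y : in_lat kap m y -> exists (d : nat -> K) z,
  y = \sum_(i < m) (d i)%:P *: ('X^(m - i.+1) *: gam kap i) + 'X^m *: z.
Proof.
elim: m y => [|m IH] y.
  by move=> [x ->]; exists (fun=> 0), x; rewrite big_ord0 add0r expr0 scale1r mul1mx.
move=> [x ->] /=; have [x' e] := vec_split x.
rewrite -!mulmxA e mulmxDr -!scalemxAr mulmxDr -!scalemxAr -gamE.
have [|d [z ->]] := IH (gw kap m *m (pm (kap m) *m x')); first by eexists.
exists (fun i => if i == m then (x 0 0)`_0 else d i), z.
rewrite big_ord_recr /= eqxx subnn expr0 scale1r scalerDr (scalerA 'X 'X^m) -exprS addrA.
congr (_ + _); rewrite addrC; congr (_ + _); rewrite scaler_sumr; apply: eq_bigr => i _.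
by rewrite ltn_eqF // subSn // exprS !scalerA mulrCA.
Qed.

Lemma lat_basisP N y : in_lat kap N y <-> (tau N y <= lat_basis kap N)%MS.
Proof.
split=> [/in_lat_decomp[d [z ->]]|/submxP[D]].
  rewrite tauD tau_Xn // addr0 tau_sum; apply: summx_sub => i _.
  rewrite tauZ scalemx_sub //.
  by apply: (eq_row_sub i); rewrite rowK.
rewrite mulmx_sum_row => e.
have [|z ->] := @tau_eq N y (\sum_(i < N) (D 0 i)%:P *: ('X^(N - i.+1) *: gam kap i)).
  by rewrite e tau_sum; apply: eq_bigr => i _; rewrite rowK tauZ.
apply: in_latD; last exact: in_lat_Xn.
have [z0 h0] : in_lat kap N 0 by exists 0; rewrite mulmx0.
apply: (big_ind (in_lat kap N)) => [|a b|i _]; first by exists z0.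
  exact: in_latD.
by apply: in_latZ; exact: in_lat_gam (ltn_ord i).
Qed.

(** All terms but the last are t times elements of Lambda_N. Cancelling the injective [gw kap N]
    leaves d_N kappa_N e1 divisible by t, so d_N = 0; then divide by t and repeat. *)
Lemma gam_sum_eq0 N (d : nat -> K) z :
  \sum_(i < N) (d i)%:P *: ('X^(N - i.+1) *: gam kap i) = 'X^N *: z ->
  forall i, (i < N)%N -> d i = 0.
Proof.
elim: N z => // N IH z.
rewrite big_ord_recr /= subnn expr0 scale1r.
pose w := \sum_(i < N) (d i)%:P *: ('X^(N - i.+1) *: gam kap i).
have -> : \sum_(i < N) (d i)%:P *: ('X^(N.+1 - i.+1) *: gam kap i) = 'X *: w.
  rewrite scaler_sumr; apply: eq_bigr => i _.
  by rewrite subSn // exprS !scalerA mulrCA mulrA.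
move=> e.
have [x ex] : in_lat kap N ('X^N *: z - w).
  rewrite -scaleN1r; apply: in_latD; first exact: in_lat_Xn.
  apply: in_latZ; rewrite /w; apply: (big_ind (in_lat kap N)) => [|a b|i _].
  - by exists 0; rewrite mulmx0.
  - exact: in_latD.
  - by apply: in_latZ; exact: in_lat_gam (ltn_ord i).
have e2 : (d N)%:P *: (pm (kap N) *m e1) = 'X *: x.
  apply: (@gw_inj N); rewrite -!scalemxAr -ex scalerBr -gamE scalerA -exprS -e.
  by rewrite addrAC subrr add0r.
have dN : d N = 0.
  have [_ k2] := pm_inv N.
  have := congr1 (mulmx (pm (invmx (kap N)))) e2.
  rewrite -!scalemxAr mulmxA k2 mul1mx => /matrixP/(_ 0 0).
  by rewrite !mxE /= mulr1 => /polyP/(_ 0%N); rewrite coefC coefXM.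
have ew : w = 'X^N *: z.
  move: e; rewrite dN scale0r addr0 exprS -scalerA.
  by rewrite -['X]expr1 => /Xn_inj.
move=> i; rewrite ltnS leq_eqVlt => /orP[/eqP -> //|]; exact: IH ew _.
Qed.

Lemma lat_basis_free N : row_free (lat_basis kap N).
Proof.
apply: inj_row_free => v; rewrite mulmx_sum_row => e.
pose d i := if insub i is Some j then v 0 (j : 'I_N) else 0.
have dE (j : 'I_N) : d j = v 0 j by rewrite /d valK.
have [|z] := @tau_eq N (\sum_(i < N) (d i)%:P *: ('X^(N - i.+1) *: gam kap i)) 0.
  rewrite tau0 -e tau_sum; apply: eq_bigr => i _.
  by rewrite rowK tauZ dE.
rewrite add0r => /gam_sum_eq0 h; apply/rowP => j.
by rewrite mxE -dE h.
Qed.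

End Word.
End Lattices.

(** * From nested lattices to words, and the contraction of words *)

Section Chains.
Local Open Scope ring_scope.
Context {K : fieldType}.
Local Notation P := {poly K}.
Local Notation vec := 'cV[{poly K}]_2.
Notation pm := (map_mx (@polyC K)).
Notation Dm := (@Dmx K).
Notation E1 := (@e1 K).
Notation E2 := (@e2 K).

(** A rank count, through which an inclusion between lattices of the same colength becomes an
    equality. *)
Lemma row_free_eq m n (A B : 'M[K]_(m, n)) : row_free A -> (A <= B)%MS ->
  row_free B /\ exists2 C : 'M_m, C \in unitmx & B = C *m A.
Proof.
move=> Af AB; have rAB : \rank A = \rank B.
  by apply/eqP; rewrite eqn_leq mxrankS // (eqP Af) rank_leq_row.
have Bf : row_free B by rewrite /row_free -rAB.
have BA : (B <= A)%MS by rewrite -(mxrank_leqif_sup AB).2 rAB.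
split=> //; have /submxP[C BE] := BA; exists C => //.
by rewrite -row_free_unit /row_free eqn_leq rank_leq_row -{1}(eqP Bf) BE mxrankM_maxl.
Qed.

Definition Lat m N (B : 'M[K]_(m, N + N)) (y : vec) : Prop := (tau N y <= B)%MS.

Lemma Lat_sub m m' N (A : 'M_(m, N + N)) (B : 'M_(m', N + N)) :
  (A <= B)%MS <-> (forall y, Lat A y -> Lat B y).
Proof.
split=> [AB y yA|H]; first exact: submx_trans AB.
by apply/row_subP => i; rewrite -(untauK (row i A)); apply: H; rewrite /Lat untauK row_sub.
Qed.

Lemma LatD m N (B : 'M_(m, N + N)) y z : Lat B y -> Lat B z -> Lat B (y + z).
Proof. by move=> hy hz; rewrite /Lat tauD addmx_sub. Qed.

Lemma LatXn m N (B : 'M_(m, N + N)) n z : (N <= n)%N -> Lat B ('X^n *: z).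
Proof. by move=> Nn; rewrite /Lat tau_Xn // sub0mx. Qed.

Lemma LatZ m N (B : 'M_(m, N + N)) p y :
  (forall y, Lat B y -> Lat B ('X *: y)) -> Lat B y -> Lat B (p *: y).
Proof.
move=> BX; elim/poly_ind: p y => [|p c IH] y yB; first by rewrite scale0r /Lat tau0 sub0mx.
rewrite scalerDl -scalerA; apply: LatD; first exact/IH/BX.
by rewrite /Lat tauZ scalemx_sub.
Qed.

Lemma inv_mod_Xn (s : P) m : s`_0 != 0 -> exists u w, u * s = 1 + 'X^m * w.
Proof.
move=> s0; have cop : coprimep s 'X^m.
  apply: coprimep_expr; rewrite -['X]subr0 -polyC0 coprimep_XsubC /root.
  by rewrite horner_coef0.
have [[u w] /= e] := Bezout_eq1_coprimepP _ _ cop.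
by exists u, (- w); rewrite -e; ring.
Qed.

(** The letters represent the points of the projective line by their first column: (0, 1) for [wmx],
    (1, x) for [lmx x]. *)
Definition wmx : 'M[K]_2 := \matrix_(i, j) (i != j)%:R.
Definition lmx (x : K) : 'M[K]_2 :=
  \matrix_(i, j) (if i == j then 1 else if j == 0 then x else 0).
Definition normal_letter (A : 'M[K]_2) := A = wmx \/ exists x, A = lmx x.

Lemma det2 (R : comNzRingType) (A : 'M[R]_2) : \det A = A 0 0 * A 1 1 - A 0 1 * A 1 0.
Proof.
rewrite (expand_det_row _ 0) !big_ord_recl big_ord0 /cofactor !det_mx11 !mxE /=.
rewrite addn0 expr0 mul1r expr1 mulN1r mulrN addr0.
by congr (A _ _ * A _ _ - A _ _ * A _ _); apply: val_inj.
Qed.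

Lemma normal_letter_unit A : normal_letter A -> A \in unitmx.
Proof.
rewrite unitmxE unitfE det2; case=> [->|[x ->]]; rewrite !mxE /=.
  by rewrite mul0r sub0r mul1r oppr_eq0 oner_eq0.
by rewrite mul1r mul0r subr0 oner_eq0.
Qed.

Lemma DwD : Dm *m pm wmx *m Dm = 'X *: pm wmx.
Proof.
apply/matrixP => i j; rewrite !mulmx2E !mxE.
case: i => [[|[|//]] ?]; case: j => [[|[|//]] ?]; rewrite /= ?polyC0 ?polyC1; try ring.
Qed.

Lemma wmxK : wmx *m wmx = 1%:M.
Proof.
apply/matrixP => i j; rewrite !mulmx2E !mxE.
by case: i => [[|[|//]] ?]; case: j => [[|[|//]] ?];
   rewrite /= ?mulr0 ?mul0r ?mulr1 ?mul1r ?addr0 ?add0r ?mul0r ?mulr0.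
Qed.

(* Nakayama: a proper submodule of O^2 (O = K[t] localised at 0, whence the
   hypothesis on X^N) is contained in kappa D O^2 for some kappa. *)
Lemma proper_submodule (L : vec -> Prop) N :
    (forall y z, L y -> L z -> L (y + z)) -> (forall p y, L y -> L (p *: y)) ->
    (forall z, L ('X^N *: z)) ->
  (forall y, L y) \/ exists2 A, normal_letter A &
    forall y, L y -> exists z, y = pm A *m (Dm *m z).
Proof.
move=> LD LZ LX.
(* If two elements have a determinant invertible modulo t^N, Cramer's formula yields everything.
   Otherwise the values at t = 0 lie on one line, spanned by (1, x) or (0, 1), which dictates the
   letter. *)
have [[y [y' [Ly Ly' d0]]]|H] := pselect (exists y y', [/\ L y, L y' &
    (y 0 0 * y' 1 0 - y' 0 0 * y 1 0)`_0 != 0]).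
  left=> z; set d := _ - _ in d0; have [u [w uw]] := inv_mod_Xn N d0.
  have -> : z = u *: (d *: z) + 'X^N *: (- w *: z).
    by rewrite !scalerA uw mulrN scaleNr scalerDl scale1r addrK.
  apply: (LD) => //; apply: (LZ).
  have -> : d *: z = (z 0 0 * y' 1 0 - z 1 0 * y' 0 0) *: y +
      (z 1 0 * y 0 0 - z 0 0 * y 1 0) *: y'.
    by apply: cV2P; rewrite !mxE /d; ring.
  by apply: LD; apply: LZ.
right; have {}H y y' : L y -> L y' -> (y 0 0)`_0 * (y' 1 0)`_0 = (y' 0 0)`_0 * (y 1 0)`_0.
  move=> Ly Ly'; apply/eqP; rewrite -subr_eq0; apply: contraT => d0; case: H.
  by exists y, y'; rewrite coefB !coefM !big_ord1.
have spl (a : P) : a`_0 = 0 -> a = 'X * drop_poly 1 a.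
  by move=> a0; rewrite {1}[a]poly_split a0 add0r.
have [[y Ly y0]|H0] := pselect (exists2 y, L y & (y 0 0)`_0 != 0).
  pose x := (y 1 0)`_0 / (y 0 0)`_0; exists (lmx x); first by right; exists x.
  move=> z Lz; pose q := z 1 0 - x%:P * z 0 0.
  exists (\col_i (if i == 0 then z 0 0 else drop_poly 1 q)).
  have q0 : q`_0 = 0.
    rewrite coefB coefCM /x mulrAC [_ * (z 0 0)`_0]mulrC -(H _ _ Ly Lz).
    by rewrite mulrAC divff // mul1r subrr.
  apply: cV2P; rewrite !mulmx2E !mxE /= ?mul1r ?mul0r ?addr0 ?add0r //.
  by rewrite -(spl _ q0) /q [RHS]addrC subrK.
exists wmx; first by left.
move=> z Lz; exists (\col_i (if i == 0 then z 1 0 else drop_poly 1 (z 0 0))).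
have z0 : (z 0 0)`_0 = 0 by apply/eqP; apply: contraT => z0; case: H0; exists z.
apply: cV2P; rewrite !mulmx2E !mxE /= ?polyC0 ?polyC1; last by ring.
by rewrite {1}(spl _ z0); ring.
Qed.

Section ChainExists.
Context (s : nat) (N : 'I_s -> nat) (B : forall k, 'M[K]_(N k, N k + N k)).

Record good := Good {
  good_free : forall k, row_free (B k);
  good_X : forall k y, Lat (B k) y -> Lat (B k) ('X *: y);
  good_sub : forall k k' : 'I_s, (k <= k')%N -> forall y, Lat (B k) y -> Lat (B k') y }.

Context (gB : good).

Lemma Lat_word_eq kap k : (forall l, kap l \in unitmx) ->
    (forall y, Lat (B k) y -> in_lat kap (N k) y) \/
    (forall y, in_lat kap (N k) y -> Lat (B k) y) ->
  forall y, Lat (B k) y <-> in_lat kap (N k) y.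
Proof.
move=> ku H; suff [h1 h2] : (B k <= lat_basis kap (N k))%MS /\ (lat_basis kap (N k) <= B k)%MS.
  move=> y; rewrite lat_basisP //; split=> h; exact: submx_trans h _.
case: H => H.
  have BL : (B k <= lat_basis kap (N k))%MS.
    by apply/Lat_sub => y /H/lat_basisP; apply.
  have [_ [C _ E]] := row_free_eq (good_free gB k) BL.
  by split=> //; rewrite E submxMl.
have BL : (lat_basis kap (N k) <= B k)%MS.
  by apply/Lat_sub => y /lat_basisP -/(_ ku)/H.
split=> //.
by have [_ [C _ E]] := row_free_eq (lat_basis_free ku (N k)) BL; rewrite E submxMl.
Qed.

(** The letter of index [m] must serve all lattices of colength greater than [m]. As they are
    nested, it is enough to choose it for the one of largest index, which contains the others. *)
Lemma chain_upto m : exists2 kap, (forall l, normal_letter (kap l)) &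
  forall k m', (m' <= m)%N -> (m' <= N k)%N -> forall y, Lat (B k) y -> in_lat kap m' y.
Proof.
have n1 : normal_letter 1%:M.
  right; exists 0; apply/matrixP => i j; rewrite !mxE; case: (i == j) => //.
  by rewrite mulr0n; case: (j == 0).
elim: m => [|m [kap kn IH]].
  exists (fun=> 1%:M) => // k m'; rewrite leqn0 => /eqP -> _ y _.
  by exists y; rewrite mul1mx.
have ku l : kap l \in unitmx by exact: normal_letter_unit.
have [k0 mk0|none] := pickP (fun k : 'I_s => m < N k)%N; last first.
  exists kap => // k m' mm mN; apply: IH => //.
  by have := none k; lia.
pose k1 := [arg max_(k > k0 | (m < N k)%N) (k : nat)].
have [mk1 k1max] : (m < N k1)%N /\ forall k : 'I_s, (m < N k)%N -> (k <= k1)%N.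
  by rewrite /k1; case: arg_maxnP.
pose L x := Lat (B k1) (gw kap m *m x).
have [] := @proper_submodule L (N k1).
- by move=> y z hy hz; rewrite /L mulmxDr; exact: LatD.
- by move=> p y hy; rewrite /L -scalemxAr; apply: LatZ => // ?; exact: (good_X gB).
- by move=> z; rewrite /L -scalemxAr; exact: LatXn.
- move=> H.
  (* This case contradicts the colength: the word padded with 1 gives a sublattice of the same
     colength [N k1], hence equality, and Lambda_m would lie in Lambda_(m+1), which misses the image
     of e2. *)
  pose kap1 l := if (l < m)%N then kap l else 1%:M.
  have k1u l : kap1 l \in unitmx by rewrite /kap1; case: ifP => // _; exact: unitmx1.
  have ge : gw kap1 m = gw kap m by apply: gw_ext => l; rewrite /kap1 => ->.
  have le y : in_lat kap1 (N k1) y -> Lat (B k1) y.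
    by move=> /(in_lat_le (ltnW mk1))[x ->]; rewrite ge; exact: H.
  have [x] : in_lat kap1 m.+1 (gw kap m *m E2).
    by apply: in_lat_le mk1 _; apply/(Lat_word_eq k1u (or_intror le)); exact: H.
  rewrite /= {2}/kap1 ltnn map_mx1 mul1mx -ge -mulmxA => /(gw_inj k1u) /matrixP/(_ 1 0).
  rewrite mulmx2E !mxE /= mul0r add0r => /polyP/(_ 0%N)/eqP.
  by rewrite coefXM coefC oner_eq0.
- move=> [A An HA]; pose kap' l := if l == m then A else kap l.
  have ge m' : (m' <= m)%N -> gw kap' m' = gw kap m'.
    by move=> mm; apply: gw_ext => l lm; rewrite /kap' ltn_eqF //; lia.
  exists kap' => [l|k m']; first by rewrite /kap'; case: eqP.
  rewrite leq_eqVlt => /orP[/eqP -> mN y yB|mm mN y yB]; last first.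
    by have [x ->] := IH k m' mm mN y yB; exists x; rewrite ge.
  have [x ex] := IH k m (leqnn m) (ltnW mN) y yB.
  have [z ez] : exists z, x = pm A *m (Dm *m z).
    by apply: HA; rewrite /L -ex; apply: (good_sub gB) yB; exact: k1max.
  by exists z; rewrite /= /kap' eqxx ge // ex ez !mulmxA.
Qed.

Lemma chain_exists : exists2 kap, (forall l, normal_letter (kap l)) &
  forall k y, Lat (B k) y <-> in_lat kap (N k) y.
Proof.
have [kap kn H] := chain_upto (\max_k N k); exists kap => // k.
apply: Lat_word_eq => [l|]; first exact: normal_letter_unit.
by left=> y; apply: H => //; exact: leq_bigmax.
Qed.

End ChainExists.

Implicit Types kap : nat -> 'M[K]_2.

Lemma gam_S kap i : exists z, gam kap i.+1 = (kap i.+1 0 0)%:P *: gam kap i + 'X *: z.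
Proof.
exists ((kap i.+1 1 0)%:P *: (gw kap i *m (pm (kap i) *m E2))).
rewrite gamE.
have -> : pm (kap i.+1) *m E1 = (kap i.+1 0 0)%:P *: E1 + (kap i.+1 1 0)%:P *: E2.
  by apply: cV2P; rewrite mulmx2E !mxE /= ?mulr1 ?mulr0 ?addr0 ?add0r.
rewrite mulmxDr -!scalemxAr; congr (_ + _).
by rewrite /= -!mulmxA Dmx_e2 -!scalemxAr !scalerA mulrC.
Qed.

(** By [gam_S], modulo t each further letter multiplies [gam] by its corner entry; the start is the
    first column of [kap 0]. *)
Lemma gam_coef0 kap i :
  ((gam kap i) 0 0)`_0 = \prod_(l < i.+1) kap l 0 0 /\
  ((gam kap i) 1 0)`_0 = kap 0%N 1 0 * \prod_(1 <= l < i.+1) kap l 0 0.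
Proof.
elim: i => [|i [h1 h2]].
  rewrite big_ord_recr big_ord0 big_nil /= gamE mul1mx !mulmx2E !mxE /=.
  by rewrite !mulr1 !mulr0 !addr0 mul1r !coefC.
have [z ->] := gam_S kap i.
have entry c (y x : vec) a : ((c%:P *: y + 'X *: x) a 0)`_0 = c * (y a 0)`_0.
  by rewrite !mxE coefD coefCM coefXM addr0.
rewrite !entry h1 h2; split.
  by rewrite [RHS]big_ord_recr mulrC.
by rewrite [in RHS]big_nat_recr //= mulrCA [kap i.+1 0 0 * _]mulrC.
Qed.

(** Without an inner [wmx] all inner corner entries are 1, so [gam] takes at t = 0 the value of the
    first column of [kap 0], which is nonzero. A [wmx] in position 0 does no harm, whence
    [0 < i]. *)
Lemma exists_wmx kap n : (forall l, normal_letter (kap l)) -> (0 < n)%N ->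
    (forall y, in_lat kap n y -> (y 0 0)`_0 = 0 /\ (y 1 0)`_0 = 0) ->
  exists2 i, (0 < i < n)%N & kap i = wmx.
Proof.
move=> kn; case: n => // n _ H.
have [|h0 h1] := H (gam kap n); first by exists E1.
have [H1|none] := pselect (exists2 i, (0 < i < n.+1)%N & kap i = wmx) => //.
have p1 : \prod_(1 <= l < n.+1) kap l 0 0 = 1.
  rewrite big_nat big1 // => l ln; case: (kn l) => [e|[x ->]]; last by rewrite mxE.
  by case: none; exists l.
have [e0 e1] := gam_coef0 kap n.
rewrite e1 p1 mulr1 in h1; move: h0.
rewrite e0 -(big_mkord xpredT (fun l => kap l 0 0)) big_ltn // p1 mulr1 => h0.
have := normal_letter_unit (kn 0%N); rewrite unitmxE unitfE det2 h0 h1.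
by rewrite mul0r mulr0 subrr eqxx.
Qed.

(* As D w D = t w, a letter w makes the chain a translate by t of the chain
   obtained by merging its neighbours. *)
Definition contract kap j : nat -> 'M[K]_2 := fun l =>
  if (l < j)%N then kap l else if l == j then kap j *m wmx *m kap j.+2 else kap l.+2.

Lemma contract_lt kap j l : (l <= j)%N -> gw (contract kap j) l = gw kap l.
Proof. by move=> lj; apply: gw_ext => i il; rewrite /contract (leq_trans il lj). Qed.

Lemma contract_ge kap j l : kap j.+1 = wmx -> (j < l)%N ->
  gw kap l.+2 = 'X *: gw (contract kap j) l.
Proof.
move=> kw; elim: l => // l IH; rewrite ltnS leq_eqVlt => /orP[/eqP <-|jl].
  have -> : gw kap j.+3 = gw kap j *m pm (kap j) *m (Dm *m pm wmx *m Dm) *m (pm (kap j.+2) *m Dm).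
    by rewrite /= kw !mulmxA.
  rewrite DwD -scalemxAr -scalemxAl /= {2}/contract ltnn eqxx contract_lt //.
  by rewrite !map_mxM !mulmxA.
have -> : gw kap l.+3 = gw kap l.+2 *m (pm (kap l.+2) *m Dm) by [].
rewrite IH // -scalemxAl /=.
by have -> : contract kap j l = kap l.+2 by rewrite /contract ltnNge (ltnW jl) gtn_eqF.
Qed.

(** The limiting length: the word stops right after D w D = t w, only invertible constants follow
    [gw kap j], and the lattice is t Lambda_j. *)
Lemma contract_eq kap j : kap j.+1 = wmx ->
  gw kap j.+2 = 'X *: (gw kap j *m (pm (kap j) *m pm wmx)).
Proof.
move=> kw; have -> : gw kap j.+2 = gw kap j *m pm (kap j) *m (Dm *m pm wmx *m Dm).
  by rewrite /= kw !mulmxA.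
by rewrite DwD -scalemxAr !mulmxA.
Qed.

End Chains.

(** * Cyclic lattices and perturbation of words *)

Section BigCell.
Local Open Scope ring_scope.
Context {K : fieldType}.
Local Notation P := {poly K}.
Local Notation vec := 'cV[{poly K}]_2.
Notation E1 := (@e1 K).
Notation E2 := (@e2 K).
Implicit Types (kap : nat -> 'M[K]_2).

Definition Emx (p : P) : 'M[P]_2 :=
  \matrix_(i, j) (if i == j then 1 else if j == 0 then p else 0).

Definition cyc p m (y : vec) := exists s z, y = s *: (Emx p *m E1) + 'X^m *: z.

(* Bases modulo t^N of the lattices corresponding to the cyclic vector v of
   M^(2^N) and to e_(N-1) v. *)
Definition B0 N : 'M[K]_(N, N + N) := \matrix_i tau N ('X^i *: E1).

Definition B1 N : 'M[K]_(N, N + N) :=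
  \matrix_i tau N (if (i : nat) == 0%N then 'X^(N.-1) *: E2 else 'X^i *: E1).

Lemma EmxD p q : Emx p *m Emx q = Emx (p + q).
Proof.
apply/matrixP => i j; rewrite mulmx2E !mxE.
by case: i => [[|[|//]] ?]; case: j => [[|[|//]] ?]; rewrite /=; ring.
Qed.

Lemma Emx0 : Emx 0 = 1%:M.
Proof.
apply/matrixP => i j; rewrite !mxE.
by case: i => [[|[|//]] ?]; case: j => [[|[|//]] ?].
Qed.

Lemma Emx_E2 p : Emx p *m E2 = E2.
Proof. by apply: cV2P; rewrite mulmx2E !mxE /=; ring. Qed.

Lemma Emx_E1 p : Emx p *m E1 = E1 + p *: E2.
Proof. by apply: cV2P; rewrite mulmx2E !mxE /=; ring. Qed.

Lemma vecE (y : vec) : y = y 0 0 *: E1 + y 1 0 *: E2.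
Proof. by apply: cV2P; rewrite !mxE /=; ring. Qed.

Lemma mulm_Emx_unit N p : mulm N N (Emx p) *m mulm N N (Emx (- p)) = 1%:M.
Proof. by rewrite mulm_mul // EmxD addNr Emx0 mulm1. Qed.

Lemma row_free_mulm N p m (A : 'M_(m, N + N)) : row_free A -> row_free (A *m mulm N N (Emx p)).
Proof.
move=> Af; apply: inj_row_free => v e; apply: (row_free_inj Af); rewrite mul0mx.
by rewrite -[LHS]mulmx1 -(mulm_Emx_unit N p) mulmxA -(mulmxA v) e mul0mx.
Qed.

Lemma row_B0 N A i : row i (B0 N *m mulm N N A) = tau N ('X^i *: (A *m E1)).
Proof. by rewrite row_mul rowK tau_mulm // scalemxAr. Qed.

Lemma row_B1 N A i : row i (B1 N *m mulm N N A) =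
  tau N (if (i : nat) == 0%N then 'X^(N.-1) *: (A *m E2) else 'X^i *: (A *m E1)).
Proof. by rewrite row_mul rowK tau_mulm //; case: eqP => _; rewrite scalemxAr. Qed.

Lemma B0El N (i j : 'I_N) : B0 N i (lshift N j) = (i == j)%:R.
Proof. by rewrite mxE row_mxEl !mxE mulr1 coefXn eq_sym. Qed.

Lemma B0Er N (i j : 'I_N) : B0 N i (rshift N j) = 0.
Proof. by rewrite mxE row_mxEr !mxE mulr0 coef0. Qed.

Lemma B1El N (i j : 'I_N) : B1 N i (lshift N j) = ((i : nat) != 0%N)%:R * (i == j)%:R.
Proof.
rewrite mxE row_mxEl !mxE; case: eqP => _; first by rewrite !mxE /= mulr0 coef0 mul0r.
by rewrite !mxE mulr1 coefXn eq_sym mul1r.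
Qed.

Lemma B1Er N (i j : 'I_N) :
  B1 N i (rshift N j) = ((i : nat) == 0%N)%:R * ((j : nat) == N.-1)%:R.
Proof.
rewrite mxE row_mxEr !mxE; case: eqP => _; first by rewrite !mxE mulr1 coefXn mul1r.
by rewrite !mxE /= mulr0 coef0 mul0r.
Qed.

Lemma B0_free N : row_free (B0 N).
Proof.
apply: inj_row_free => v /rowP e; apply/rowP => j.
have := e (lshift N j); rewrite !mxE => <-; rewrite (bigD1 j) //= big1 => [|i ij].
  by rewrite B0El eqxx mulr1 addr0.
by rewrite B0El (negbTE ij) mulr0.
Qed.

Lemma B1_free N : row_free (B1 N).
Proof.
apply: inj_row_free => v /rowP e; apply/rowP => j; rewrite mxE.
have j0 : (0 < N)%N by apply: leq_ltn_trans (ltn_ord j).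
have l0 : (N.-1 < N)%N by rewrite prednK.
have [jz|jn] := eqVneq (j : nat) 0%N.
  have := e (rshift N (Ordinal l0)); rewrite !mxE => <-; rewrite (bigD1 j) //= big1 => [|i ij].
    by rewrite B1Er jz !eqxx !mulr1 addr0.
  rewrite B1Er (_ : (i : nat) == 0%N = false) ?mul0r ?mulr0 //.
  by apply: contraNF ij => /eqP i0; apply/eqP/val_inj; rewrite /= jz.
have := e (lshift N j); rewrite !mxE => <-; rewrite (bigD1 j) //= big1 => [|i ij].
  by rewrite B1El jn eqxx !mulr1 addr0.
by rewrite B1El (negbTE ij) !mulr0.
Qed.

Lemma tau_poly_sub N m (B : 'M_(m, N + N)) (s : P) v :
  (forall i, (tau N ('X^i *: v) <= B)%MS) -> (tau N (s *: v) <= B)%MS.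
Proof.
move=> H; rewrite -[s]coefK poly_def scaler_suml tau_sum; apply: summx_sub => i _.
by rewrite -mul_polyC -scalerA tauZ scalemx_sub.
Qed.

Lemma cycP N p y : Lat (B0 N *m mulm N N (Emx p)) y <-> cyc p N y.
Proof.
split=> [/submxP[D]|[s [z ->]]].
  rewrite mulmx_sum_row => e.
  have [|z ->] := @tau_eq _ N y (\sum_(i < N) (D 0 i)%:P *: ('X^i *: (Emx p *m E1))).
    by rewrite e tau_sum; apply: eq_bigr => i _; rewrite row_B0 tauZ.
  exists (\sum_(i < N) (D 0 i)%:P * 'X^i), z; rewrite scaler_suml; congr (_ + _).
  by apply: eq_bigr => i _; rewrite scalerA.
apply: LatD; last exact: LatXn.
apply: tau_poly_sub => i; have [iN|Ni] := ltnP i N; last by rewrite tau_Xn // sub0mx.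
by apply: (eq_row_sub (Ordinal iN)); rewrite row_B0.
Qed.

(** Modulo t^N, the rows t^(N-1) e2, t e1, ..., t^(N-1) e1 of [B1] span t (O e1 + t^(N-2) O^2),
    which [Emx p] carries to t times a cyclic lattice. *)
Lemma tcycP N p y : (1 < N)%N -> Lat (B1 N *m mulm N N (Emx p)) y <->
  exists2 y', y = 'X *: y' & cyc p (N - 2) y'.
Proof.
move=> N1; set B := B1 N *m _.
have N2 : N.-1 = (N - 2).+1 by lia.
split=> [/submxP[D]|[_ -> [s [z ->]]]].
  rewrite mulmx_sum_row => e.
  pose a (i : 'I_N) : P := if (i : nat) == 0%N then 0 else (D 0 i)%:P * 'X^(i.-1).
  pose b (i : 'I_N) : P := if (i : nat) == 0%N then (D 0 i)%:P else 0.
  have [|z ->] := @tau_eq _ N y (\sum_(i < N) 'X *: (a i *: (Emx p *m E1) + 'X^(N - 2) *: (b i *: E2))).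
    rewrite e tau_sum; apply: eq_bigr => i _; rewrite row_B1 -tauZ /a /b; congr (tau _ _).
    case: (i : nat) => [|k] /=.
      by rewrite scale0r add0r Emx_E2 N2 !scalerA; congr (_ *: _); rewrite exprS; ring.
    by rewrite scale0r scaler0 addr0 !scalerA; congr (_ *: _); rewrite exprS; ring.
  exists ((\sum_(i < N) a i) *: (Emx p *m E1) + 'X^(N - 2) *: ((\sum_(i < N) b i) *: E2 + 'X *: z)).
    rewrite -scaler_sumr big_split /= -scaler_suml -scaler_sumr -scaler_suml.
    rewrite !scalerDr addrA; congr (_ + _); rewrite !scalerA; congr (_ *: _).
    by rewrite -exprS -exprSr; congr ('X^_); lia.
  by exists (\sum_(i < N) a i), ((\sum_(i < N) b i) *: E2 + 'X *: z).
have r1 i : (tau N ('X^(i.+1) *: (Emx p *m E1)) <= B)%MS.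
  have [iN|Ni] := ltnP i.+1 N; last by rewrite tau_Xn // sub0mx.
  by apply: (eq_row_sub (Ordinal iN)); rewrite row_B1.
have N0 : (0 < N)%N by lia.
have r2 : (tau N ('X^(N.-1) *: E2) <= B)%MS.
  by apply: (eq_row_sub (Ordinal N0)); rewrite row_B1 /= Emx_E2.
rewrite scalerDr; apply: LatD.
  rewrite scalerA mulrC -scalerA; apply: tau_poly_sub => i.
  by rewrite scalerA -exprSr; exact: r1.
rewrite scalerA -exprS -N2.
have -> : z = z 0 0 *: (Emx p *m E1) + (z 1 0 - z 0 0 * p) *: E2.
  by rewrite Emx_E1; apply: cV2P; rewrite !mxE /=; ring.
rewrite scalerDr; apply: LatD.
  rewrite scalerA mulrC -scalerA; apply: tau_poly_sub => i.
  by rewrite scalerA -exprD N2 addnS; exact: r1.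
rewrite scalerA mulrC -scalerA; apply: tau_poly_sub => -[|i].
  by rewrite expr0 scale1r.
by rewrite scalerA -exprD tau_Xn ?sub0mx //; lia.
Qed.

Lemma cyc_ext p q m : cyc (p + 'X^m * q) m = cyc p m.
Proof.
have H p' q' y : cyc (p' + 'X^m * q') m y -> cyc p' m y.
  move=> [s [z ->]]; exists s, (z + s *: (q' *: E2)).
  rewrite !Emx_E1 !scalerDr scalerDl !scalerDr -!addrA; congr (_ + (_ + _)).
  by rewrite addrC !scalerA; congr (_ + _ *: _); rewrite mulrCA mulrA.
apply/funext => y; apply/propext; split; first exact: H.
by rewrite {1}(_ : p = p + 'X^m * q + 'X^m * (- q)); [exact: H | rewrite mulrN addrK].
Qed.

Lemma cyc_E1 p m s z : cyc p m (s *: (Emx p *m E1) + 'X^m *: z).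
Proof. by exists s, z. Qed.

(** With nonzero corner entries the last [gam] has a first entry invertible modulo t, so a multiple
    of it is (1, p) modulo t^n. It lies in every shorter Lambda_m, hence one [p] serves all [m];
    equality follows by rank. *)
Lemma big_cell kap n : (forall l, kap l \in unitmx) ->
    (forall l, (l < n)%N -> kap l 0 0 != 0) ->
  exists p, forall m y, (m <= n)%N -> in_lat kap m y <-> cyc p m y.
Proof.
case: n => [|n] ku k0.
  exists 0 => m y; rewrite leqn0 => /eqP ->; split=> _.
    by exists 0, y; rewrite scale0r add0r expr0 scale1r.
  by exists y; rewrite mul1mx.
have [g0 _] := gam_coef0 kap n.
have s0 : ((gam kap n) 0 0)`_0 != 0.
  by rewrite g0 prodf_seq_neq0; apply/allP => l _; exact: k0.
have [u [w uw]] := inv_mod_Xn n.+1 s0.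
pose p := u * gam kap n 1 0; exists p.
have Ep : in_lat kap n.+1 (Emx p *m E1).
  have -> : Emx p *m E1 = u *: gam kap n + 'X^(n.+1) *: (- w *: E1).
    rewrite Emx_E1 [in RHS](vecE (gam kap n)) scalerDr !scalerA uw addrAC -scalerDl.
    by rewrite mulrN addrK scale1r.
  apply: in_latD; last exact: in_lat_Xn.
  by apply: in_latZ; exists E1.
move=> m y mn.
have sub y' : cyc p m y' -> in_lat kap m y'.
  move=> [s [z ->]]; apply: in_latD; last exact: in_lat_Xn.
  by apply/in_latZ/(in_lat_le mn).
split; last exact: sub.
move/(lat_basisP ku); have BL : (B0 m *m mulm m m (Emx p) <= lat_basis kap m)%MS.
  by apply/Lat_sub => y' /cycP/sub/(lat_basisP ku).
have [_ [C _ E]] := row_free_eq (row_free_mulm p (B0_free m)) BL.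
by rewrite E => h; apply/cycP; apply: submx_trans h (submxMl _ _).
Qed.

Definition poly_coef (F : K -> P) := forall k, poly_fun (fun x => (F x)`_k).

Lemma poly_coef_cst p : poly_coef (fun=> p).
Proof. by move=> k; exists (p`_k)%:P => x; rewrite hornerC. Qed.

Lemma poly_coefC f : poly_fun f -> poly_coef (fun x => (f x)%:P).
Proof.
move=> [q fq] k; case: k => [|k]; [exists q | exists 0] => x; rewrite coefC //=.
by rewrite horner0.
Qed.

Lemma poly_coefD F G : poly_coef F -> poly_coef G -> poly_coef (fun x => F x + G x).
Proof.
have [_ pD _] := poly_fun_subring (K := K).
move=> hF hG k; rewrite (_ : (fun _ => _) = fun x => (F x)`_k + (G x)`_k); first exact: pD.
by apply/funext => x; rewrite coefD.
Qed.

Lemma poly_coefM F G : poly_coef F -> poly_coef G -> poly_coef (fun x => F x * G x).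
Proof.
have [_ _ pM] := poly_fun_subring (K := K).
move=> hF hG k; rewrite (_ : (fun _ => _) = fun x => \sum_(j < k.+1) (F x)`_j * (G x)`_(k - j)).
  by apply: (fun_subring_sum poly_fun_subring) => j; exact: pM.
by apply/funext => x; rewrite coefM.
Qed.

Lemma poly_coef_mulmx n (A : K -> 'M[P]_2) (B : K -> 'M[P]_(2, n)) :
  (forall i j, poly_coef (fun x => A x i j)) -> (forall i j, poly_coef (fun x => B x i j)) ->
  forall i j, poly_coef (fun x => (A x *m B x) i j).
Proof.
move=> hA hB i j; rewrite (_ : (fun _ => _) = fun x => A x i 0 * B x 0 j + A x i 1 * B x 1 j).
  by apply: poly_coefD; exact: poly_coefM.
by apply/funext => x; rewrite mulmx2E.
Qed.

Lemma lat_basis_poly (kap : K -> nat -> 'M[K]_2) :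
  (forall l i j, poly_fun (fun x => kap x l i j)) ->
  forall N i j, poly_fun (fun x => lat_basis (kap x) N i j).
Proof.
move=> kp; have gp m i j : poly_coef (fun x => gw (kap x) m i j).
  elim: m i j => [|m IH] i j /=; first exact: poly_coef_cst.
  apply: poly_coef_mulmx => // {}i {}j; apply: poly_coef_mulmx => {}i {}j; last exact: poly_coef_cst.
  rewrite (_ : (fun _ => _) = fun x => (kap x m i j)%:P); first exact: poly_coefC.
  by apply/funext => x; rewrite mxE.
have gamp i a : poly_coef (fun x => gam (kap x) i a 0).
  by apply: poly_coef_mulmx => i' b; [exact: gp | exact: poly_coef_cst].
move=> N i j; have H n a (c : 'I_N) : poly_fun (fun x => (('X^n *: gam (kap x) i) a 0)`_c).
  have [q qE] := poly_coefM (poly_coef_cst 'X^n) (gamp i a) c.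
  by exists q => x; rewrite -qE mxE.
rewrite -[j]splitK; case: (split j) => c.
  rewrite (_ : (fun _ => _) = fun x => (('X^(N - i.+1) *: gam (kap x) i) 0 0)`_c) //.
  by apply/funext => x; rewrite mxE row_mxEl mxE.
rewrite (_ : (fun _ => _) = fun x => (('X^(N - i.+1) *: gam (kap x) i) 1 0)`_c) //.
by apply/funext => x; rewrite mxE row_mxEr mxE.
Qed.

Definition perturb (x : K) (A : 'M[K]_2) := A + x *: delta_mx 0 0.

(** The corner entry of [perturb x A] times its determinant, as a polynomial in x; the determinant
    is affine in x because a single entry moves. *)
Definition generic_at (A : 'M[K]_2) : {poly K} :=
  ((A 0 0)%:P + 'X) * ((\det A)%:P + (A 1 1)%:P * 'X).

Lemma generic_at_neq0 A : A \in unitmx -> generic_at A != 0.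
Proof.
rewrite unitmxE unitfE => dA; rewrite mulf_eq0 negb_or; apply/andP; split.
  apply/eqP => /polyP/(_ 1%N)/eqP.
  by rewrite coefD coefC coefX coef0 /= add0r oner_eq0.
apply: contraNneq dA => /polyP/(_ 0%N).
by rewrite coefD coefC coefMX coef0 /= addr0 => ->.
Qed.

Lemma generic_atP A x : (generic_at A).[x] != 0 ->
  perturb x A \in unitmx /\ perturb x A 0 0 != 0.
Proof.
rewrite hornerM !hornerD !hornerM !hornerC hornerX mulf_eq0 negb_or => /andP[h1 h2].
split; last by rewrite !mxE /= mulr1.
rewrite unitmxE unitfE; move: h2; congr (is_true (_ != 0)).
by rewrite !det2 !mxE /=; ring.
Qed.

Lemma perturb0 A : perturb 0 A = A.
Proof. by rewrite /perturb scale0r addr0. Qed.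

Lemma perturb_poly A i j : poly_fun (fun x => perturb x A i j).
Proof.
exists ((A i j)%:P + (delta_mx 0 0 i j)%:P * 'X) => x.
by rewrite hornerD hornerM !hornerC hornerX !mxE mulrC.
Qed.

(* Letters beyond n do not matter; they are reset to 1 to remain invertible. *)
Definition perturb_word n kap x l := if (l < n)%N then perturb x (kap l) else 1%:M.

Lemma perturb_word_generic n kap : (forall l, kap l \in unitmx) ->
  exists2 r : {poly K}, r != 0 & forall x, r.[x] != 0 ->
    forall l, perturb_word n kap x l \in unitmx /\ perturb_word n kap x l 0 0 != 0.
Proof.
move=> ku; exists (\prod_(l < n) generic_at (kap l)).
  by rewrite prodf_seq_neq0; apply/allP => l _; exact: generic_at_neq0.
move=> x rx l; rewrite /perturb_word; case: ltnP => [ln|_].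
  apply: generic_atP; apply: contraNneq rx => e.
  by rewrite horner_prod (bigD1 (Ordinal ln)) //= e mul0r.
by rewrite unitmx1 mxE oner_eq0.
Qed.

Lemma perturb_word_poly n kap l i j : poly_fun (fun x => perturb_word n kap x l i j).
Proof.
rewrite /perturb_word; case: ltnP => _; first exact: perturb_poly.
by exists ((1%:M : 'M[K]_2) i j)%:P => x; rewrite hornerC.
Qed.

End BigCell.

(** * The boundary of the orbit in Plücker coordinates *)

Section Geometry.
Local Open Scope ring_scope.
Local Open Scope classical_set_scope.
Context {K : fieldType} (char0 : [pchar K] =i pred0).
Local Notation P := {poly K}.
Local Notation vec := 'cV[{poly K}]_2.
Notation pm := (map_mx (@polyC K)).
Notation E1 := (@e1 K).

(** Cramer's rule: coordinates with one changed column, divided by the one at [f], are the entries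
    of the matrix normalised to the identity on the columns [f]. *)
Lemma cramer_upd n p (B : 'M[K]_(n, p)) f i c : colsub f B \in unitmx ->
  pluck B (upd f i c) = pluck B f * (invmx (colsub f B) *m B) i c.
Proof.
set C := colsub f B => Cu; set A := invmx C *m B.
have BE : B = C *m A by rewrite mulmxA mulmxV // mul1mx.
have fA : colsub f A = 1%:M.
  rewrite -(mulVmx Cu) /A; apply/matrixP => a b; rewrite !mxE.
  by apply: eq_bigr => l _; rewrite !mxE.
have {1}-> : pluck B (upd f i c) = \det C * pluck A (upd f i c) by rewrite -pluck_mul -BE.
congr (_ * _); rewrite /pluck (expand_det_col _ i).
have cof a : cofactor (colsub (upd f i c) A) a i = (a == i)%:R.
  have <- : (\adj (1%:M : 'M[K]_n)) i a = (a == i)%:R.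
    by have := mul_adj_mx (1%:M : 'M[K]_n); rewrite mulmx1 det1 => ->; rewrite mxE eq_sym.
  rewrite mxE -fA /cofactor; congr (_ * \det _); apply/matrixP => x y.
  by rewrite !mxE /upd eq_sym (negbTE (neq_lift _ _)).
rewrite (bigD1 i) //= big1 => [|a ai]; last by rewrite cof (negbTE ai) mulr0.
by rewrite cof eqxx mulr1 addr0 mxE /upd eqxx.
Qed.

Lemma row_free_pluck n p (B : 'M[K]_(n, p)) : row_free B -> exists f, pluck B f != 0.
Proof.
move=> Bf; have Bt : row_full B^T by rewrite /row_full mxrank_tr.
have := fullrowsub_full Bt; rewrite row_full_unit => h.
exists (fullrankfun Bt); rewrite /pluck -unitfE -unitmxE -unitmx_tr.
by rewrite (_ : _^T = rowsub (fullrankfun Bt) B^T) //; apply/matrixP => a b; rewrite !mxE.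
Qed.

Lemma row_free_pluck_col n p (B : 'M[K]_(n, p)) i0 c : row_free B -> B i0 c != 0 ->
  exists f i, f i = c /\ pluck B f != 0.
Proof.
move=> Bf Bc; have [f f0] := row_free_pluck Bf.
have Cu : colsub f B \in unitmx by rewrite unitmxE unitfE.
have [i ic] : exists i, (invmx (colsub f B) *m B) i c != 0.
  apply/existsP; apply: contraNT Bc; rewrite negb_exists => /forallP h.
  have -> : B = colsub f B *m (invmx (colsub f B) *m B) by rewrite mulmxA mulmxV // mul1mx.
  rewrite mxE big1 // => j _; have := h j.
  by rewrite negbK => /eqP ->; rewrite mulr0.
exists (upd f i c), i; split; first by rewrite /upd eqxx.
by rewrite cramer_upd // mulf_neq0.
Qed.

Lemma Lat_mulm m N (B : 'M[K]_(m, N + N)) (A A' : 'M[P]_2) (y : vec) : A *m A' = 1%:M -> A' *m A = 1%:M ->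
  Lat (B *m mulm N N A) y <-> Lat B (A' *m y).
Proof.
move=> h h'; rewrite /Lat -(tau_mulm _ _ (leqnn N)); split=> H.
  by have := submxMr (mulm N N A') H; rewrite -mulmxA mulm_mul // h' mulm1 mulmx1.
have := submxMr (mulm N N A) H.
by rewrite -mulmxA mulm_mul // h mulm1 mulmx1.
Qed.

(** The bases of the two-dimensional modules begin with the lowest weight vector, so [e] acts by the
    matrix unit of index (1, 0) and [f] by that of index (0, 1). *)
Definition Xe (p : P) : 'M[P]_2 := p *: delta_mx 1 0.
Definition Xf (p : P) : 'M[P]_2 := p *: delta_mx 0 1.
Definition Fmx (p : P) : 'M[P]_2 := 1%:M + Xf p.

Lemma EmxE p : Emx p = 1%:M + Xe p.
Proof.
apply/matrixP => i j; rewrite !mxE.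
by case: i => [[|[|//]] ?]; case: j => [[|[|//]] ?]; rewrite /=; ring.
Qed.

Lemma Xe2 p : Xe p *m Xe p = 0.
Proof. by rewrite -scalemxAl -scalemxAr mul_delta_mx_0 // !scaler0. Qed.

Lemma Xf2 p : Xf p *m Xf p = 0.
Proof. by rewrite -scalemxAl -scalemxAr mul_delta_mx_0 // !scaler0. Qed.

Lemma FmxN p : Fmx p *m Fmx (- p) = 1%:M.
Proof.
rewrite /Fmx /Xf mulmxDl mul1mx mulmxDr mulmx1 -scalemxAl -scalemxAr mul_delta_mx_0 //.
by rewrite !scaler0 addr0 scaleNr addrNK.
Qed.

Lemma FmxN' p : Fmx (- p) *m Fmx p = 1%:M.
Proof. by rewrite -{2}[p]opprK FmxN. Qed.

Lemma EmxN (p : P) : Emx p *m Emx (- p) = 1%:M /\ Emx (- p) *m Emx p = 1%:M.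
Proof. by rewrite !EmxD addrN addNr Emx0. Qed.

Context (s : nat) (s_gt1 : (1 < s)%N) (N : 'I_s -> nat).
Context (N_gt0 : forall k, (0 < N k)%N).
Context (N_dec : forall k k' : 'I_s, (k < k')%N -> (N k' < N k)%N).
Context (U : vectType K) (phi : colfam N -> 'Hom(U, K^o)).
Context (phi_inj : forall u, (forall f, phi f u = 0) -> u = 0).
Context (v : U) (v_plucker : has_plucker phi v (fun k => B0 (N k))).
(** A separate polynomial for each factor lets [Eop] include the operator of N_j that acts only on
    the last factors. *)
Context (Eop : ('I_s -> P) -> 'End(U)) (Fop : P -> 'End(U)).
Context (Eop_slot : forall q, slot_op phi (Eop q) (fun k => mulm (N k) (N k) (Xe (q k)))).
Context (Fop_slot : forall p, slot_op phi (Fop p) (fun k => mulm (N k) (N k) (Xf p))).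

Let k0 : 'I_s := Ordinal (ltnW s_gt1).

Lemma N_le (k k' : 'I_s) : (k <= k')%N -> (N k' <= N k)%N.
Proof. by rewrite leq_eqVlt => /orP[/eqP/val_inj -> //|/N_dec/ltnW]. Qed.

Lemma N_le0 k : (N k <= N k0)%N.
Proof. exact: N_le. Qed.

Lemma has_plucker_sub u B B' : (forall k, row_free (B k)) ->
  (forall k, (B k <= B' k)%MS) -> has_plucker phi u B <-> has_plucker phi u B'.
Proof.
move=> Bf BB; have H k : exists2 C : 'M_(N k), C \in unitmx & B' k = C *m B k.
  by have [_] := row_free_eq (Bf k) (BB k).
have {H} /dep_choice [d dP] : forall k, exists C : 'M_(N k), C \in unitmx /\ B' k = C *m B k.
  by move=> k; have [C Cu CE] := H k; exists C.
have E f : \prod_k pluck (B' k) (f k) = \prod_k \det (d k) * \prod_k pluck (B k) (f k).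
  by rewrite -big_split; apply: eq_bigr => k _; rewrite (dP k).2 pluck_mul.
have d0 : \prod_k \det (d k) != 0.
  by rewrite prodf_seq_neq0; apply/allP => k _; rewrite -unitfE -unitmxE (dP k).1.
split=> -[c c0 uB].
  exists (c / \prod_k \det (d k)); first by rewrite mulf_neq0 ?invr_eq0.
  by move=> f; rewrite uB E mulrA divfK.
exists (c * \prod_k \det (d k)); first by rewrite mulf_neq0.
by move=> f; rewrite uB E mulrA.
Qed.

Lemma has_plucker_prop u u' B : has_plucker phi u B -> has_plucker phi u' B ->
  exists2 c, c != 0 & u' = c *: u.
Proof.
move=> [a a0 uB] [b b0 uB']; exists (b / a); first by rewrite mulf_neq0 ?invr_eq0.
apply/eqP; rewrite -subr_eq0; apply/eqP/phi_inj => f.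
by rewrite linearB linearZ /= -[_ *: _]/(_ * _) uB uB' mulrA divfK // subrr.
Qed.

Lemma has_pluckerZ u B c : c != 0 -> has_plucker phi u B -> has_plucker phi (c *: u) B.
Proof.
move=> c0 [a a0 uB]; exists (c * a) => [|f]; first by rewrite mulf_neq0.
by rewrite linearZ /= -[_ *: _]/(_ * _) uB mulrA.
Qed.

Lemma has_plucker_neq0 u B : (forall k, row_free (B k)) -> has_plucker phi u B -> u != 0.
Proof.
move=> Bf [c c0 uB].
have /dep_choice [f f0] : forall k, exists f, pluck (B k) f != 0.
  by move=> k; exact: row_free_pluck.
apply: contraTneq isT => u0; have /eqP := uB f.
rewrite u0 linear0 eq_sym mulf_eq0 (negbTE c0) /=.
by rewrite prodf_seq_eq0 => /hasP[k _]; rewrite (negbTE (f0 k)).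
Qed.

Lemma good_mulm (B : forall k, 'M[K]_(N k, N k + N k)) (A A' : 'M[P]_2) : A *m A' = 1%:M -> A' *m A = 1%:M ->
  good B -> good (fun k => B k *m mulm (N k) (N k) A).
Proof.
move=> h h' [Bf BX BS]; split.
- move=> k; apply: inj_row_free => x e; apply: (row_free_inj (Bf k)); rewrite mul0mx.
  rewrite -[LHS]mulmx1 -mulm1 -h' -(@mulm_mul _ (N k) (N k)) // mulmxA -(mulmxA x) e.
  by rewrite mul0mx.
- move=> k y /(Lat_mulm _ _ h h') H; apply/(Lat_mulm _ _ h h').
  by rewrite -scalemxAr; exact: BX.
- move=> k k' kk y /(Lat_mulm _ _ h h') H; apply/(Lat_mulm _ _ h h').
  exact: BS kk _ H.
Qed.

Lemma good_B0 : good (fun k => B0 (N k) : 'M[K]_(N k, N k + N k)).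
Proof.
have E k y : Lat (B0 (N k)) y <-> cyc 0 (N k) y.
  by rewrite -cycP Emx0 mulm1 mulmx1.
split=> [k|k y|k k' kk y]; first exact: B0_free.
  move=> /E[a [z ->]]; apply/E; exists ('X * a), ('X *: z).
  by rewrite scalerDr !scalerA ['X * 'X^_]mulrC.
move=> /E[a [z ->]]; apply/E.
by rewrite -(subnK (N_le kk)) addnC exprD -scalerA; exact: cyc_E1.
Qed.

Inductive orb : U -> Prop :=
| orb_v : orb v
| orb_E p u : orb u -> orb (nexp (Eop (fun=> p)) u)
| orb_F p u : orb u -> orb (nexp (Fop p) u).

Definition orb_lines : set {vspace U} := [set L | exists2 u, orb u & L = <[u]>%VS].

Lemma plucker_E q u B : has_plucker phi u B ->
  has_plucker phi (nexp (Eop q) u) (fun k => B k *m mulm (N k) (N k) (Emx (q k))).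
Proof.
move=> uB; have := has_plucker_nexp char0 phi_inj (Eop_slot q) _ uB.
rewrite (_ : (fun k => _) = fun k => B k *m mulm (N k) (N k) (Emx (q k))); last first.
  by apply/functional_extensionality_dep => k; rewrite EmxE mulmD mulm1.
by apply=> k; rewrite mulm_mul // Xe2 mulm0.
Qed.

Lemma plucker_F p u B : has_plucker phi u B ->
  has_plucker phi (nexp (Fop p) u) (fun k => B k *m mulm (N k) (N k) (Fmx p)).
Proof.
move=> uB; have := has_plucker_nexp char0 phi_inj (Fop_slot p) _ uB.
rewrite (_ : (fun k => _) = fun k => B k *m mulm (N k) (N k) (Fmx p)); last first.
  by apply/functional_extensionality_dep => k; rewrite mulmD mulm1.
by apply=> k; rewrite mulm_mul // Xf2 mulm0.
Qed.

(** [Emx p] and [Fmx p] commute with t and are invertible, also at t = 0. So each exponential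
    preserves goodness and the existence of an element of the first lattice that is nonzero at t =
    0. *)
Lemma orb_good u : orb u -> exists B, [/\ has_plucker phi u B, good B &
  exists2 y : vec, Lat (B k0) y & ((y 0 0)`_0 != 0) || ((y 1 0)`_0 != 0)].
Proof.
elim=> [|p {}u _ [B [uB gB [y yB y0]]]|p {}u _ [B [uB gB [y yB y0]]]].
- exists (fun k => B0 (N k)); split=> //; first exact: good_B0.
  exists E1; last by rewrite !mxE coefC oner_eq0.
  by apply: (eq_row_sub (Ordinal (N_gt0 k0))); rewrite rowK expr0 scale1r.
- have [h h'] := EmxN p; exists (fun k => B k *m mulm (N k) (N k) (Emx p)); split.
  + exact: (plucker_E (fun=> p)).
  + exact: good_mulm h h' gB.
  + exists (Emx p *m y); first by rewrite (Lat_mulm _ _ h h') mulmxA h' mul1mx.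
    rewrite !mulmx2E !mxE /= mul1r mul0r addr0 mul1r coefD coefM big_ord1 /=.
    by move: y0; have [->|//] := eqVneq (y 0 0)`_0 0; rewrite /= mulr0 add0r.
- have h := FmxN p; have h' := FmxN' p; exists (fun k => B k *m mulm (N k) (N k) (Fmx p)); split.
  + exact: plucker_F.
  + exact: good_mulm h h' gB.
  + exists (Fmx p *m y); first by rewrite (Lat_mulm _ _ h h') mulmxA h' mul1mx.
    rewrite !mulmx2E !mxE /= !mulr0 !addr0 add0r !mul1r mulr1 mul0r add0r coefD coefM big_ord1 /=.
    move: y0; have [->|b0 _] := eqVneq (y 1 0)`_0 0; last by rewrite orbT.
    by rewrite /= mulr0 addr0.
Qed.

(** An element of the first lattice with invertible first entry scales to (1, p) modulo t^(N k0).
    All lattices of the tuple contain it, so by rank they are the cyclic ones of slope [p], and [w]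
    is a multiple of exp (e (x) p) v. *)
Lemma good_orb w B (y : vec) : has_plucker phi w B -> good B -> Lat (B k0) y ->
  ((y 0 0)`_0 != 0) || ((y 1 0)`_0 != 0) -> exists2 u, orb u & <[w]>%VS = <[u]>%VS.
Proof.
have lineZ c u : c != 0 -> <[c *: u]>%VS = <[u]>%VS.
  move=> c0; apply/eqP; rewrite eqEsubv; apply/andP; split.
    by rewrite -memvE memvZ // memv_line.
  by rewrite -memvE -{1}[u](scalerK c0) memvZ // memv_line.
have big w' B' (y' : vec) : has_plucker phi w' B' -> good B' -> Lat (B' k0) y' ->
    (y' 0 0)`_0 != 0 -> exists2 c, c != 0 & exists2 u, orb u & w' = c *: u.
  move=> wB gB yB y0; have [a [b ab]] := inv_mod_Xn (N k0) y0.
  pose p := a * y' 1 0.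
  have Ep : Lat (B' k0) (Emx p *m E1).
    have -> : Emx p *m E1 = a *: y' + 'X^(N k0) *: (- b *: E1).
      rewrite Emx_E1 [in RHS](vecE y') scalerDr !scalerA ab addrAC -scalerDl.
      by rewrite mulrN addrK scale1r.
    by apply: LatD; [apply: LatZ => // ?; exact: (good_X gB) | exact: LatXn].
  have sub k : (B0 (N k) *m mulm (N k) (N k) (Emx p) <= B' k)%MS.
    apply/Lat_sub => x /cycP[c [z ->]]; apply: LatD; last exact: LatXn.
    by apply: LatZ => [?|]; [exact: (good_X gB) | exact: (good_sub gB) Ep].
  have /(has_plucker_sub _ _ sub) h : has_plucker phi w' B' by [].
  have [|c c0 e] := has_plucker_prop (plucker_E (fun=> p) v_plucker) (h _).
    by move=> k; apply: row_free_mulm; exact: B0_free.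
  by exists c => //; exists (nexp (Eop (fun=> p)) v) => //; do 2!constructor.
move=> wB gB yB; have [y0 y1|y0 _] := eqVneq (y 0 0)`_0 0; last first.
  by have [c c0 [u uo ->]] := big _ _ _ wB gB yB y0; exists u => //; exact: lineZ.
(* When only the second entry is invertible, the exponential of f adds it to the first; the
   exponential of -f brings the result back. *)
have h := FmxN 1; have h' := FmxN' 1.
have [||c c0 [u uo wu]] := big _ _ (Fmx 1 *m y) (plucker_F 1 wB) (good_mulm h h' gB).
- by rewrite (Lat_mulm _ _ h h') mulmxA h' mul1mx.
- have -> : (Fmx 1 *m y) 0 0 = y 0 0 + y 1 0 by rewrite mulmx2E !mxE /=; ring.
  by rewrite coefD y0 add0r.
have wF := plucker_F (- 1) (plucker_F 1 wB).
have {}wF : has_plucker phi (nexp (Fop (- 1)) (nexp (Fop 1) w)) B.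
  move: wF; rewrite (_ : (fun k => _) = B) //.
  by apply/functional_extensionality_dep => k; rewrite -mulmxA mulm_mul // h' mulm1 mulmx1.
have [d d0 e] := has_plucker_prop wF wB.
exists (nexp (Fop (- 1)) u); first by constructor.
by rewrite e wu linearZ scalerA lineZ // mulf_neq0.
Qed.

(** Where the coordinate [f0] is nonzero, the normalised matrices have quotients of coordinates as
    entries. That the coordinates are products of minors, that the lattices are t-stable and that
    they are nested become identities between regular functions of the chart; they pass from the
    orbit to its closure. *)
Lemma closure_good L : zariski_closure orb_lines L ->
  exists w B, [/\ w != 0, L = <[w]>%VS, has_plucker phi w B & good B].
Proof.
move=> cl; have [d1 _] := cl.
have [w w0 Lw] : exists2 w : U, w != 0 & L = <[w]>%VS.
  exists (vpick L); first by rewrite vpick0 -dimv_eq0 d1.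
  apply/eqP; rewrite eq_sym eqEdim d1 dim_vline vpick0 -dimv_eq0 d1 andbT.
  by rewrite -memvE memv_pick.
have [f0 f0w] : exists f, phi f w != 0.
  by apply: contrapT => H; case/eqP: w0; apply: phi_inj => f; apply/eqP; apply: contraT => h; case: H; exists f.
pose la := phi f0.
pose Bn u k : 'M[K]_(N k, N k + N k) :=
  \matrix_(i, c) ((phi (@updf _ N f0 k i c) u : K) / la u).
(* The rows span t^a L_k read modulo t^(N k'). As [Bn u k'] is the identity on the columns [f0 k'],
   inclusion in its row space means that [T] is [Tc] times [Bn u k'], with no unknown coefficients.
   The case a = 1, k = k' is t-stability; a = 0 is nesting. *)
pose T k k' a u := Bn u k *m mulm (N k) (N k') ('X^a)%:M.
pose Tc k k' a u := colsub (f0 k') (T k k' a u).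
have lin := chart_fun_lin la.
have CR := chart_fun_subring la; have [Cc CD CM] := CR.
have onS L' x : orb_lines L' -> x \in L' -> la x != 0 -> [/\
    forall f, (phi f x : K) / la x = \prod_k pluck (Bn x k) (f k),
    forall k, colsub (f0 k) (Bn x k) = 1%:M
  & forall (k k' : 'I_s) a, (k <= k')%N -> T k k' a x = Tc k k' a x *m Bn x k'].
  move=> [u1 ou ->] /vlineP[c ->] l0.
  have c0 : c != 0 by apply: contraNneq l0 => ->; rewrite scale0r linear0.
  have [B [uB gB _]] := orb_good ou.
  have {uB} := has_pluckerZ c0 uB; set u : U := c *: u1 in l0 *.
  move=> [e e0 uB].
  have fB k : pluck (B k) (f0 k) != 0.
    by move: l0; rewrite /la uB mulf_eq0 (negbTE e0) /= prodf_seq_neq0 => /allP/(_ k)/(_ (mem_index_enum _)).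
  have Cu k : colsub (f0 k) (B k) \in unitmx by rewrite unitmxE unitfE; exact: fB.
  have BnE k : Bn u k = invmx (colsub (f0 k) (B k)) *m B k.
    apply/matrixP => i j; rewrite mxE /la !uB (prod_updf (fun k => pluck (B k))) cramer_upd //.
    rewrite [in X in _ / X](bigD1 k) //=.
    have q0 : \prod_(l | l != k) pluck (B l) (f0 l) != 0.
      by apply/prodf_neq0 => l _; exact: fB.
    move: (fB k) => pk; field.
    by rewrite e0 q0 pk.
  split.
  - move=> f; rewrite /la !uB -mulf_div divff // mul1r -prodf_div.
    apply: eq_bigr => k _; rewrite BnE pluck_mul det_inv mulrC; congr (_ * _).
  - move=> k; rewrite BnE -(mulVmx (Cu k)); apply/matrixP => a b; rewrite !mxE.
    by apply: eq_bigr => l _; rewrite !mxE.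
  - move=> k k' a kk.
    have /submxP[D TE] : (T k k' a u <= Bn u k')%MS.
      have BB l : (Bn u l :=: B l)%MS by rewrite BnE; apply: eqmxMfull; rewrite row_full_unit unitmx_inv.
      rewrite BB; apply: submx_trans (_ : (B k *m mulm (N k) (N k') ('X^a)%:M <= _)%MS).
        by rewrite /T submxMr // BB.
      apply/row_subP => i; rewrite row_mul mul_mulm mul_scalar_mx.
      suff : Lat (B k') ('X^a *: untau (row i (B k))) by [].
      apply: LatZ => [?|]; first exact: (good_X gB).
      by apply: (good_sub gB) kk _ _; rewrite /Lat untauK row_sub.
    rewrite /Tc TE; congr (_ *m _).
    rewrite -[LHS]mulmx1; have <- : colsub (f0 k') (Bn u k') = 1%:M.
      rewrite BnE -(mulVmx (Cu k')); apply/matrixP => i b; rewrite !mxE.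
      by apply: eq_bigr => l _; rewrite !mxE.
    by apply/matrixP => i b; rewrite !mxE; apply: eq_bigr => l _; rewrite !mxE.
have wL : w \in L by rewrite Lw memv_line.
have BnP k i c : chart_fun la (fun u => Bn u k i c).
  rewrite (_ : (fun _ => _) = fun u => (phi (@updf _ N f0 k i c) u : K) / la u) //.
  by apply/funext => u; rewrite mxE.
have TP k k' a i c : chart_fun la (fun u => T k k' a u i c).
  by apply: (fun_subring_mulmx CR) => // x b; exact: Cc.
exists w, (Bn w); split=> //.
  exists (la w) => // f; apply: (mulIf (invr_neq0 f0w)).
  rewrite [la w * _]mulrC mulfK //; apply/eqP; rewrite -subr_eq0; apply/eqP.
  apply: (chart_fun_closed (G := fun u => (phi f u : K) / la u - \prod_k pluck (Bn u k) (f k)) _ _ cl wL f0w).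
    apply: (fun_subring_sub CR); first exact: lin.
    by apply: (fun_subring_prod CR) => k; exact: (fun_subring_pluck CR).
  by move=> L' u SL uL l0; have [-> _ _] := onS L' u SL uL l0; rewrite subrr.
have T1 k : colsub (f0 k) (Bn w k) = 1%:M.
  apply/matrixP => a b; apply/eqP; rewrite -subr_eq0; apply/eqP.
  apply: (chart_fun_closed (G := fun u => colsub (f0 k) (Bn u k) a b - (1%:M : 'M[K]_(N k)) a b) _ _ cl wL f0w).
    apply: (fun_subring_sub CR); last exact: Cc.
    rewrite (_ : (fun _ => _) = fun u => Bn u k a (f0 k b)) //.
    by apply/funext => u; rewrite mxE.
  by move=> L' u SL uL l0; have [_ -> _] := onS L' u SL uL l0; rewrite subrr.
have TT (k k' : 'I_s) a : (k <= k')%N -> (T k k' a w <= Bn w k')%MS.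
  move=> kk; suff -> : T k k' a w = Tc k k' a w *m Bn w k' by exact: submxMl.
  apply/matrixP => i j; apply/eqP; rewrite -subr_eq0; apply/eqP.
  apply: (chart_fun_closed (G := fun u => T k k' a u i j - (Tc k k' a u *m Bn u k') i j) _ _ cl wL f0w).
    apply: (fun_subring_sub CR) => //; apply: (fun_subring_mulmx CR) => // x b.
    rewrite (_ : (fun _ => _) = fun u => T k k' a u x (f0 k' b)) //.
    by apply/funext => u; rewrite mxE.
  by move=> L' u SL uL l0; have [_ _ /(_ _ _ _ kk) ->] := onS L' u SL uL l0; rewrite subrr.
have LT (k k' : 'I_s) a y : (k <= k')%N -> Lat (Bn w k) y -> Lat (Bn w k') ('X^a *: y).
  move=> kk yB; apply: submx_trans (TT _ _ a kk).
  by rewrite -mul_scalar_mx -(tau_mulm _ _ (N_le kk)) submxMr.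
split.
- move=> k; apply: inj_row_free => x e; rewrite -[x]mulmx1 -(T1 k).
  apply/matrixP => i j; move/matrixP: e => /(_ i (f0 k j)); rewrite !mxE => e; rewrite -[RHS]e.
  by apply: eq_bigr => l _; rewrite !mxE.
- by move=> k y yB; rewrite -['X]expr1; exact: LT yB.
- by move=> k k' kk y yB; rewrite -[y]scale1r -(expr0 'X); exact: LT kk yB.
Qed.


Lemma cyc_eq_plucker (B : forall k, 'M[K]_(N k, N k + N k)) (q : 'I_s -> P) u :
    (forall k, row_free (B k)) -> (forall k y, Lat (B k) y <-> cyc (q k) (N k) y) ->
  has_plucker phi u B <-> has_plucker phi u (fun k => B0 (N k) *m mulm (N k) (N k) (Emx (q k))).
Proof.
move=> Bf BE; apply: has_plucker_sub => // k.
by apply/Lat_sub => y /BE/cycP.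
Qed.

Lemma good_closure w B : w != 0 -> has_plucker phi w B -> good B ->
  zariski_closure orb_lines <[w]>%VS.
Proof.
move=> w0 wB gB; have [kap kn BE] := chain_exists gB.
have ku l : kap l \in unitmx by exact: normal_letter_unit.
have [r r0 rP] := perturb_word_generic (N k0) ku.
apply: (@zariski_closure_limit _ char0 _ _ _ _ phi_inj _ _
   (fun x k => lat_basis (perturb_word (N k0) kap x) (N k)) _ r0) => //.
- by move=> k; apply: lat_basis_poly => l; exact: perturb_word_poly.
- move=> x /rP gen.
  have [||p pE] := @big_cell _ (perturb_word (N k0) kap x) (N k0).
  + by move=> l; case: (gen l).
  + by move=> l _; case: (gen l).
  exists <[nexp (Eop (fun=> p)) v]>%VS, (nexp (Eop (fun=> p)) v).
  split; [by exists (nexp (Eop (fun=> p)) v) => //; do 2!constructor | exact: memv_line |].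
  have pu l : perturb_word (N k0) kap x l \in unitmx by case: (gen l).
  apply/(@cyc_eq_plucker _ (fun=> p)); last exact: (plucker_E (fun=> p)).
    by move=> k; exact: lat_basis_free.
  by move=> k y; rewrite -pE ?N_le0 //; apply: iff_sym; exact: lat_basisP.
- have p0 k : lat_basis (perturb_word (N k0) kap 0) (N k) = lat_basis kap (N k).
    apply/row_matrixP => i; rewrite !rowK /gam (@gw_ext _ _ kap) // => l li.
    by rewrite /perturb_word perturb0 (leq_trans li) // (leq_trans (ltn_ord i)) ?N_le0.
  apply/(@has_plucker_sub _ B) => // k; first exact: (good_free gB).
  by rewrite p0; apply/Lat_sub => y /BE /lat_basisP; apply.
Qed.

Lemma cycX (p : P) m (y : vec) : cyc p m y -> cyc p m.+1 ('X *: y).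
Proof.
move=> [a [z ->]]; exists ('X * a), z.
by rewrite scalerDr !scalerA exprS.
Qed.

Lemma cyc_le (p : P) m m' (y : vec) : (m' <= m)%N -> cyc p m y -> cyc p m' y.
Proof.
move=> mm [a [z ->]]; exists a, ('X^(m - m') *: z).
by rewrite scalerA -exprD subnKC.
Qed.

Context (wa : 'I_s -> U).
Let Bwa (al : 'I_s) k : 'M[K]_(N k, N k + N k) := if (k < al)%N then B1 (N k) else B0 (N k).
Context (wa_plucker : forall al, has_plucker phi (wa al) (Bwa al)).

(** Factors are numbered from 0, so k < al are the first alpha factors and [N al] is n - j; the
    extra term is then the one of degree n - j - 1 in N_j. *)
Definition shift_at (al : 'I_s) p (c : K) : 'I_s -> P :=
  fun k => if (al <= k)%N then p + 'X^((N al).-1) * c%:P else p.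

Definition N_lines (al : 'I_s) : set {vspace U} :=
  [set L | exists p c, L = <[nexp (Eop (shift_at al p c)) (wa al)]>%VS].

Let BN al p c k := Bwa al k *m mulm (N k) (N k) (Emx (shift_at al p c k)).

Lemma N_plucker al p c : has_plucker phi (nexp (Eop (shift_at al p c)) (wa al)) (BN al p c).
Proof. exact: plucker_E. Qed.

Lemma N_gt1 (al k : 'I_s) : (k < al)%N -> (1 < N k)%N.
Proof. by move=> /N_dec; apply: leq_ltn_trans. Qed.

Lemma BN_free al p c k : row_free (BN al p c k).
Proof. by apply: row_free_mulm; rewrite /Bwa; case: ifP => _; [exact: B1_free | exact: B0_free]. Qed.

Lemma BN_lt (al : 'I_s) p c (k : 'I_s) (y : vec) : (k < al)%N -> Lat (BN al p c k) y <->
  exists2 y', y = 'X *: y' & cyc p (N k - 2) y'.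
Proof.
move=> ka; rewrite /BN /Bwa ka /shift_at leqNgt ka /=.
by apply: tcycP; exact: N_gt1 ka.
Qed.

Lemma BN_ge (al : 'I_s) p c (k : 'I_s) (y : vec) : (al <= k)%N -> Lat (BN al p c k) y <->
  cyc (p + 'X^((N al).-1) * c%:P) (N k) y.
Proof. by move=> ka; rewrite /BN /Bwa ltnNge ka /shift_at ka; exact: cycP. Qed.

(** The case to watch is k < al <= k'. There N k - 2 >= N al - 1, so the term c t^(N al - 1) does
    not affect the cyclic lattice of length N al - 1, and multiplication by t gains the missing
    power. *)
Lemma BN_good al p c : good (BN al p c).
Proof.
split=> [k|k y|k k' kk y]; first exact: BN_free.
  case: (ltnP k al) => ka; rewrite ?(BN_lt _ _ _ ka) ?(BN_ge _ _ _ ka).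
    by move=> [y' -> h]; exists ('X *: y') => //; apply: cyc_le (cycX h).
  by move=> h; apply: cyc_le (cycX h).
case: (ltnP k al) => ka; last first.
  rewrite (BN_ge _ _ _ ka) (BN_ge _ _ _ (leq_trans ka kk)).
  by apply: cyc_le; exact: N_le.
rewrite (BN_lt _ _ _ ka) => -[y' -> h]; case: (ltnP k' al) => ka'.
  rewrite (BN_lt _ _ _ ka'); exists y' => //.
  by apply: cyc_le h; have := N_le kk; lia.
rewrite (BN_ge _ _ _ ka').
have h' : cyc p (N al).-1 y' by apply: cyc_le h; have := N_dec ka; lia.
rewrite -(cyc_ext _ c%:P) in h'.
apply: cyc_le (cycX h'); rewrite prednK //; exact: N_le.
Qed.

Lemma N_sub_closure al : zariski_closure (N_lines al) `<=` zariski_closure orb_lines.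
Proof.
apply: zariski_closure_trans => _ [p [c ->]].
apply: good_closure (N_plucker al p c) (BN_good al p c).
exact: has_plucker_neq0 (BN_free al p c) (N_plucker al p c).
Qed.

(** Linear forms separate: an orbit point has a nonzero coordinate using a column [c] of degree 0 in
    t, whereas at the points of N_j this column of the first matrix is zero, since the first lattice
    lies in t O^2. *)
Lemma N_not_orb (al : 'I_s) L : (0 < al)%N -> zariski_closure (N_lines al) L -> ~ orb_lines L.
Proof.
move=> al0 cl [u ou Lu]; have [B [uB gB [y yB y0]]] := orb_good ou.
have N0 := N_gt0 k0.
pose c := if (y 0 0)`_0 != 0 then lshift (N k0) (Ordinal N0) else rshift (N k0) (Ordinal N0).
have [i0 Bc] : exists i0, B k0 i0 c != 0.
  apply: contrapT => H; case/submxP: yB => D /rowP/(_ c).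
  rewrite [RHS]mxE big1 => [|j _]; last first.
    by apply/eqP; rewrite mulf_eq0; apply/orP; right; apply: contraT => h; case: H; exists j.
  rewrite /c; move: y0; case: ifP => h; rewrite ?row_mxEl ?row_mxEr mxE /= => y0 e.
    by rewrite e eqxx in h.
  by rewrite e eqxx in y0.
have [f1 [i [fi f1B]]] := row_free_pluck_col (good_free gB k0) Bc.
have /dep_choice [g gB0] : forall k, exists f, pluck (B k) f != 0.
  by move=> k; apply: row_free_pluck; exact: (good_free gB).
pose f : colfam N := dfwith g f1.
have fu : phi f u != 0.
  have [e e0 ->] := uB; rewrite mulf_neq0 // prodf_seq_neq0; apply/allP => k _ /=.
  by rewrite /f; case: dfwithP => // ? ?; rewrite gB0.
case/negP: fu; apply/eqP.
apply: (zariski_closure_lin _ cl); last by rewrite Lu memv_line.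
move=> _ u' [p [c' ->]] /vlineP[a ->]; rewrite linearZ /=.
have [e _ ->] := N_plucker al p c'.
rewrite (bigD1 k0) //= /f dfwith_in.
suff -> : pluck (BN al p c' k0) f1 = 0 by rewrite mul0r mulr0 scaler0.
have B0c j : BN al p c' k0 j c = 0.
  have /(BN_lt _ _ _ (k := k0) al0)[y' ey _] : Lat (BN al p c' k0) (untau (row j (BN al p c' k0))).
    by rewrite /Lat untauK row_sub.
  have -> : BN al p c' k0 j c = tau (N k0) (untau (row j (BN al p c' k0))) 0 c.
    by rewrite untauK [RHS]mxE.
  by rewrite ey /c; case: ifP => _; rewrite ?row_mxEl ?row_mxEr !mxE coefXM.
rewrite /pluck (expand_det_col _ i) big1 // => j _.
by rewrite mxE fi B0c mul0r.
Qed.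

Lemma lat_wmx (kap : nat -> 'M[K]_2) m (y : vec) : (forall l, kap l \in unitmx) -> kap m.+1 = wmx ->
  in_lat kap m.+2 y <-> exists2 y', y = 'X *: y' & in_lat kap m y'.
Proof.
move=> ku kw; rewrite /in_lat contract_eq //; split=> [[x ->]|[_ -> [x ->]]].
  by rewrite -scalemxAl; eexists => //; rewrite -mulmxA; eexists.
have [k1 _] := pm_inv ku m.
exists (pm wmx *m (pm (invmx (kap m)) *m x)).
rewrite -scalemxAl -!mulmxA (mulmxA (pm wmx)) -map_mxM wmxK map_mx1 mul1mx.
by rewrite (mulmxA (pm (kap m))) k1 mul1mx.
Qed.

Lemma contract_unit (kap : nat -> 'M[K]_2) j : (forall l, kap l \in unitmx) ->
  forall l, contract kap j l \in unitmx.
Proof.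
move=> ku l; rewrite /contract; case: ifP => // _; case: ifP => // _.
have wu : (wmx : 'M[K]_2) \in unitmx by apply: normal_letter_unit; left.
by rewrite !unitmx_mul !ku wu.
Qed.

Lemma contract_lat (kap : nat -> 'M[K]_2) j l (y : vec) :
    (forall l, kap l \in unitmx) -> kap j.+1 = wmx -> (j <= l)%N ->
  in_lat kap l.+2 y <-> exists2 y', y = 'X *: y' & in_lat (contract kap j) l y'.
Proof.
move=> ku kw; rewrite leq_eqVlt => /orP[/eqP <-|jl].
  by rewrite lat_wmx // /in_lat contract_lt.
rewrite /in_lat (contract_ge kw jl); split=> [[x ->]|[_ -> [x ->]]].
  by rewrite -scalemxAl; eexists => //; eexists.
by exists x; rewrite scalemxAl.
Qed.

Definition override (kap : nat -> 'M[K]_2) m A l := if l == m then A else kap l.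

(** Normal form of a boundary point. The word [kap] is contracted at an inner [wmx] in position j +
    1; it gives the lattices after [al] directly and those before [al] up to a factor t, and only
    the lattice [al] has its own last letter [A]. The cases depend on how the colengths lie around j
    + 1. *)
Lemma boundary_word L : zariski_closure orb_lines L -> ~ orb_lines L ->
  exists w B (al : 'I_s) kap A, [/\ w != 0, L = <[w]>%VS, has_plucker phi w B & good B] /\
    [/\ (0 < al)%N, forall l, kap l \in unitmx & A \in unitmx] /\
    [/\ forall k : 'I_s, (al < k)%N -> forall y, Lat (B k) y <-> in_lat kap (N k) y,
        forall y, Lat (B al) y <-> in_lat (override kap (N al).-1 A) (N al) y
      & forall k : 'I_s, (k < al)%N -> forall y,
          Lat (B k) y <-> exists2 y', y = 'X *: y' & in_lat kap (N k - 2) y'].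
Proof.
move=> cl nL; have [w [B [w0 Lw wB gB]]] := closure_good cl.
have [kap kn BE] := chain_exists gB.
have ku l : kap l \in unitmx by exact: normal_letter_unit.
have [|i /andP[i0 iN] ki] := exists_wmx kn (N_gt0 k0).
  move=> y /BE yB; have [y0|y0] := eqVneq (y 0 0)`_0 0; last first.
    by case: nL; rewrite Lw; have [|u ou ->] := good_orb wB gB yB; [rewrite y0 | exists u].
  have [y1|y1] := eqVneq (y 1 0)`_0 0; first by [].
  by case: nL; rewrite Lw; have [|u ou ->] := good_orb wB gB yB; [rewrite y1 orbT | exists u].
case: i i0 iN ki => // j _ jN kj; set kap' := contract kap j.
have k'u : forall l, kap' l \in unitmx by exact: contract_unit.
have small (k : 'I_s) y : (N k <= j)%N -> Lat (B k) y <-> in_lat kap' (N k) y.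
  by move=> kj'; rewrite BE /in_lat contract_lt.
have large (k : 'I_s) y : (j.+1 < N k)%N ->
    Lat (B k) y <-> exists2 y', y = 'X *: y' & in_lat kap' (N k - 2) y'.
  move=> kj'; rewrite BE -(contract_lat (j := j)) //; last lia.
  by rewrite (_ : (N k - 2).+2 = N k) //; lia.
exists w, B.
(* A lattice of colength j + 1 stops just before [wmx]: it sees [kap j] where the contracted word
   has the merged letter. *)
have [k1 Nk1|none] := pickP (fun k : 'I_s => N k == j.+1).
  move/eqP: Nk1 => Nk1.
  exists k1, kap', (kap j); split=> //; split.
    split=> //; rewrite lt0n; apply: contraTneq jN => k10.
    by rewrite -Nk1 (_ : k1 = k0) ?ltnn //; exact: val_inj.
  split=> [k k1k y|y|k kk1 y].
  + by apply: small; have := N_dec k1k; lia.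
  + rewrite BE Nk1 /in_lat /= {2}/override eqxx.
    by rewrite (@gw_ext _ (override _ _ _) kap') ?contract_lt // => l lj; rewrite /override ltn_eqF.
  + by apply: large; have := N_dec kk1; lia.
have not_j (k : 'I_s) : N k != j.+1 by rewrite none.
(* The colengths jump over j + 1: [al] is the first index with colength at most j, and [A] is the
   letter already present. *)
have [k1 Nk1|none'] := pickP (fun k : 'I_s => N k <= j)%N.
  pose al := [arg min_(k < k1 | (N k <= j)%N) (k : nat)].
  have [Nal alP] : (N al <= j)%N /\ forall k : 'I_s, (N k <= j)%N -> (al <= k)%N.
    by rewrite /al; case: arg_minnP.
  exists al, kap', (kap' (N al).-1); split=> //; split.
    split=> //; rewrite lt0n; apply: contraTneq jN => al0.
    by rewrite -leqNgt (leq_trans _ (leq_trans Nal (leqnSn j))) // (_ : al = k0) //; exact: val_inj.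
  split=> [k alk y|y|k kal y].
  + by apply: small; have := N_dec alk; lia.
  + rewrite small //; rewrite /in_lat (@gw_ext _ (override _ _ _) kap') // => l _.
    by rewrite /override; case: eqP => // ->.
  + apply: large; have := not_j k; have := alP k; lia.
(* All lattices lie in t O^2. Then [al] is the last index, and A = w expresses t Lambda_(N al - 2)
   by a word of length [N al]. *)
have lt_s : (s.-1 < s)%N by lia.
pose al : 'I_s := Ordinal lt_s.
have big k : (j.+1 < N k)%N by have := not_j k; have := none' k; lia.
have wu : (wmx : 'M[K]_2) \in unitmx by apply: normal_letter_unit; left.
exists al, kap', wmx; split=> //; split.
  by split=> //=; lia.
split=> [k alk y|y|k kal y].
- by have := ltn_ord k; move: alk => /=; lia.
- rewrite large //.
  have e : N al = (N al - 2).+2%N by have := big al; lia.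
  rewrite [X in in_lat _ X _]e lat_wmx.
  + rewrite /in_lat (@gw_ext _ (override _ _ _) kap') // => l lN.
    by rewrite /override ltn_eqF //; lia.
  + by move=> l; rewrite /override; case: ifP.
  + by rewrite /override {2}e /= eqxx.
- exact: large.
Qed.

(** By [big_cell] the perturbed word and its variant ending in the perturbed [A] give slopes p and
    p2. They share N al - 1 letters, so p2 - p is c t^(N al - 1) modulo t^(N al), and this c is the
    parameter z of N_j. *)
Lemma boundary_sub L : zariski_closure orb_lines L -> ~ orb_lines L ->
  exists2 al : 'I_s, (0 < al)%N & zariski_closure (N_lines al) L.
Proof.
move=> cl nL; have [w [B [al [kap [A [[w0 Lw wB gB] [[al0 ku Au] [h1 h2 h3]]]]]]]] := boundary_word cl nL.
exists al => //; rewrite Lw.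
have [r r0 rP] := perturb_word_generic (N k0) ku.
have Nal := N_gt0 al.
have NalE : N al = (N al).-1.+1 by rewrite prednK.
pose pw := perturb_word (N k0) kap.
(* Before [al], the letters 1 and w follow N k - 2 perturbed letters, so by [lat_wmx] the lattice
   remains t times a lattice of the perturbed chain for generic x; this w is not perturbed. *)
pose W x (k : 'I_s) : nat -> 'M[K]_2 :=
  if (k < al)%N then override (override (pw x) (N k - 2)%N 1%:M) (N k - 2).+1%N wmx
  else if k == al then override (pw x) (N al).-1 (perturb x A) else pw x.
have wu : (wmx : 'M[K]_2) \in unitmx by apply: normal_letter_unit; left.
have poly_cst c : poly_fun (fun=> c : K) by exists c%:P => x; rewrite hornerC.
have Wp k l i j : poly_fun (fun x => W x k l i j).
  rewrite /W /override; case: (k < al)%N.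
    case: (l == (N k - 2).+1)%N => //; case: (l == N k - 2)%N => //.
    exact: perturb_word_poly.
  case: (k == al); last exact: perturb_word_poly.
  by case: (l == (N al).-1)%N; [exact: perturb_poly | exact: perturb_word_poly].
have Wlt x (k : 'I_s) y : (k < al)%N -> (forall l, pw x l \in unitmx) ->
    in_lat (W x k) (N k) y <-> exists2 y', y = 'X *: y' & in_lat (pw x) (N k - 2) y'.
  move=> kal pu; rewrite /W kal; have e : N k = (N k - 2).+2%N by have := N_gt1 kal; lia.
  rewrite [X in in_lat _ X _]e lat_wmx; last by rewrite /override eqxx.
    rewrite /in_lat (@gw_ext _ (override _ _ _) (pw x)) // => l lN.
    by rewrite /override !ltn_eqF // ltnW.
  by move=> l; rewrite /override; case: ifP => // _; case: ifP => // _; exact: unitmx1.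
apply: (@zariski_closure_limit _ char0 _ _ _ _ phi_inj _ (r * generic_at A)
   (fun x k => lat_basis (W x k) (N k))) => //.
- by rewrite mulf_neq0 // generic_at_neq0.
- by move=> k; exact: lat_basis_poly.
- move=> x; rewrite hornerM mulf_eq0 negb_or => /andP[/rP gen /generic_atP[Axu Ax0]].
  have pu l : pw x l \in unitmx by case: (gen l).
  have p0 l : pw x l 0 0 != 0 by case: (gen l).
  have Wu k l : W x k l \in unitmx.
    rewrite /W /override; case: ifP => _; [case: ifP => _ //|case: ifP => _ //].
      by case: ifP => _ //; exact: unitmx1.
    by case: ifP.
  have [p pE] := @big_cell _ (pw x) (N k0) pu (fun l _ => p0 l).
  have Walu : forall l, W x al l \in unitmx by move=> l; exact: Wu.
  have [l _|p2 p2E] := @big_cell _ (W x al) (N al) Walu.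
    by rewrite /W ltnn eqxx /override; case: ifP.
  have Nal0 := N_le0 al.
  have agree : gw (W x al) (N al).-1 = gw (pw x) (N al).-1.
    by apply: gw_ext => l lN; rewrite /W ltnn eqxx /override ltn_eqF.
  have [c cE] : exists c : K, cyc p2 (N al) = cyc (p + 'X^((N al).-1) * c%:P) (N al).
    have : cyc p (N al).-1 (Emx p2 *m E1).
      rewrite -pE; last lia.
      rewrite /in_lat -agree -/(in_lat (W x al) _ _) p2E; last lia.
      by exists 1, 0; rewrite scaler0 addr0 scale1r.
    move=> [a [z e]].
    have ea : 1 = a + 'X^((N al).-1) * z 0 0.
      by move/matrixP: e => /(_ 0 0); rewrite !Emx_E1 !mxE /= !mulr0 !addr0 !mulr1.
    have eb : p2 = a * p + 'X^((N al).-1) * z 1 0.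
      by move/matrixP: e => /(_ 1 0); rewrite !Emx_E1 !mxE /= !mulr1 !add0r.
    (* Eliminating [a] between [ea] and [eb] gives p2 = p + t^(N al - 1) q, and only q(0) matters
       modulo t^(N al). *)
    pose q := z 1 0 - z 0 0 * p.
    have -> : p2 = p + 'X^((N al).-1) * (q`_0)%:P + 'X^(N al) * drop_poly 1 q.
      rewrite eb (_ : a = 1 - 'X^((N al).-1) * z 0 0); last by rewrite {1}ea addrK.
      rewrite [in 'X^(N al)]NalE exprSr -[_ * 'X * _]mulrA -addrA -mulrDr -poly_split /q; ring.
    by exists q`_0; rewrite cyc_ext.
  exists <[nexp (Eop (shift_at al p c)) (wa al)]>%VS, (nexp (Eop (shift_at al p c)) (wa al)).
  split; [by exists p, c | exact: memv_line |].
  apply/(@has_plucker_sub _ _ (BN al p c)); last exact: N_plucker.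
    by move=> k; exact: lat_basis_free (Wu k) _.
  move=> k; apply/Lat_sub => y /(lat_basisP (Wu k)).
  have [kal|alk] := ltnP k al.
    move/(Wlt x k y kal pu) => [y' -> h]; apply/(BN_lt _ _ _ kal); exists y' => //.
    by apply/pE => //; have := N_le0 k; lia.
  rewrite (BN_ge _ _ _ alk); have [->|kal] := eqVneq k al.
    by rewrite -cE; move/p2E; apply.
  have alk' : (al < k)%N by rewrite ltn_neqAle alk eq_sym kal.
  rewrite {1}/W ltnNge alk /= (negbTE kal) => /pE h.
  have := h (N_le0 k); have Nk := N_dec alk'.
  by rewrite -(cyc_ext _ ('X^((N al).-1 - N k) * c%:P)) mulrA -exprD subnKC //; lia.
- have gen0 l : pw 0 l \in unitmx.
    by rewrite /pw /perturb_word perturb0; case: ifP => // _; exact: unitmx1.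
  have pw0 m : (m <= N k0)%N -> gw (pw 0) m = gw kap m.
    by move=> mN; apply: gw_ext => l lm; rewrite /pw /perturb_word perturb0 (leq_trans lm).
  have Wu k l : W 0 k l \in unitmx.
    rewrite /W /override; case: ifP => _; [case: ifP => _ //|case: ifP => _ //].
      by case: ifP => _ //; exact: unitmx1.
    by case: ifP => // _; rewrite perturb0.
  apply/(@has_plucker_sub _ B) => // k; first exact: (good_free gB).
  apply/Lat_sub => y yB; apply/lat_basisP => //.
  have [kal|alk] := ltnP k al.
    apply/Wlt => //; have /(h3 k kal)[y' -> yk] := yB; exists y' => //.
    by rewrite /in_lat pw0 //; have := N_le0 k; lia.
  have [ek|kal] := eqVneq k al.
    subst k; have /h2 := yB; rewrite /in_lat /W ltnn eqxx perturb0.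
    rewrite (@gw_ext _ (override kap _ _) (override (pw 0) (N al).-1 A)) // => l lN.
    rewrite /override; case: ifP => // _.
    by rewrite /pw /perturb_word perturb0 (leq_trans lN) ?N_le0.
  have alk' : (al < k)%N by rewrite ltn_neqAle alk eq_sym kal.
  rewrite /W ltnNge alk /= (negbTE kal) /in_lat pw0 ?N_le0 //.
  exact/(h1 k alk').
Qed.

Theorem boundary_eq L : zariski_closure orb_lines L /\ ~ orb_lines L <->
  exists2 al : 'I_s, (0 < al)%N & zariski_closure (N_lines al) L.
Proof.
split=> [[cl nL]|[al al0 clN]]; first exact: boundary_sub.
by split; [exact: N_sub_closure clN | exact: N_not_orb clN].
Qed.

End Geometry.

(** * Fusion products of two-dimensional modules *)

Section TensorFunctionals.
Local Open Scope ring_scope.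
Context {K : fieldType}.

Lemma prod_sum_dffun (R : comNzRingType) (I : finType) (T : I -> finType)
    (F : forall i, T i -> R) :
  \prod_i \sum_j F i j = \sum_(g : {dffun forall i, T i}) \prod_i F i (g i).
Proof.
pose P i : {ffun T i -> R} := [ffun j => F i j].
have -> : \prod_i \sum_j F i j = \prod_i \sum_(j in tagged_with T i) untag 0 (P i) j.
  apply: eq_bigr => i _; transitivity (\sum_j P i j).
    by apply: eq_bigr => j _; rewrite ffunE.
  exact: (big_tag (fun i => P i)).
rewrite bigA_distr_big_dep -big_fprod (reindex (@fprod_of_dffun I T)) /=; last first.
  exact/onW_bij/fprod_of_dffun_bij.
apply: eq_bigr => g _; apply: eq_bigr => i _; rewrite ffunE; congr (F i _).
by rewrite -[in RHS](fprod_of_dffunK g) ffunE.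
Qed.

Context (I : finType) (M : I -> vectType K).
Implicit Types (la : forall i, 'Hom(M i, K^o)).

Lemma vbasis_coord (V : vectType K) (k l : 'I_(\dim {:V})) :
  coord (vbasis {:V}) l (vbasis {:V})`_k = (k == l)%:R.
Proof. by rewrite coord_free ?(basis_free (vbasisP _)) // eq_sym. Qed.

Lemma tens_tbasis (J J' : tidx M) : tens (tbasis J) J' = (J == J')%:R :> K.
Proof.
rewrite ffunE; have [->|JJ] := eqVneq J J'.
  by rewrite big1 // => i _; rewrite /tbasis vbasis_coord eqxx.
have [i Ji] : exists i, J i != J' i.
  apply/existsP; apply: contraNT JJ; rewrite negb_exists => /forallP h.
  by apply/eqP/ffunP => i; have := h i; rewrite negbK => /eqP.
by rewrite (bigD1 i) //= /tbasis vbasis_coord (negbTE Ji) mul0r.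
Qed.

Lemma tensor_expand (x : tensor M) : x = \sum_J (x J : K) *: tens (tbasis J).
Proof.
apply/ffunP => J; rewrite sum_ffunE (bigD1 J) //= big1 ?addr0 => [|J' JJ].
  by rewrite ffunE tens_tbasis eqxx -[RHS]/(_ * _) mulr1.
by rewrite ffunE tens_tbasis (negbTE JJ) scaler0.
Qed.

Lemma tens_ext (W : vectType K) (h g : 'Hom(tensor M, W)) :
  (forall u, h (tens u) = g (tens u)) -> forall x, h x = g x.
Proof.
move=> hg x; rewrite [x]tensor_expand !linear_sum.
by apply: eq_bigr => J _; rewrite !linearZ /= hg.
Qed.

Lemma tfun_exists la : exists h : 'Hom(tensor M, K^o), forall x,
  h x = \sum_J (x J : K) * \prod_i la i (tbasis J i).
Proof.
apply: lfun_of_linear => a x y; rewrite scaler_sumr -big_split; apply: eq_bigr => J _ /=.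
by rewrite !ffunE mulrDl -[a *: (x J * _)]/(a * (_ * _)) mulrA.
Qed.

Definition tfun la : 'Hom(tensor M, K^o) := sval (cid (tfun_exists la)).

Lemma tfun_tens la u : tfun la (tens u) = \prod_i (la i (u i) : K).
Proof.
rewrite /tfun; case: cid => h /= ->.
have -> : \prod_i (la i (u i) : K) =
    \prod_i \sum_(j < \dim {:M i}) coord (vbasis {:M i}) j (u i) * la i (vbasis {:M i})`_j.
  apply: eq_bigr => i _; rewrite {1}(coord_vbasis (memvf (u i))) linear_sum.
  by apply: eq_bigr => j _; rewrite linearZ.
rewrite (@prod_sum_dffun _ _ (fun i => 'I_(\dim {:M i}) : finType)
   (fun i j => coord (vbasis {:M i}) j (u i) * la i (vbasis {:M i})`_j)).
by apply: eq_bigr => J _; rewrite ffunE -big_split.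
Qed.

(** By [joint_inj_span] each basis coordinate of a factor is a combination of the [mu i]; expanding
    products, each coordinate of the tensor product is a combination of forms [tfun]. *)
Lemma tfun_inj (F : I -> finType) (mu : forall i, F i -> 'Hom(M i, K^o)) :
    (forall i u, (forall f, mu i f u = 0) -> u = 0) ->
  forall x, (forall g : forall i, F i, tfun (fun i => mu i (g i)) x = 0) -> x = 0.
Proof.
move=> muI x x0; apply/ffunP => J; rewrite [RHS]ffunE.
have /dep_choice [co coE] : forall i, exists c : F i -> K,
    forall u, coord (vbasis {:M i}) (J i) u = \sum_f c f * mu i f u.
  move=> i; have [h hE] : exists h : 'Hom(M i, K^o), forall u, h u = coord (vbasis {:M i}) (J i) u.
    by apply: lfun_of_linear => a u v; rewrite linearP.
  by have [c cE] := joint_inj_span (muI i) h; exists c => u; rewrite -hE.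
have [h hE] : exists h : 'Hom(tensor M, K^o), forall y, h y = y J.
  by apply: lfun_of_linear => a y z; rewrite !ffunE.
have [h' hE'] : exists h' : 'Hom(tensor M, K^o), forall y, h' y =
    \sum_(g : {dffun forall i, F i}) (\prod_i co i (g i)) * tfun (fun i => mu i (g i)) y.
  apply: lfun_of_linear => a y z; rewrite scaler_sumr -big_split; apply: eq_bigr => g _ /=.
  by rewrite linearP mulrDr -[a *: (_ * tfun _ y)]/(a * (_ * _)) mulrCA.
rewrite -hE (_ : h x = h' x); first by rewrite hE' big1 // => g _; rewrite x0 mulr0.
apply: tens_ext => u; rewrite hE hE' ffunE.
rewrite (eq_bigr _ (fun i _ => coE i (u i))).
rewrite (@prod_sum_dffun _ _ F (fun i f => co i f * mu i f (u i))).
by apply: eq_bigr => g _; rewrite tfun_tens big_split.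
Qed.

Lemma dim_tensor : \dim {:tensor M} = (\prod_i \dim {:M i})%N.
Proof.
rewrite dimvf /dim /= muln1 card_dep_ffun foldrE big_image /=.
by apply: eq_bigr => i _; rewrite card_ord.
Qed.

End TensorFunctionals.

(** * Linear independence of the minors of (1, p) *)

Section ToeplitzMinors.
Context {K : fieldType} (char0 : [pchar K]%R =i pred0).
Context (n : nat).
Notation E1 := (@e1 K).
Let b := n.+1.

(** Uniqueness of digits in base b = n + 1: an exponent occurs at most n times, so a higher leading
    power exceeds the whole other sum. Zero exponents count as well, so the length is determined. *)
Lemma sum_expn_inj (a a' : seq nat) : sorted geq a -> sorted geq a' ->
    (size a < b)%N -> (size a' < b)%N ->
  (\sum_(x <- a) b ^ x = \sum_(x <- a') b ^ x)%N -> a = a'.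
Proof.
have bound x r : path geq x r -> (size r).+1 < b -> (\sum_(y <- x :: r) b ^ y < b ^ x.+1)%N.
  move=> pr sr; have /allP h : all (geq x) r.
    by apply: order_path_min pr => ? ? ? /= h1 h2; exact: leq_trans h2 h1.
  apply: (@leq_ltn_trans (\sum_(y <- x :: r) b ^ x)%N).
    rewrite big_seq [leqRHS]big_seq; apply: leq_sum => y; rewrite inE.
    by case/orP => [/eqP -> //|/h yx]; rewrite leq_pexp2l.
  by rewrite big_const_seq count_predT iter_addn_0 mulnC expnS ltn_pmul2r ?expn_gt0.
have pos x r : (b ^ x <= \sum_(y <- x :: r) b ^ y)%N by rewrite big_cons leq_addr.
elim: a a' => [|x a IH] [|y a'] //.
- by move=> _ _ _ _ e; have := pos y a'; rewrite -e big_nil leqNgt expn_gt0.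
- by move=> _ _ _ _ e; have := pos x a; rewrite e big_nil leqNgt expn_gt0.
move=> /= sa sa' na na' e.
have [xy|yx|exy] := ltngtP x y.
- have := leq_ltn_trans (leq_trans (leq_pexp2l (ltn0Sn n) xy) (pos y a')) (eq_rect _ (fun s => (s < _)%N) (bound x a sa na) _ e).
  by rewrite ltnn.
- have := leq_ltn_trans (leq_trans (leq_pexp2l (ltn0Sn n) yx) (pos x a)) (eq_rect _ (fun s => (s < _)%N) (bound y a' sa' na') _ (esym e)).
  by rewrite ltnn.
rewrite exy; congr (_ :: _); apply: IH; rewrite ?(ltnW na) ?(ltnW na') ?(path_sorted sa) ?(path_sorted sa') //.
by move: e; rewrite !big_cons exy => /addnI.
Qed.

(** The largest moved index l0 is sent below itself, so its term is at least b times b^(s l0 - l0),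
    more than the at most n terms of index up to l0 on the left; the later terms agree. *)
Lemma sum_expn_perm (s : nat -> nat) r (sg : {perm 'I_n}) :
    (forall l l', (l <= l' < r)%N -> (s l - l <= s l' - l')%N) ->
    (forall l, (l < r)%N -> (l <= s l)%N) ->
    (forall l : 'I_n, (r <= l)%N -> sg l = l) ->
    (forall l : 'I_n, (l < r)%N -> (sg l <= s l)%N) -> sg != 1%g ->
  (\sum_(l < n | (l < r)%N) b ^ (s l - l) < \sum_(l < n | (l < r)%N) b ^ (s l - sg l))%N.
Proof.
move=> mono sl fixr sgs sg1.
have [l1 l1P] : exists l, sg l != l.
  apply/existsP; apply: contraNT sg1; rewrite negb_exists => /forallP h.
  by apply/eqP/permP => l; rewrite perm1; have := h l; rewrite negbK => /eqP.
pose l0 := [arg max_(l > l1 | sg l != l) (l : nat)].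
have [l0P l0max] : sg l0 != l0 /\ forall l : 'I_n, sg l != l -> (l <= l0)%N.
  by rewrite /l0; case: arg_maxnP.
have gt_fix (l : 'I_n) : (l0 < l)%N -> sg l = l.
  by move=> ll; apply/eqP; apply: contraTT ll => /l0max; rewrite -leqNgt.
have l0r : (l0 < r)%N by rewrite ltnNge; apply: contra l0P => /fixr ->.
have lt0 : (sg l0 < l0)%N.
  rewrite ltn_neqAle l0P leqNgt; apply: contra l0P => /gt_fix /perm_inj ->.
  by [].
rewrite (bigID (fun l : 'I_n => (l0 < l)%N)) [ltnRHS](bigID (fun l : 'I_n => (l0 < l)%N)) /=.
have -> : (\sum_(l < n | (l < r) && (l0 < l)) b ^ (s l - sg l) =
   \sum_(l < n | (l < r) && (l0 < l)) b ^ (s l - l))%N.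
  by apply: eq_bigr => l /andP[_ /gt_fix ->].
rewrite ltn_add2l.
have h0 : ((l0 < r) && ~~ (l0 < l0))%N by rewrite ltnn l0r.
apply: (@leq_trans (b ^ (s l0 - sg l0))%N); last first.
  by rewrite (bigD1 l0) ?h0 //= leq_addr.
apply: (@leq_trans (b ^ (s l0 - l0).+1)%N); last first.
  by rewrite leq_pexp2l //; have := sl _ l0r; lia.
apply: (@leq_ltn_trans (\sum_(l < n) b ^ (s l0 - l0))%N).
  rewrite [leqRHS](bigID (fun l : 'I_n => (l < r) && ~~ (l0 < l)))%N /=.
  apply: leq_trans (leq_addr _ _); apply: leq_sum => l /andP[lr ll].
  by rewrite leq_pexp2l // mono // leqNgt ll l0r.
by rewrite sum_nat_const card_ord expnS ltn_pmul2r ?expn_gt0.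
Qed.

Implicit Types (S : {set 'I_n}).

Definition elt S l : nat := nth 0%N [seq val i | i <- enum S] l.

(** The matrix of the cyclic lattice is an identity block followed by a Toeplitz block in the
    coefficients of p. The first |S| identity columns are exchanged for the Toeplitz columns indexed
    by [S], which gives 2^n minors. *)
Definition minor_cols S : 'I_n -> 'I_(n + n) :=
  fun l => if (l < #|S|)%N then rshift n (nth l (enum S) l) else lshift n l.

Lemma sorted_enum S : sorted ltn [seq val i | i <- enum S].
Proof.
have -> : [seq val i | i <- enum S] = [seq i <- iota 0 n | i \in [seq val i | i <- enum S]].
  rewrite -val_enum_ord filter_map; congr map.
  have -> : enum S = filter (mem S) (enum 'I_n) by rewrite enumT.
  apply: eq_filter => i /=; rewrite (mem_map val_inj).
  by rewrite mem_filter mem_enum andbT.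
by apply: sorted_filter (iota_ltn_sorted 0 n) => ? ? ?; exact: ltn_trans.
Qed.

Lemma elt_lt S l l' : (l < l')%N -> (l' < #|S|)%N -> (elt S l < elt S l')%N.
Proof.
move=> ll lS; apply: (sorted_ltn_nth ltn_trans 0%N (sorted_enum S)) => //;
  by rewrite inE size_map -cardE // (ltn_trans ll).
Qed.

Lemma elt_ge S l : (l < #|S|)%N -> (l <= elt S l)%N.
Proof.
elim: l => // l IH lS; apply: leq_ltn_trans (IH (ltnW lS)) _.
exact: elt_lt.
Qed.

Lemma elt_mono S l l' : (l <= l' < #|S|)%N -> (elt S l - l <= elt S l' - l')%N.
Proof.
case/andP; elim: l' => [|l' IH]; first by rewrite leqn0 => /eqP ->.
rewrite leq_eqVlt => /orP[/eqP -> //|]; rewrite ltnS => ll lS.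
apply: leq_trans (IH ll (ltnW lS)) _.
by have := elt_lt (ltnSn l') lS; lia.
Qed.

Definition min_exp S := (\sum_(l < n | (l < #|S|)%N) b ^ (elt S l - l))%N.

Lemma card_le S : (#|S| <= n)%N.
Proof. by rewrite -[n in (_ <= n)%N]card_ord max_card. Qed.

Lemma min_exp_inj : injective min_exp.
Proof.
pose al S := rev [seq (elt S l - l)%N | l <- iota 0 #|S|].
have E S : min_exp S = (\sum_(x <- al S) b ^ x)%N.
  rewrite (perm_big [seq (elt S l - l)%N | l <- iota 0 #|S|]) ?perm_rev //=.
  rewrite big_map (_ : iota _ _ = index_iota 0 #|S|) ?/index_iota ?subn0 //.
  rewrite -{1}[#|S|]subn0 -/(index_iota 0 #|S|) (big_mkord xpredT (fun l => b ^ (elt S l - l))%N).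
  by rewrite (big_ord_widen n (fun l => b ^ (elt S l - l))%N (card_le S)).
have sz S : (size (al S) < b)%N by rewrite size_rev size_map size_iota ltnS card_le.
have srt S : sorted geq (al S).
  rewrite /al rev_sorted sorted_map.
  have : {in iota 0 #|S| &, forall l l', (l <= l')%N -> (elt S l - l <= elt S l' - l')%N}.
    by move=> l l'; rewrite !mem_iota /= => _ l'S ll; apply: elt_mono; rewrite ll.
  move=> h; apply: sub_in_sorted (iota_sorted 0 #|S|); first exact: h.
  by apply/allP.
move=> S S' e; have := sum_expn_inj (srt S) (srt S') (sz S) (sz S'); rewrite -!E => /(_ e).
move/(congr1 rev); rewrite !revK => e'.
have eS : #|S| = #|S'| by have := congr1 size e'; rewrite !size_map !size_iota.
have : [seq val i | i <- enum S] = [seq val i | i <- enum S'].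
  apply: (@eq_from_nth _ 0%N); first by rewrite !size_map -!cardE.
  move=> l; rewrite size_map -cardE => lS.
  have lS' : (l < #|S'|)%N by rewrite -eS.
  have := congr1 (nth 0%N ^~ l) e'.
  rewrite !(nth_map 0%N) ?size_iota // !nth_iota // !add0n.
  by have := elt_ge lS; have := elt_ge lS'; rewrite -!/(elt _ l); lia.
by move=> h; rewrite -[S]set_enum -[S']set_enum (inj_map (@ord_inj n) h).
Qed.

Local Open Scope ring_scope.

(** The submatrix of [minor_cols S] after the substitution p_k = y^(b^k), whose sparse exponents
    keep the lowest terms for different [S] apart. *)
Let Mx S : 'M[{poly K}]_n := \matrix_(i, l)
  if (l < #|S|)%N then if (i <= elt S l)%N then 'X^(b ^ (elt S l - i)) else 0
  else (l == i)%:R.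

(** The identity permutation contributes y^(min_exp S); every other one contributes 0 or, by
    [sum_expn_perm], a strictly higher power. *)
Lemma coef_det_Mx S e : (e <= min_exp S)%N -> (\det (Mx S))`_e = (e == min_exp S)%:R.
Proof.
move=> eS; rewrite -det_tr /determinant (bigD1 1%g) //= coefD.
rewrite [X in _ + X](_ : _ = 0) ?addr0.
  rewrite odd_perm1 expr0 mul1r.
  have -> : \prod_i (Mx S)^T i ((1%g : {perm 'I_n}) i) = 'X^(min_exp S).
    rewrite /min_exp -prodrXr [RHS]big_mkcond; apply: eq_bigr => l _; rewrite !mxE perm1.
    by case: ifP => lS; rewrite ?elt_ge // eqxx.
  by rewrite coefXn.
rewrite coef_sum big1 // => sg sg1.
have -> : (-1) ^+ sg = ((-1) ^+ sg)%:P :> {poly K} by rewrite polyC_exp polyCN.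
rewrite coefCM.
have [/forallP ok|] := boolP [forall l : 'I_n, if (l < #|S|)%N then (sg l <= elt S l)%N else l == sg l].
  have -> : \prod_i (Mx S)^T i (sg i) = 'X^(\sum_(l < n | (l < #|S|)%N) b ^ (elt S l - sg l)).
    rewrite -prodrXr [RHS]big_mkcond; apply: eq_bigr => l _; rewrite !mxE.
    by have := ok l; case: ifP => lS ->.
  rewrite coefXn (_ : (e == _) = false) ?mulr0 //; apply/negbTE; rewrite neq_ltn.
  apply/orP; left; apply: leq_ltn_trans eS _; apply: sum_expn_perm => //.
  - by move=> l l'; exact: elt_mono.
  - by move=> l; exact: elt_ge.
  - by move=> l; have := ok l; case: ltnP => // _ /eqP <-.
  - by move=> l lS; have := ok l; rewrite lS.
rewrite negb_forall => /existsP[l lP]; rewrite (bigD1 l) //= !mxE.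
by move: lP; case: ifP => lS /negbTE -> ; rewrite mul0r coef0 mulr0.
Qed.

Lemma coef_Mx S (p : {poly K}) (y : K) : (forall k, (k < n)%N -> p`_k = y ^+ (b ^ k)) ->
  pluck (B0 n *m mulm n n (Emx p)) (minor_cols S) = (\det (Mx S)).[y] :> K.
Proof.
move=> py; rewrite -[_.[y]]/(horner_eval y _) -det_map_mx /pluck; congr (\det _).
have rowE i c : (B0 n *m mulm n n (Emx p)) i c = tau n ('X^i *: (E1 + p *: @e2 K)) 0 c.
  by rewrite -Emx_E1 -row_B0 [RHS]mxE.
apply/matrixP => i l; rewrite [LHS]mxE rowE [RHS]mxE [Mx S i l]mxE /minor_cols /= /horner_eval; case: ifP => lS.
  have -> : elt S l = nth l (enum S) l by rewrite /elt (nth_map l) // -cardE.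
  rewrite row_mxEr mxE (_ : ('X^i *: (E1 + p *: @e2 K)) 1 0 = 'X^i * p); last by rewrite !mxE /=; ring.
  rewrite coefXnM ltnNge.
  case: leqP => h /=; last by rewrite horner0.
  by rewrite py ?hornerXn //; apply: leq_ltn_trans (leq_subr _ _) (ltn_ord _).
rewrite row_mxEl mxE (_ : ('X^i *: (E1 + p *: @e2 K)) 0 0 = 'X^i); last by rewrite !mxE /=; ring.
rewrite coefXn.
by rewrite -val_eqE /=; case: eqP => _; rewrite ?hornerC ?horner0.
Qed.

(** In a relation, the lowest power of y among the terms with nonzero coefficient occurs once, by
    [min_exp_inj], and cannot cancel. *)
Lemma minors_free (c : {set 'I_n} -> K) :
    (forall p : {poly K}, \sum_S c S * pluck (B0 n *m mulm n n (Emx p)) (minor_cols S) = 0) ->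
  forall S, c S = 0.
Proof.
move=> H; have Q0 : \sum_S (c S)%:P * \det (Mx S) = 0.
  apply: (poly_eq0 char0) => y; rewrite horner_sum -[RHS](H (\poly_(k < n) y ^+ (b ^ k))).
  apply: eq_bigr => S _; rewrite hornerM hornerC (coef_Mx S (y := y)) // => k kn.
  by rewrite coef_poly kn.
move=> S; apply/eqP; apply: contraT => cS.
pose S0 := [arg min_(T < S | c T != 0) min_exp T].
have [cS0 S0min] : c S0 != 0 /\ forall T, c T != 0 -> (min_exp S0 <= min_exp T)%N.
  by rewrite /S0; case: arg_minnP.
move/polyP: Q0 => /(_ (min_exp S0)); rewrite coef_sum (bigD1 S0) //= big1 => [|T TS].
  by rewrite coefCM coef_det_Mx // eqxx mulr1 addr0 coef0 => /eqP; rewrite (negbTE cS0).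
rewrite coefCM; have [->|cT] := eqVneq (c T) 0; first by rewrite mul0r.
rewrite coef_det_Mx ?S0min // (_ : (_ == _) = false) ?mulr0 //.
by apply: contraNF TS => /eqP/min_exp_inj ->.
Qed.

End ToeplitzMinors.

(** * Plücker coordinates on the graded module *)

Section FusionTwos.
Local Open Scope ring_scope.
Context {K : fieldType} (char0 : [pchar K] =i pred0).
Context (A : seq nat) (A2 : forall i : 'I_(size A), nth 0%N A i = 2%N).
Context (M : fusion_product K A).
Notation pm := (map_mx (@polyC K)).
Let n := size A.
Let z : 'I_n -> K := fp_pt M.

(** Reads an entry by its number, so that a = 2 can remain a propositional equality without
    casts. *)
Definition ent a (y : 'cV[K]_a) (j : nat) : K := \sum_(i < a | (i : nat) == j) y i 0.

Definition irr2 (x : 'M[K]_2) : 'M[K]_2 := \matrix_(i, j)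
  (if i == 0 then if j == 0 then - x 0 0 else x 1 0
   else if j == 0 then x 0 1 else x 0 0).

Lemma ent2 (y : 'cV[K]_2) (i : 'I_2) : ent y i = y i 0.
Proof. by rewrite /ent (big_pred1 i) // => j; rewrite /= -val_eqE. Qed.

Lemma irr_mx2 x : irr_mx 2 x = irr2 x.
Proof.
apply/matrixP => i j; rewrite !mxE.
case: i => [[|[|//]] i]; case: j => [[|[|//]] j];
  rewrite /= ?muln0 ?mul1n ?muln1 ?add0n ?subn0 ?(mulr0, mul0r, addr0, add0r, mul1r, mulr1) //.
  by rewrite -{1}[1]/(1%:R) -opprB -natrB // mulrN mulr1.
by rewrite -natrB // mulr1.
Qed.

Lemma ent_irr a x (y : 'cV[K]_a) (i : 'I_2) : a = 2%N ->
  ent (irr_act a x y) i = irr2 x i 0 * ent y 0 + irr2 x i 1 * ent y 1.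
Proof.
move=> a2; subst a; rewrite ent2 (ent2 y 0) (ent2 y 1).
by rewrite lfunE /= mulmx2E irr_mx2.
Qed.

Lemma ent_linear a j : linear (fun y : 'cV[K]_a => ent y j : K^o).
Proof.
move=> c y y'; rewrite /ent scaler_sumr -big_split; apply: eq_bigr => i _ /=.
by rewrite !mxE.
Qed.

Definition bit (c : 'I_(n + n)) : 'I_2 := if split c is inl _ then 0 else 1.
Definition deg (c : 'I_(n + n)) : 'I_n := match split c with inl k => k | inr k => k end.

Lemma bitl k : bit (lshift n k) = 0.
Proof. by rewrite /bit -[lshift n k]/(unsplit (inl k)) unsplitK. Qed.
Lemma bitr k : bit (rshift n k) = 1.
Proof. by rewrite /bit -[rshift n k]/(unsplit (inr k)) unsplitK. Qed.
Lemma degl k : deg (lshift n k) = k.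
Proof. by rewrite /deg -[lshift n k]/(unsplit (inl k)) unsplitK. Qed.
Lemma degr k : deg (rshift n k) = k.
Proof. by rewrite /deg -[rshift n k]/(unsplit (inr k)) unsplitK. Qed.

(** Row i of the inverse [D] of this Vandermonde matrix lists the coefficients of the Lagrange
    idempotent at z_i. *)
Let Vnd : 'M[K]_n := \matrix_(j, i) z i ^+ j.
Let D : 'M[K]_n := invmx Vnd.

Lemma Vnd_unit : Vnd \in unitmx.
Proof.
have -> : Vnd = Vandermonde n (\row_i z i) by apply/matrixP => i j; rewrite !mxE.
rewrite unitmxE unitfE det_Vandermonde prodf_seq_neq0; apply/allP => i _ /=.
rewrite prodf_seq_neq0; apply/allP => j _; apply/implyP => ij; rewrite !mxE subr_eq0.
by rewrite (inj_eq (@fp_pt_inj _ _ M)) -val_eqE /= gtn_eqF.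
Qed.

(* Multiplication by t^k on K[t]/prod (t - z_i), in the basis of the t^j; up to
   terms of lower degree it shifts the degrees by k. *)
Let T k : 'M[K]_n := Vnd *m diag_mx (\row_i z i ^+ k) *m D.

Lemma D_T k i j : \sum_l D i l * T k l j = z i ^+ k * D i j.
Proof.
have : D *m T k = diag_mx (\row_i z i ^+ k) *m D by rewrite /T !mulmxA mulVmx ?Vnd_unit // mul1mx.
by move/matrixP/(_ i j); rewrite mul_diag_mx !mxE.
Qed.

Lemma T_shift k (j j' : 'I_n) : (j + k < n)%N -> T k j j' = ((j' : nat) == (j + k)%N)%:R.
Proof.
move=> jk; have := mulmxV Vnd_unit => /matrixP/(_ (Ordinal jk) j'); rewrite -/D !mxE.
rewrite -val_eqE eq_sym /= => <-; apply: eq_bigr => i _; congr (_ * _).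
by rewrite mul_mx_diag !mxE -exprD.
Qed.

Lemma T_gt k (j j' : 'I_n) : (j + k < j')%N -> T k j j' = 0.
Proof. by move=> h; rewrite T_shift ?(ltn_trans h) // gtn_eqF. Qed.

Lemma T_eq k (j j' : 'I_n) : (j' : nat) = (j + k)%N -> T k j j' = 1.
Proof. by move=> h; rewrite T_shift -?h // eqxx. Qed.

Lemma lam_exists i (c : 'I_(n + n)) : exists h : 'Hom(@ev_factor K A i : vectType K, K^o),
  forall y, h y = ent y (bit c) * D i (deg c).
Proof.
apply: lfun_of_linear => a y y'; rewrite ent_linear mulrDl.
by rewrite -[a *: (_ * _)]/(a * (_ * _)) mulrA.
Qed.

Definition lam i c : 'Hom(@ev_factor K A i : vectType K, K^o) := sval (cid (lam_exists i c)).

Lemma lamE i c y : lam i c y = ent y (bit c) * D i (deg c).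
Proof. by rewrite /lam; case: cid. Qed.

(* For y = y_1 (x) ... (x) y_n, this is a coordinate of the exterior product of
   the y_i 1_i in (K[t] / prod (t - z_i))^2, where 1_i is the idempotent at z_i.
   It vanishes on V^(m) when the degree of f exceeds deg0 + m, so that its
   values in the extremal degree descend to the fusion product. *)
Definition Psi (f : 'I_n -> 'I_(n + n)) : 'Hom(@ev_space K A : vectType K, K^o) :=
  \sum_(s : {perm 'I_n}) ((-1) ^+ s : K) *: tfun (fun i => lam i (f (s i))).

Definition Bz (y : forall i, @ev_factor K A i) : 'M[K]_(n, n + n) :=
  \matrix_(i, c) (ent (y i) (bit c) * D i (deg c)).

Lemma Psi_tens f y : Psi f (tens y) = pluck (Bz y) f.
Proof.
rewrite sum_lfunE; apply: eq_bigr => s _; rewrite scale_lfunE tfun_tens.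
rewrite -[LHS]/(_ * _); congr (_ * _); apply: eq_bigr => i _.
by rewrite lamE !mxE.
Qed.

Definition Xz (x : 'M[K]_2) k : 'M[K]_(n + n) :=
  \matrix_(c, c') (irr2 x (bit c') (bit c) * T k (deg c) (deg c')).

(** The leading part of [Xz], where multiplication by t^k is taken modulo t^n instead of prod (t -
    z_i); it is what acts on the graded module ([psi_act]). *)
Definition X0 (x : 'M[K]_2) k : 'M[K]_(n + n) :=
  \matrix_(c, c') (irr2 x (bit c') (bit c) * ((deg c' : nat) == (deg c + k)%N)%:R).

Lemma Bz_Xz x k y i c : (Bz y *m Xz x k) i c =
  z i ^+ k * (ent (irr_act (nth 0%N A i) x (y i)) (bit c) * D i (deg c)).
Proof.
rewrite mxE big_split_ord /= ent_irr // mulrDl mulrDr; congr (_ + _).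
  transitivity (\sum_l (irr2 x (bit c) 0 * ent (y i) 0) * (D i l * T k l (deg c))).
    by apply: eq_bigr => l _; rewrite !mxE bitl degl; ring.
  by rewrite -mulr_sumr D_T; ring.
transitivity (\sum_l (irr2 x (bit c) 1 * ent (y i) 1) * (D i l * T k l (deg c))).
  by apply: eq_bigr => l _; rewrite !mxE bitr degr; ring.
by rewrite -mulr_sumr D_T; ring.
Qed.

(** On a pure tensor, acting on the i-th vector alters row i of [Bz], and [sum_pluck_upd] turns rows
    into columns. *)
Lemma Psi_act f x k u : (Psi f (ev_act z x k u) : K) =
  \sum_j \sum_c (Psi (upd f j c) u : K) * Xz x k c (f j).
Proof.
have [h hE] : exists h : 'Hom(@ev_space K A : vectType K, K^o), forall u, h u =
    \sum_j \sum_c (Psi (upd f j c) u : K) * Xz x k c (f j).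
  apply: lfun_of_linear => a u1 u2; rewrite scaler_sumr -big_split; apply: eq_bigr => j _ /=.
  rewrite scaler_sumr -big_split; apply: eq_bigr => c _ /=.
  by rewrite linearP mulrDl -[a *: (_ * _)]/(a * (_ * _)) mulrA.
suff H y : (Psi f \o ev_act z x k)%VF (tens y) = h (tens y).
  by rewrite -hE -(tens_ext H) comp_lfunE.
rewrite hE comp_lfunE (eq_bigr (fun j => \sum_c pluck (Bz y) (upd f j c) * Xz x k c (f j))); last first.
  by move=> j _; apply: eq_bigr => c _; rewrite Psi_tens.
have -> : ev_act z x k (tens y) = \sum_i z i ^+ k *:
    tens (dfwith y (irr_act (nth 0%N A i) x (y i) : @ev_factor K A i)).
  by rewrite sum_lfunE; apply: eq_bigr => i _; rewrite scale_lfunE tlift_tens.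
rewrite sum_pluck_upd linear_sum; apply: eq_bigr => i _.
rewrite linearZ /= Psi_tens -[LHS]/(_ * _).
have -> : row_repl (colsub f (Bz y)) (colsub f (Bz y *m Xz x k)) i =
    \matrix_(a, b) ((if a == i then z i ^+ k else 1) *
       colsub f (Bz (dfwith y (irr_act (nth 0%N A i) x (y i)))) a b).
  apply/matrixP => a b; rewrite [LHS]mxE [RHS]mxE; case: (eqVneq a i) => [->|ai].
    by rewrite mxE Bz_Xz !mxE dfwith_in.
  by rewrite !mxE mul1r dfwith_out // eq_sym.
rewrite /pluck /determinant mulr_sumr; apply: eq_bigr => s _.
rewrite mulrCA; congr (_ * _).
rewrite [RHS](eq_bigr (fun a => (if a == i then z i ^+ k else 1) *
   colsub f (Bz (dfwith y (irr_act (nth 0%N A i) x (y i)))) a (s a))); last by move=> a _; rewrite mxE.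
by rewrite big_split /= -big_mkcond big_pred1_eq.
Qed.

Definition degf (f : 'I_n -> 'I_(n + n)) : nat := (\sum_j deg (f j))%N.
Definition deg0 : nat := (\sum_(j < n) j)%N.

Lemma degf_upd f j c : (degf (upd f j c) + deg (f j) = degf f + deg c)%N.
Proof.
rewrite /degf (bigD1 j) //= [in RHS](bigD1 j) //= {1}/upd eqxx.
rewrite (eq_bigr (fun i => deg (f i) : nat)) => [|i /negbTE ij]; first lia.
by rewrite /upd ij.
Qed.

Lemma pluck_B0_deg f : pluck (B0 n : 'M[K]_(n, n + n)) f != 0 -> degf f = deg0.
Proof.
move=> h; have [s hs] : exists s : {perm 'I_n}, \prod_i colsub f (B0 n : 'M[K]_(n, n + n)) i (s i) != 0.
  apply: contrapT => H; case/eqP: h; rewrite /pluck /determinant big1 // => s _.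
  by apply/eqP; rewrite mulf_eq0; apply/orP; right; apply: contraT => hs; case: H; exists s.
rewrite /degf (reindex_inj (@perm_inj _ s)); apply: eq_bigr => i _.
move/prodf_neq0: hs => /(_ i isT); rewrite mxE; case: (splitP (f (s i))) => k ek.
  have -> : f (s i) = lshift n k by exact: val_inj.
  by rewrite B0El degl; case: (i =P k) => [-> //|_]; rewrite eqxx.
have -> : f (s i) = rshift n k by exact: val_inj.
by rewrite B0Er eqxx.
Qed.

Lemma Psi_low f : Psi f (@ev_low K A) = \det D * pluck (B0 n) f :> K.
Proof.
rewrite Psi_tens -pluck_mul; congr (pluck _ f); apply/matrixP => i c.
have e0 a j : a = 2%N -> ent (irr_low a : 'cV[K]_a) j = (j == 0%N)%:R.
  move=> a2; subst a; rewrite /ent; case: j => [|j].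
    by rewrite (big_pred1 (0 : 'I_2)) ?mxE // => i'; rewrite /= -val_eqE.
  by rewrite big1 // => i' /eqP h; rewrite mxE h.
rewrite !mxE e0 //; case: (splitP c) => k ek.
  have -> : c = lshift n k by exact: val_inj.
  rewrite bitl degl mul1r (bigD1 k) //= big1 => [|l lk]; first by rewrite B0El eqxx mulr1 addr0.
  by rewrite B0El (negbTE lk) mulr0.
have -> : c = rshift n k by exact: val_inj.
by rewrite bitr mul0r big1 // => l _; rewrite B0Er mulr0.
Qed.

Lemma Xz_deg x k c c' : Xz x k c c' != 0 -> (deg c' <= deg c + k)%N.
Proof.
by rewrite mxE leqNgt; apply: contra => /(T_gt (k := k)) ->; rewrite mulr0.
Qed.

Lemma Psi_word f w : Psi f (word_app z w) != 0 ->
  (degf f <= deg0 + sumn [seq xk.2 | xk <- w])%N.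
Proof.
elim: w f => [|[x k] w IH] f /=.
  by rewrite Psi_low mulf_eq0 negb_or => /andP[_ /pluck_B0_deg ->]; rewrite addn0.
move=> h.
have [j [c jc]] : exists j c, (Psi (upd f j c) (word_app z w) : K) * Xz x k c (f j) != 0.
  apply: contrapT => H; case/eqP: h; rewrite -[LHS]/(Psi f (ev_act z x k (word_app z w)) : K) Psi_act.
  rewrite big1 // => j _; rewrite big1 // => c _; apply/eqP; apply: contraT => jc.
  by case: H; exists j, c.
move: jc; rewrite mulf_eq0 negb_or => /andP[/IH h1 /Xz_deg h2].
by have := degf_upd f j c; lia.
Qed.

Lemma Psi_fil f m u : ev_fil z m u -> (deg0 + m < degf f)%N -> Psi f u = 0.
Proof.
move=> [ws /allP wsP us] fm; apply/eqP; rewrite -memv_ker; apply: subvP us.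
apply/span_subvP => _ /mapP[w /wsP/andP[_ wm] ->]; rewrite memv_ker.
apply: contraLR fm => /Psi_word; rewrite -leqNgt => h; apply: leq_trans h _.
by rewrite leq_add2l.
Qed.

(** The coordinate [f] on the class of the sum of the symbols of [u m]: only the component of degree
    degf f - deg0, extremal for [f], contributes. Outside the range of summation the value is 0. *)
Definition top_val f (L : nat) (u : nat -> @ev_space K A) : K :=
  if (deg0 <= degf f)%N && (degf f - deg0 < L)%N then Psi f (u (degf f - deg0)%N) else 0.

(** If the class is zero, its component of degree m comes from V^(m-1), where [Psi f] vanishes for
    reasons of degree. *)
Lemma top_val_eq0 f L u : (forall m, ev_fil z m (u m)) ->
  \sum_(m < L) fp_symb M m (u m) = 0 -> top_val f L u = 0.
Proof.
move=> hu s0; rewrite /top_val; case: ifP => // /andP[h1 h2].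
have := fp_symb_direct hu s0 h2 => /(fp_symb_eq0 (hu _)).
case e : (degf f - deg0)%N => [|m] /=; first by move=> ->; rewrite linear0.
by move/Psi_fil; apply; lia.
Qed.

Lemma ev_fil_pad L u m : (forall m, ev_fil z m (u m)) -> ev_fil z m (if (m < L)%N then u m else 0).
Proof. by move=> hu; case: ifP => _ //; exact: ev_fil0. Qed.

Lemma symb_pad L L' (u : nat -> @ev_space K A) : (L <= L')%N ->
  \sum_(m < L') fp_symb M m (if (m < L)%N then u m else 0) = \sum_(m < L) fp_symb M m (u m).
Proof.
move=> LL; rewrite (sum_ord_vanish (F := fun m => fp_symb M m (if (m < L)%N then u m else 0)) LL).
  by apply: eq_bigr => m _; rewrite ltn_ord.
by move=> m Lm; rewrite ltnNge Lm linear0.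
Qed.

Lemma top_val_pad f L L' u : (L <= L')%N ->
  top_val f L' (fun m => if (m < L)%N then u m else 0) = top_val f L u.
Proof.
move=> LL; rewrite /top_val; case: (deg0 <= degf f)%N => //=.
case: (ltnP _ L) => h; first by rewrite (leq_trans h LL).
by case: ifP => //; rewrite linear0.
Qed.

(** Gives linearity and independence of the representative at once: pad all sequences with 0 to a
    common length and apply [top_val_eq0] to the difference. *)
Lemma top_valP f a L u L' u' : (forall m, ev_fil z m (u m)) -> (forall m, ev_fil z m (u' m)) ->
  forall L'' u'', (forall m, ev_fil z m (u'' m)) ->
  \sum_(m < L'') fp_symb M m (u'' m) =
    a *: \sum_(m < L) fp_symb M m (u m) + \sum_(m < L') fp_symb M m (u' m) ->
  top_val f L'' u'' = a * top_val f L u + top_val f L' u'.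
Proof.
move=> hu hu' L'' u'' hu'' e.
pose B := maxn L'' (maxn L L').
have [b1 b2 b3] : [/\ L'' <= B, L <= B & L' <= B]%N by rewrite /B; split; lia.
pose p L (u : nat -> @ev_space K A) m := if (m < L)%N then u m else 0.
pose w m := p L'' u'' m - (a *: p L u m + p L' u' m).
have hw m : ev_fil z m (w m).
  rewrite /w -scaleN1r addrC; apply: ev_filL; last exact: ev_fil_pad.
  by apply: ev_filL; exact: ev_fil_pad.
have := @top_val_eq0 f B w hw; rewrite /w.
have -> : \sum_(m < B) fp_symb M m (p L'' u'' m - (a *: p L u m + p L' u' m)) = 0.
  rewrite (eq_bigr (fun m : 'I_B => fp_symb M m (p L'' u'' m) -
     (a *: fp_symb M m (p L u m) + fp_symb M m (p L' u' m)))); last first.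
    by move=> m _; rewrite linearB linearP.
  by rewrite sumrB big_split /= -scaler_sumr !symb_pad // e subrr.
move=> /(_ erefl) h; rewrite -(top_val_pad f _ b1) -(top_val_pad f _ b2) -(top_val_pad f _ b3).
apply/eqP; rewrite -subr_eq0 -[X in _ == X]h /top_val; apply/eqP.
case: ifP => _; last by rewrite mulr0 addr0 subrr.
by rewrite linearB linearP.
Qed.

Lemma psi_exists f : exists psi : 'Hom(M : vectType K, K^o), forall L u,
  (forall m, ev_fil z m (u m)) -> psi (\sum_(m < L) fp_symb M m (u m)) = top_val f L u.
Proof.
have /choice[rep repP] : forall w : M, exists Lu : nat * (nat -> @ev_space K A),
    (forall m, ev_fil z m (Lu.2 m)) /\ w = \sum_(m < Lu.1) fp_symb M m (Lu.2 m).
  by move=> w; have [L [u [hu e]]] := fp_symb_span w; exists (L, u).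
have wd f' L u : (forall m, ev_fil z m (u m)) ->
    top_val f' L u = top_val f' (rep (\sum_(m < L) fp_symb M m (u m))).1 (rep (\sum_(m < L) fp_symb M m (u m))).2.
  move=> hu; set w := \sum_(m < L) _; have [h e] := repP w.
  rewrite (@top_valP f' 0 0 (fun=> 0) (rep w).1 (rep w).2 _ h) ?mul0r ?add0r //.
    by move=> m; exact: ev_fil0.
  by rewrite scale0r add0r -e.
have [psi psiE] : exists psi : 'Hom(M : vectType K, K^o), forall w, psi w = top_val f (rep w).1 (rep w).2.
  apply: lfun_of_linear => a w w'; have [h e] := repP w; have [h' e'] := repP w'.
  have [h'' e''] := repP (a *: w + w').
  by rewrite (@top_valP f a (rep w).1 (rep w).2 (rep w').1 (rep w').2 h h' _ _ h'') // -e -e' -e''.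
by exists psi => L u hu; rewrite psiE -wd.
Qed.

Definition psi f : 'Hom(M : vectType K, K^o) := sval (cid (psi_exists f)).

Lemma psiE f L u : (forall m, ev_fil z m (u m)) ->
  psi f (\sum_(m < L) fp_symb M m (u m)) = top_val f L u.
Proof. by move=> hu; rewrite /psi; case: cid => h /= ->. Qed.

Lemma psi_vec f : psi f (fp_vec M) = \det D * pluck (B0 n) f :> K.
Proof.
have hu m : ev_fil z m (@ev_low K A).
  apply: (@ev_filS _ _ _ 0%N) => //; exists [:: [::]] => //=.
  by rewrite span_seq1 memv_line.
have := psiE f 1 hu; rewrite big_ord1 => ->; rewrite /top_val Psi_low.
case: ifP => // h; have [->|h0] := eqVneq (pluck (B0 n : 'M[K]_(n, n + n)) f) 0; first by rewrite mulr0.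
by rewrite (pluck_B0_deg h0) subnn leqnn in h.
Qed.

Lemma psi_act f x k w : \tr x = 0 -> (psi f (fp_act M x k w) : K) =
  \sum_j \sum_c (psi (upd f j c) w : K) * X0 x k c (f j).
Proof.
move=> tx; have [L [u [hu ->]]] := fp_symb_span w.
pose u2 m := if (k <= m)%N then ev_act z x k (u (m - k)%N) else 0.
have hu2 m : ev_fil z m (u2 m).
  rewrite /u2; case: leqP => km; last exact: ev_fil0.
  by rewrite -{1}(subnK km); apply: ev_fil_act.
have -> : fp_act M x k (\sum_(m < L) fp_symb M m (u m)) = \sum_(m < k + L) fp_symb M m (u2 m).
  have z0 : \sum_(i < k) fp_symb M i (u2 i) = 0.
    by rewrite big1 // => i _; rewrite /u2 leqNgt ltn_ord linear0.
  rewrite big_split_ord /= z0 add0r.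
  rewrite linear_sum; apply: eq_bigr => i _ /=.
  by rewrite fp_actE // /u2 leq_addr addKn addnC.
rewrite psiE //.
have -> : \sum_j \sum_c (psi (upd f j c) (\sum_(m < L) fp_symb M m (u m)) : K) * X0 x k c (f j) =
  \sum_j \sum_c top_val (upd f j c) L u * X0 x k c (f j).
  by apply: eq_bigr => j _; apply: eq_bigr => c _; rewrite psiE.
pose ok := [&& (deg0 <= degf f)%N, (degf f - deg0 < k + L)%N & (k <= degf f - deg0)%N].
have -> : top_val f (k + L) u2 = \sum_j \sum_c
    (if ok then (Psi (upd f j c) (u (degf f - deg0 - k)%N) : K) * Xz x k c (f j) else 0).
  rewrite /top_val /ok /u2; case: (deg0 <= degf f)%N => /=; last first.
    by rewrite big1 // => j _; rewrite big1.
  case: (_ < _)%N => /=; last by rewrite big1 // => j _; rewrite big1.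
  case: leqP => _; last by rewrite linear0 big1 // => j _; rewrite big1.
  by rewrite -[LHS]/(Psi f (ev_act z x k _) : K) Psi_act.
apply: eq_bigr => j _; apply: eq_bigr => c _.
have e := degf_upd f j c.
(* If deg (f j) = deg c + k, both matrices have the same entry; if it is smaller, [Psi] vanishes on
   the step of the filtration; if it is larger, [Xz] is zero. *)
have [eq|ne] := eqVneq (deg (f j) : nat) (deg c + k)%N.
  have -> : X0 x k c (f j) = Xz x k c (f j) by rewrite [LHS]mxE [RHS]mxE eq eqxx T_eq.
  rewrite /top_val /ok.
  have -> : (degf f - deg0 - k = degf (upd f j c) - deg0)%N by lia.
  have -> : [&& (deg0 <= degf f)%N, (degf f - deg0 < k + L)%N & (k <= degf f - deg0)%N] =
     (deg0 <= degf (upd f j c))%N && (degf (upd f j c) - deg0 < L)%N by lia.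
  by case: ifP => //; rewrite mul0r.
rewrite [X0 _ _ _ _]mxE (negbTE ne) !mulr0; case: ifP => // /and3P[h1 h2 h3].
have [h4|h4] := leqP (deg (f j)) (deg c + k).
  by rewrite (Psi_fil (hu _)) ?mul0r //; move: ne; lia.
have [->|/Xz_deg] := eqVneq (Xz x k c (f j)) 0; first by rewrite mulr0.
by rewrite leqNgt h4.
Qed.

Lemma X0_mulm x k : X0 x k = mulm n n ('X^k *: pm (irr2 x)).
Proof.
have ud (c : 'I_(n + n)) : untau (delta_mx 0 c : 'rV[K]_(n + n)) =
    'X^(deg c) *: (delta_mx (bit c) 0 : 'cV[{poly K}]_2).
  rewrite -[c]splitK; case: (split c) => k' /=.
    rewrite bitl degl; apply: cV2P; rewrite !mxE /=.
      rewrite (_ : lsubmx _ = delta_mx 0 k') ?rVpoly_delta ?mulr1 //.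
      by apply/rowP => j; rewrite !mxE (inj_eq (@lshift_inj _ _)).
    rewrite (_ : rsubmx _ = 0) ?linear0 ?mulr0 //.
    by apply/rowP => j; rewrite !mxE eq_rlshift andbF.
  rewrite bitr degr; apply: cV2P; rewrite !mxE /=.
    rewrite (_ : lsubmx _ = 0) ?linear0 ?mulr0 //.
    by apply/rowP => j; rewrite !mxE eq_lrshift andbF.
  rewrite (_ : rsubmx _ = delta_mx 0 k') ?rVpoly_delta ?mulr1 //.
  by apply/rowP => j; rewrite !mxE (inj_eq (@rshift_inj _ _)).
apply/row_matrixP => c; rewrite rowK ud -scalemxAl -scalemxAr scalerA -exprD -colE.
have cE i : (('X^(k + deg c) *: col (bit c) (pm (irr2 x))) i 0) = 'X^(k + deg c) * (irr2 x i (bit c))%:P.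
  by rewrite mxE [col _ _ _ _]mxE mxE.
apply/rowP => c'; rewrite [LHS]mxE [LHS]mxE; case: (splitP c') => k' ek.
  have -> : c' = lshift n k' by exact: val_inj.
  by rewrite bitl degl row_mxEl [RHS]mxE cE coefMC coefXn mulrC [(k + _)%N]addnC.
have -> : c' = rshift n k' by exact: val_inj.
by rewrite bitr degr row_mxEr [RHS]mxE cE coefMC coefXn mulrC [(k + _)%N]addnC.
Qed.

End FusionTwos.

(** * Joint injectivity by a dimension count *)

Section FusionTwosInjective.
Local Open Scope ring_scope.
Context {K : fieldType} (char0 : [pchar K] =i pred0).
Context (A : seq nat) (A2 : forall i : 'I_(size A), nth 0%N A i = 2%N).
Context (M : fusion_product K A).
Notation pm := (map_mx (@polyC K)).
Let n := size A.
Let z : 'I_n -> K := fp_pt M.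
Let psiM := @psi K A A2 M.

(** The symbol map kills V^(m-1) in V^(m), so the dimensions of its images telescope; finitely many
    degrees suffice for a basis. *)
Lemma dim_fusion_le : (\dim {:M : vectType K} <= \dim {:@ev_space K A})%N.
Proof.
have /choice[U UP] m := ex_vspace (@ev_fil0 K A z m) (@ev_filL K A z m).
pose Up m := if m is m'.+1 then U m' else 0%VS.
have UpP m u : u \in Up m <-> ev_fil_pred z m u.
  by case: m => [|m] /=; [rewrite memv0; split=> /eqP | exact: UP].
pose G m := (fp_symb M m @: U m)%VS.
have dG m : (\dim (G m) + \dim (Up m) <= \dim (Up m.+1))%N.
  rewrite -[\dim (Up m.+1)](limg_ker_dim (fp_symb M m)) addnC leq_add2r dimvS //.
  apply/subvP => u uU; have uUm : u \in U m.
    by case: m uU => [|m] /=; [rewrite memv0 => /eqP ->; exact: mem0v | move/UP/(ev_filS (leqnSn m))/UP].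
  by rewrite memv_cap uUm memv_ker; apply/eqP/fp_symb_eq0; [exact/UP | exact/UpP].
have sG L : (\dim (\sum_(m < L) G m)%VS <= \dim (Up L))%N.
  elim: L => [|L IH]; first by rewrite big_ord0 dimv0.
  rewrite big_ord_recr /=; apply: leq_trans (dG L).
  by apply: leq_trans (dimv_add_leqif _ _) _; rewrite addnC leq_add2l.
have [L fullL] : exists L, (fullv <= \sum_(m < L) G m)%VS.
  have /choice[Lb LbP] : forall w : M, exists L, w \in (\sum_(m < L) G m)%VS.
    move=> w; have [L [u [hu ->]]] := fp_symb_span w; exists L.
    apply: memv_suml => m _; apply: subvP (memv_img _ (_ : u m \in U m)); last exact/UP.
    exact: (sumv_sup m).
  pose L := (\max_(b <- vbasis {:M : vectType K}) Lb b)%N; exists L.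
  rewrite -(span_basis (vbasisP {:M : vectType K})); apply/span_subvP => w wb.
  apply: subvP (LbP w); apply/subv_sumP => m _.
  have mL : (m < L)%N.
    by apply: leq_trans (ltn_ord m) _; rewrite /L (big_rem w) //= leq_maxl.
  exact: (sumv_sup (Ordinal mL)).
apply: leq_trans (dimvS fullL) (leq_trans (sG L) _).
by apply: dimvS; exact: subvf.
Qed.

Lemma dim_ev_space : \dim {:@ev_space K A} = (2 ^ n)%N.
Proof.
rewrite dim_tensor (eq_bigr (fun=> 2%N)) ; last first.
  by move=> i _; rewrite dimvf -[LHS]/(dim 'cV[K]_(nth 0%N A i)) dim_matrix A2 mulr1.
by rewrite big_const_ord iter_muln_1.
Qed.

Lemma sum_X0 x (p : {poly K}) m : (n <= m)%N ->
  \sum_(l < m) p`_l *: X0 A x l = mulm n n (p *: pm (irr2 x)).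
Proof.
move=> nm; have Xn q : mulm n n (('X^m * q) *: pm (irr2 x)) = 0.
  apply/row_matrixP => i; rewrite rowK row0 -scalemxAl -scalerA tau_Xn //.
rewrite -[in RHS](poly_take_drop m p) scalerDl mulmD [_ * 'X^m]mulrC Xn addr0.
rewrite /take_poly poly_def scaler_suml.
have -> : forall F : 'I_m -> 'M[{poly K}]_2, mulm n n (\sum_l F l) = \sum_l mulm n n (F l).
  move=> F; apply: (big_morph (mulm n n)) => [B B'|]; [exact: mulmD | exact: mulm0].
by apply: eq_bigr => l _; rewrite X0_mulm -mul_polyC -scalerA mulmZ.
Qed.

Lemma irr2_e : pm (irr2 (sl2_e : 'M[K]_2)) = delta_mx 1 0.
Proof.
apply/matrixP => i j; rewrite !mxE.
by case: i => [[|[|//]] ?]; case: j => [[|[|//]] ?]; rewrite /= ?oppr0.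
Qed.

Lemma irr2_f : pm (irr2 (sl2_f : 'M[K]_2)) = delta_mx 0 1.
Proof.
apply/matrixP => i j; rewrite !mxE.
by case: i => [[|[|//]] ?]; case: j => [[|[|//]] ?]; rewrite /= ?oppr0.
Qed.

Lemma tr_e : \tr (sl2_e : 'M[K]_2) = 0.
Proof. by rewrite /mxtrace !big_ord_recl big_ord0 !mxE /= !addr0. Qed.

Lemma tr_f : \tr (sl2_f : 'M[K]_2) = 0.
Proof. by rewrite /mxtrace !big_ord_recl big_ord0 !mxE /= !addr0. Qed.

Lemma psi_vecs : exists2 c : K, c != 0 & forall f,
  (psiM f (fp_vec M) : K) = c * pluck (B0 n) f /\
  ((0 < n)%N -> (psiM f (fp_act M sl2_e n.-1 (fp_vec M)) : K) = c * pluck (B1 n) f).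
Proof.
have [c c0 vE] : exists2 c : K, c != 0 & forall f, (psiM f (fp_vec M) : K) = c * pluck (B0 n) f.
  eexists; last by move=> f; exact: psi_vec.
  by rewrite -unitfE -unitmxE unitmx_inv; exact: Vnd_unit.
exists c => // f; split=> // n0; rewrite psi_act ?tr_e //.
transitivity (c * \sum_j \sum_b pluck (B0 n) (upd f j b) * X0 A sl2_e n.-1 b (f j)).
  rewrite mulr_sumr; apply: eq_bigr => j _; rewrite mulr_sumr; apply: eq_bigr => b _.
  by rewrite vE -mulrA.
rewrite sum_pluck_upd; congr (_ * _).
have rowE i : row i (B0 n *m X0 A sl2_e n.-1) = tau n ('X^(i + n.-1) *: @e2 K).
    rewrite X0_mulm irr2_e row_B0 -scalemxAl scalerA -exprD; congr (tau n (_ *: _)).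
    by rewrite /e1 /e2 mul_delta_mx.
  pose i0 : 'I_n := Ordinal n0.
  rewrite (bigD1 i0) //= big1 ?addr0 => [|i ii0].
    congr (\det _); apply/matrixP => a b; rewrite [LHS]mxE [RHS]mxE.
    have [->|ai] := eqVneq a i0.
      have /rowP/(_ (f b)) := rowE i0; rewrite [X in X = _ -> _]mxE [colsub _ _ _ _]mxE => ->.
      by rewrite [RHS]mxE.
    have a0 : ((a : nat) == 0%N) = false.
      by apply: contraNF ai => /eqP a0; apply/eqP/val_inj.
    by rewrite [LHS]mxE [LHS]mxE [RHS]mxE a0.
  have ipos : (0 < i)%N by rewrite lt0n; apply: contraNneq ii0 => i00; apply/eqP/val_inj.
  rewrite (expand_det_row _ i) big1 // => b _; rewrite [row_repl _ _ _ _ _]mxE eqxx [colsub _ _ _ _]mxE.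
  have /rowP/(_ (f b)) := rowE i; rewrite [X in X = _ -> _]mxE => ->.
  by rewrite tau_Xn ?mxE ?mul0r //; lia.
Qed.

(** The bound [m] may exceed n, so that factors of different sizes can share one range of
    summation. *)
Lemma psi_slot x (p : {poly K}) m f u : \tr x = 0 -> (n <= m)%N ->
  (psiM f ((\sum_(l < m) p`_l *: fp_act M x l) u) : K) =
  \sum_j \sum_c (psiM (upd f j c) u : K) * mulm n n (p *: pm (irr2 x)) c (f j).
Proof.
move=> tx nm; rewrite sum_lfunE linear_sum.
transitivity (\sum_(l < m) \sum_j \sum_c (psiM (upd f j c) u : K) * (p`_l * X0 A x l c (f j))).
  apply: eq_bigr => l _; rewrite scale_lfunE linearZ /= -[LHS]/(_ * _) psi_act // mulr_sumr.
  apply: eq_bigr => j _; rewrite mulr_sumr; apply: eq_bigr => c _; ring.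
rewrite exchange_big; apply: eq_bigr => j _; rewrite exchange_big; apply: eq_bigr => c _ /=.
rewrite -mulr_sumr -(sum_X0 x p nm) summxE; congr (_ * _).
by apply: eq_bigr => l _; rewrite [RHS]mxE.
Qed.

(** The vector is the exponential of e (x) p at v, from [slot_op_exp] for a family with one factor,
    indexed by [unit]. The explicit sum replaces [nexp], because [slot_op_nilp] requires the joint
    injectivity that is deduced from here. *)
Lemma psi_orbit : exists2 c : K, c != 0 & forall p : {poly K}, exists w,
  forall f, (psiM f w : K) = c * pluck (B0 n *m mulm n n (Emx p)) f.
Proof.
have [c c0 cE] := psi_vecs; exists c => // p.
pose phi (f : colfam (fun _ : unit => n)) := psiM (f tt).
pose X : 'End(M : vectType K) := \sum_(l < n) p`_l *: fp_act M sl2_e l.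
have sumT (V : nmodType) (F : unit -> V) : \sum_i F i = F tt.
  by rewrite (bigD1 tt) //= big1 ?addr0 // => -[].
have XA : slot_op phi X (fun=> mulm n n (Xe p)).
  move=> f u; rewrite sumT /phi psi_slot ?tr_e // irr2_e.
  by apply: eq_bigr => j _; apply: eq_bigr => b _; rewrite /updf dfwith_in.
have A2' (i : unit) : mulm n n (Xe p) *m mulm n n (Xe p) = 0.
  by rewrite mulm_mul // Xe2 mulm0.
have vB (f : colfam (fun _ : unit => n)) : (phi f (fp_vec M) : K) = c * \prod_i pluck (B0 n) (f i).
  by rewrite (bigD1 tt) //= big1 ?mulr1 => [|[]//]; exact: (cE _).1.
have H := slot_op_exp char0 XA A2' vB.
eexists => f; apply: etrans (H (fun=> f)) _; congr (_ * _).
by rewrite (bigD1 tt) //= big1 ?mulr1 => [|[]//]; rewrite EmxE mulmD mulm1.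
Qed.

(** The 2^n forms of [minor_cols] are independent, as [minors_free] shows on the vectors of
    [psi_orbit]; since dim M <= 2^n they separate points. *)
Lemma psi_inj (w : M) : (forall f : {ffun 'I_n -> 'I_(n + n)}, psiM f w = 0) -> w = 0.
Proof.
move=> w0; set d := \dim {:M : vectType K}.
pose e := vbasis {:M : vectType K}.
pose Q : 'M[K]_(d, #|{set 'I_n}|) := \matrix_(i, S) (psiM (minor_cols (enum_val S)) e`_i : K).
have Qw (y : M) : (\row_i coord e i y) *m Q = \row_S (psiM (minor_cols (enum_val S)) y : K).
  apply/rowP => S; rewrite !mxE [in RHS](coord_vbasis (memvf y)) linear_sum.
  by apply: eq_bigr => i _; rewrite !mxE linearZ.
have QT : row_free Q^T.
  apply: inj_row_free => v vQ; have [c c0 orbP] := psi_orbit.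
  have vS : forall S, v 0 (enum_rank S) = 0.
    apply: (minors_free char0) => p; have [y yE] := orbP p.
    apply: (mulfI c0); rewrite mulr0 mulr_sumr.
    have : (\row_i coord e i y) *m Q *m v^T = 0.
      by rewrite -mulmxA -[Q]trmxK -trmx_mul vQ trmx0 mulmx0.
    rewrite Qw => /matrixP/(_ 0 0); rewrite !mxE => e0; rewrite -[RHS]e0.
    rewrite [RHS](reindex (@enum_rank _)) /=; last exact/onW_bij/enum_rank_bij.
    by apply: eq_bigr => S _; rewrite [X in _ = X * _]mxE enum_rankK yE mxE; ring.
  by apply/rowP => S; rewrite mxE -(enum_valK S) vS.
have rQ : \rank Q = (2 ^ n)%N.
  by rewrite -mxrank_tr (eqP QT) -cardsT -powersetT card_powerset cardsT card_ord.
have Qf : row_free Q.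
  by rewrite /row_free eqn_leq rank_leq_row rQ -dim_ev_space dim_fusion_le.
have : (\row_i coord e i w) *m Q = 0 *m Q.
  rewrite Qw mul0mx; apply/rowP => S; rewrite !mxE.
  rewrite (_ : minor_cols _ = finfun (minor_cols (enum_val S))) ?w0 //.
  by apply/funext => i; rewrite ffunE.
move/(row_free_inj Qf)/rowP => c0; rewrite (coord_vbasis (memvf w)) big1 // => i _.
by have := c0 i; rewrite !mxE => ->; rewrite scale0r.
Qed.

End FusionTwosInjective.

(** * The embedding in a tensor product *)

Section TensorLift.
Local Open Scope ring_scope.
Context {K : fieldType} {I : finType} (M : I -> vectType K).

Lemma tliftD i (X Y : 'End(M i)) u : tlift (X + Y) u = tlift X u + tlift Y u.
Proof.
suff H y : tlift (X + Y) (tens y) = (tlift X + tlift Y) (tens y).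
  by rewrite (tens_ext H) add_lfunE.
rewrite add_lfunE !tlift_tens add_lfunE.
have := tens_linear y 1 (X (y i)) (Y (y i)).
by rewrite !scale1r.
Qed.

Lemma tliftZ i a (X : 'End(M i)) u : tlift (a *: X) u = a *: tlift X u.
Proof.
suff H y : tlift (a *: X) (tens y) = (a *: tlift X) (tens y).
  by rewrite (tens_ext H) scale_lfunE.
rewrite scale_lfunE !tlift_tens scale_lfunE.
have /= := tens_linear y a (X (y i)) 0; rewrite !addr0.
have -> : tens (dfwith y (0 : M i)) = 0 :> tensor M.
  by apply/ffunP => J; rewrite tens_dfwith linear0 mul0r [RHS]ffunE.
by rewrite addr0.
Qed.

Lemma tlift_sum i m (F : nat -> 'End(M i)) u :
  tlift (\sum_(l < m) F l) u = \sum_(l < m) tlift (F l) u.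
Proof.
elim: m => [|m IH]; last by rewrite !big_ord_recr /= tliftD IH.
by rewrite !big_ord0 -(scale0r (0 : 'End(_))) tliftZ scale0r.
Qed.

End TensorLift.

(** * Application to the given modules and embedding *)

Section Boundary.
Local Open Scope ring_scope.
Local Open Scope classical_set_scope.
Context {K : fieldType} (char0 : [pchar K] =i pred0).
Context (ty : seq nat) (ty_pos : all (fun i => (0 < i)%N) ty) (ty_gt1 : (1 < size ty)%N).
Context (MA : fusion_product K (typeA ty)).
Context (M : forall k : 'I_(size ty), fusion_product K (nseq (twos ty k) 2%N)).
Context (iota : 'Hom(MA, prod_space M)) (iota_emb : is_embedding iota).
Local Notation pm := (map_mx (@polyC K)).
Let n := sumn ty.
(** Kept as a [size], so that column indices have the type that [psi] expects. *)
Let N (k : 'I_(size ty)) := size (nseq (twos ty k) 2%N).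
Local Notation U := (prod_space M).

Let A2 (k : 'I_(size ty)) (i : 'I_(N k)) : nth 0%N (nseq (twos ty k) 2%N) i = 2%N.
Proof.
rewrite nth_nseq; have : (i < N k)%N by exact: ltn_ord.
by move: (nat_of_ord i) => j; rewrite /N size_nseq => ->.
Qed.

Lemma sumn_take_lt k k' : (k < k')%N -> (k' <= size ty)%N ->
  (sumn (take k ty) < sumn (take k' ty))%N.
Proof.
move=> kk k's; have ks : (k < size ty)%N by apply: leq_trans k's.
have -> : take k' ty = take k ty ++ take (k' - k) (drop k ty).
  by rewrite -takeD subnKC // ltnW.
rewrite sumn_cat (drop_nth 0%N ks) -(prednK (_ : 0 < k' - k)%N) ?subn_gt0 //=.
have : (0 < nth 0%N ty k)%N by move/all_nthP: ty_pos; apply.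
lia.
Qed.

Lemma sumn_take_size : sumn (take (size ty) ty) = n.
Proof. by rewrite take_size. Qed.

Lemma N_E k : N k = (n - sumn (take k ty))%N.
Proof. by rewrite /N size_nseq. Qed.

Lemma N_pos k : (0 < N k)%N.
Proof.
have := sumn_take_lt (ltn_ord k) (leqnn _).
by rewrite sumn_take_size N_E subn_gt0.
Qed.

Lemma N_decr (k k' : 'I_(size ty)) : (k < k')%N -> (N k' < N k)%N.
Proof.
move=> kk; have := sumn_take_lt kk (ltnW (ltn_ord k')).
have := sumn_take_lt (ltn_ord k') (leqnn _).
by rewrite sumn_take_size !N_E; lia.
Qed.

Lemma N_le_n k : (N k <= n)%N.
Proof. by rewrite N_E leq_subr. Qed.

Lemma size_typeA : size (typeA ty) = n.
Proof.
rewrite /typeA size_flatten /shape -map_comp /n.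
rewrite (eq_map (g := nth 0%N ty)) => [|k /=]; last by rewrite size_nseq.
by rewrite map_nth_iota0 // take_size.
Qed.

Let psik k (f : 'I_(N k) -> 'I_(N k + N k)) : 'Hom(M k : vectType K, K^o) :=
  psi (A2 (k := k)) (M k) f.

Let phi (f : colfam N) : 'Hom(U, K^o) := tfun (fun k => psik (f k)).

Lemma phi_inj u : (forall f, phi f u = 0) -> u = 0.
Proof.
move=> u0; apply: (@tfun_inj K _ _ (fun k => {ffun 'I_(N k) -> 'I_(N k + N k)} : finType)
   (fun k f => psik f)).
  by move=> k w w0; apply: (psi_inj char0) w0.
by move=> g; exact: (u0 (fun k => g k)).
Qed.

Lemma vecs_exists : exists2 c : 'I_(size ty) -> K, forall k, c k != 0 & forall k f,
  (psik f (fp_vec (M k)) : K) = c k * pluck (B0 (N k)) f /\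
  (psik f (fp_act (M k) sl2_e (N k).-1 (fp_vec (M k))) : K) = c k * pluck (B1 (N k)) f.
Proof.
have /dep_choice[c cP] : forall k, exists c : K, c != 0 /\ forall f,
    (psik f (fp_vec (M k)) : K) = c * pluck (B0 (N k)) f /\
    (psik f (fp_act (M k) sl2_e (N k).-1 (fp_vec (M k))) : K) = c * pluck (B1 (N k)) f.
  move=> k; have [c c0 cE] := psi_vecs (A2 (k := k)) (M k); exists c; split=> // f.
  by have [h1 h2] := cE f; split=> //; apply: h2; exact: N_pos.
by exists c => k; case: (cP k).
Qed.

Lemma tens_plucker (B : forall k, 'M[K]_(N k, N k + N k)) (w : forall k, M k) :
    (forall k, exists2 c : K, c != 0 & forall f, (psik f (w k) : K) = c * pluck (B k) f) ->
  has_plucker phi (tens (w : forall k, (M k : vectType K))) B.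
Proof.
move=> H; have /dep_choice[c cP] : forall k, exists c : K, c != 0 /\
    forall f, (psik f (w k) : K) = c * pluck (B k) f.
  by move=> k; have [c c0 cE] := H k; exists c.
exists (\prod_k c k).
  by rewrite prodf_seq_neq0; apply/allP => k _; case: (cP k).
move=> f; rewrite /phi tfun_tens -big_split; apply: eq_bigr => k _.
by case: (cP k).
Qed.

Lemma v_plucker : has_plucker phi (prod_vec M) (fun k => B0 (N k)).
Proof.
apply: tens_plucker => k; have [c c0 cE] := vecs_exists.
by exists (c k) => // f; case: (cE k f).
Qed.

Lemma w_plucker (al : 'I_(size ty)) :
  has_plucker phi (w_ M al) (fun k => if (k < al)%N then B1 (N k) else B0 (N k)).
Proof.
apply: tens_plucker => k; have [c c0 cE] := vecs_exists.
exists (c k) => // f; have [h1 h2] := cE k f.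
case: ifP => // _; rewrite -h2 (_ : (twos ty k - 1)%N = (N k).-1) //.
by rewrite /N size_nseq subn1.
Qed.

Lemma tlift_slot k (X : 'End(M k : vectType K)) (B : 'M[K]_(N k + N k)) f u :
    (forall f u, (psik f (X u) : K) = \sum_j \sum_c (psik (upd f j c) u : K) * B c (f j)) ->
  (phi f (tlift X u) : K) = \sum_j \sum_c (phi (@updf _ N f k j c) u : K) * B c (f k j).
Proof.
move=> XB.
have [h hE] : exists h : 'Hom(U, K^o), forall u, h u =
    \sum_j \sum_c (phi (@updf _ N f k j c) u : K) * B c (f k j).
  apply: lfun_of_linear => a u1 u2; rewrite scaler_sumr -big_split; apply: eq_bigr => j _ /=.
  rewrite scaler_sumr -big_split; apply: eq_bigr => c _ /=.
  by rewrite linearP mulrDl -[a *: (_ * _)]/(a * (_ * _)) mulrA.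
rewrite -hE; suff H y : (phi f \o tlift X)%VF (tens y) = h (tens y).
  by rewrite -(tens_ext H) comp_lfunE.
rewrite hE comp_lfunE tlift_tens /phi tfun_tens (bigD1 k) //= dfwith_in XB mulr_suml.
apply: eq_bigr => j _; rewrite mulr_suml; apply: eq_bigr => c _.
rewrite tfun_tens (bigD1 k (P := xpredT)) //= /updf dfwith_in mulrAC; congr (_ * _ * _).
by apply: eq_bigr => l lk; rewrite !dfwith_out // eq_sym.
Qed.

Definition lift_op (x : 'M[K]_2) (q : 'I_(size ty) -> {poly K}) : 'End(U) :=
  \sum_(k < size ty) tlift (\sum_(l < n) (q k)`_l *: fp_act (M k) x l).

Lemma lift_op_slot x q : \tr x = 0 ->
  slot_op phi (lift_op x q) (fun k => mulm (N k) (N k) (q k *: pm (irr2 x))).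
Proof.
move=> tx f u; rewrite sum_lfunE linear_sum; apply: eq_bigr => k _.
apply: tlift_slot => g w; apply: psi_slot => //; exact: N_le_n.
Qed.

Definition Eop q := lift_op sl2_e q.
Definition Fop (p : {poly K}) := lift_op sl2_f (fun=> p).

Lemma Eop_slot q : slot_op phi (Eop q) (fun k => mulm (N k) (N k) (Xe (q k))).
Proof. by have := lift_op_slot q tr_e; rewrite irr2_e. Qed.

Lemma Fop_slot p : slot_op phi (Fop p) (fun k => mulm (N k) (N k) (Xf p)).
Proof. by have := lift_op_slot (fun=> p) tr_f; rewrite irr2_f. Qed.

Lemma lift_op_cst x p u :
  lift_op x (fun=> p) u = \sum_(l < n) p`_l *: prod_act M x l u.
Proof.
rewrite sum_lfunE; transitivity (\sum_(k < size ty) \sum_(l < n) p`_l *: tlift (fp_act (M k) x l) u).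
  apply: eq_bigr => k _; rewrite (tlift_sum _ (fun l => p`_l *: fp_act (M k) x l)).
  by apply: eq_bigr => l _; rewrite tliftZ.
rewrite exchange_big; apply: eq_bigr => l _ /=.
by rewrite -scaler_sumr /prod_act sum_lfunE.
Qed.

Lemma iota_inj : injective iota.
Proof. by case: iota_emb. Qed.

Lemma iota_trunc x (p : {poly %/ ('X^(size (typeA ty)) : {poly K})}) u : \tr x = 0 ->
  iota (trunc_act (fp_act MA) x p u) = lift_op x (fun=> (p : {poly K})) (iota u).
Proof.
move=> tx; have [_ iotaX _] := iota_emb.
rewrite lift_op_cst /trunc_act sum_lfunE linear_sum.
have nE (F : nat -> U) : \sum_(l < n) F l = \sum_(l < size (typeA ty)) F l.
  by rewrite size_typeA.
rewrite (nE (fun l => (p : {poly K})`_l *: prod_act M x l (iota u))).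
by apply: eq_bigr => l _; rewrite scale_lfunE linearZ /= iotaX.
Qed.

Let orbU := orb (prod_vec M) Eop Fop.

Let orb_goodU u : orbU u -> exists B, has_plucker phi u B.
Proof.
move=> ou.
have [B [uB _ _]] := orb_good char0 ty_gt1 N_pos N_decr phi_inj v_plucker Eop_slot Fop_slot ou.
by exists B.
Qed.

Lemma iota_nexp_e (p : {poly %/ ('X^(size (typeA ty)) : {poly K})}) u : orbU (iota u) ->
  iota (nexp (trunc_act (fp_act MA) sl2_e p) u) = nexp (Eop (fun=> (p : {poly K}))) (iota u).
Proof.
move=> /orb_goodU[B uB]; apply: nexp_morph iota_inj _ (slot_op_nilp phi_inj (Eop_slot _) _ uB).
  by move=> w; apply: iota_trunc; exact: tr_e.
by move=> k; rewrite mulm_mul // Xe2 mulm0.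
Qed.

Lemma iota_nexp_f (p : {poly %/ ('X^(size (typeA ty)) : {poly K})}) u : orbU (iota u) ->
  iota (nexp (trunc_act (fp_act MA) sl2_f p) u) = nexp (Fop (p : {poly K})) (iota u).
Proof.
move=> /orb_goodU[B uB]; apply: nexp_morph iota_inj _ (slot_op_nilp phi_inj (Fop_slot _) _ uB).
  by move=> w; apply: iota_trunc; exact: tr_f.
by move=> k; rewrite mulm_mul // Xf2 mulm0.
Qed.

Lemma lift_op_coef x (q q' : 'I_(size ty) -> {poly K}) : (forall k l, (l < n)%N -> (q k)`_l = (q' k)`_l) ->
  lift_op x q = lift_op x q'.
Proof.
move=> qq; apply: eq_bigr => k _; congr tlift; apply: eq_bigr => l _.
by rewrite qq.
Qed.

Lemma qpoly_coef (p : {poly K}) : exists p' : {poly %/ ('X^(size (typeA ty)) : {poly K})},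
  forall l, (l < n)%N -> (p' : {poly K})`_l = p`_l.
Proof.
exists (in_qpoly _ (take_poly n p)) => l ln.
have s1 : (1 < n.+1)%N.
  have := N_le_n (Ordinal (ltnW ty_gt1)); have := N_pos (Ordinal (ltnW ty_gt1)); lia.
rewrite in_qpoly_small ?coef_take_poly ?ln // /mk_monic size_typeA size_polyXn s1 monicXn.
by rewrite size_polyXn ltnS size_take_poly.
Qed.

Lemma fp_orbit_orb : [set (iota @: L)%VS | L in fp_orbit MA] = orb_lines (prod_vec M) Eop Fop.
Proof.
have [_ _ iota_v] := iota_emb.
have det_e (i j : 'I_2) (p : {poly %/ ('X^(size (typeA ty)) : {poly K})}) : i != j ->
    \det (1%:M + p *: delta_mx i j) = 1.
  move=> ij; rewrite det2 !mxE.
  by case: i ij => [[|[|//]] ?]; case: j => [[|[|//]] ?] //= _; ring.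
apply/seteqP; split=> [_ [_ [g [T [_ gT ->]]] <-]|_ [u ou ->]].
  exists (iota (T (fp_vec MA))); last by rewrite limg_line.
  elim: gT => [|p {}g {}T _ IH|p {}g {}T _ IH].
  - by rewrite id_lfunE iota_v; constructor.
  - by rewrite comp_lfunE iota_nexp_e //; constructor.
  - by rewrite comp_lfunE iota_nexp_f //; constructor.
suff [g [T [dg gT <-]]] : exists (g : 'M[{poly %/ ('X^(size (typeA ty)) : {poly K})}]_2) (T : 'End(MA)),
    [/\ \det g = 1, SL2_act (fp_act MA) g T & iota (T (fp_vec MA)) = u].
  by exists <[T (fp_vec MA)]>%VS; [exists g, T | rewrite limg_line].
elim: ou => [|p {}u ou [g [T [dg gT e]]]|p {}u ou [g [T [dg gT e]]]].
- exists 1%:M, \1%VF; split; [exact: det1 | exact: SL2_act_1 | by rewrite id_lfunE].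
- have [p' p'E] := qpoly_coef p.
  exists ((1%:M + p' *: delta_mx 0 1) *m g), (nexp (trunc_act (fp_act MA) sl2_e p') \o T)%VF.
  split; [by rewrite det_mulmx dg det_e // mulr1 | exact: SL2_act_e |].
  rewrite comp_lfunE iota_nexp_e [iota _]e; last by []; congr (fun_of_lfun (nexp _) u).
  by apply: lift_op_coef => k l; exact: p'E.
- have [p' p'E] := qpoly_coef p.
  exists ((1%:M + p' *: delta_mx 1 0) *m g), (nexp (trunc_act (fp_act MA) sl2_f p') \o T)%VF.
  split; [by rewrite det_mulmx dg det_e // mulr1 | exact: SL2_act_f |].
  rewrite comp_lfunE iota_nexp_f [iota _]e; last by []; congr (fun_of_lfun (nexp _) u).
  by apply: lift_op_coef => k l; exact: p'E.
Qed.

Let waU (al : 'I_(size ty)) : U := w_ M al.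

(** The parameters z_l are the coefficients of p below n and z' is c; [Eop] reads no further
    coefficient. *)
Lemma N_lines_eq (al : 'I_(size ty)) : N_ M al = zariski_closure (N_lines N Eop waU al).
Proof.
rewrite /N_; congr zariski_closure.
have NalE : (sumn ty - sumn (take al ty) - 1)%N = (N al).-1 by rewrite N_E subn1.
have key (p : {poly K}) c : Eop (shift_at N al p c) =
    \sum_(l < n) p`_l *: prod_act M sl2_e l + c *: prod_act2 M al sl2_e (sumn ty - sumn (take al ty) - 1)%N.
  rewrite NalE; apply/lfunP => u; rewrite add_lfunE scale_lfunE !sum_lfunE.
  have -> : \sum_(l < n) (p`_l *: prod_act M sl2_e l) u =
      \sum_(k < size ty) \sum_(l < n) p`_l *: tlift (fp_act (M k) sl2_e l) u.
    rewrite exchange_big; apply: eq_bigr => l _ /=.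
    by rewrite scale_lfunE /prod_act sum_lfunE scaler_sumr.
  rewrite [X in c *: X]big_mkcond scaler_sumr -big_split; apply: eq_bigr => k _ /=.
  rewrite (tlift_sum _ (fun l => (shift_at N al p c k)`_l *: fp_act (M k) sl2_e l)).
  have lN : ((N al).-1 < n)%N by have := N_le_n al; have := N_pos al; lia.
  have -> : (if (al <= k)%N then tlift (fp_act (M k) sl2_e (N al).-1) u else 0) =
      \sum_(l < n) (if (al <= k)%N && ((l : nat) == (N al).-1) then tlift (fp_act (M k) sl2_e l) u else 0).
    case: ifP => _ /=; last by rewrite big1.
    by rewrite -big_mkcond (big_pred1 (Ordinal lN)) // => l; rewrite /= -val_eqE.
  rewrite scaler_sumr -big_split; apply: eq_bigr => l _ /=.
  rewrite tliftZ /shift_at; case: (al <= k)%N => /=; last by rewrite scaler0 addr0.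
  rewrite coefD coefMC coefXn; case: eqP => _; rewrite ?mul1r ?mul0r ?addr0 ?scaler0 ?addr0 //.
  by rewrite scalerDl.
apply/seteqP; split=> [L [z [z' ->]]|L [p [c ->]]].
  exists (\sum_(l < n) z l *: 'X^l), z'.
  have zE (l : 'I_n) : (\sum_(l < n) z l *: 'X^l)`_l = z l.
    rewrite coef_sum (bigD1 l) //= big1 => [|i il]; first by rewrite coefZ coefXn eqxx mulr1 addr0.
    by rewrite coefZ coefXn eq_sym (negbTE (il : (i != l :> nat))) mulr0.
  have zsum : \sum_(l < n) (\sum_(l < n) z l *: 'X^l)`_l *: prod_act M sl2_e l =
      \sum_(l < n) z l *: prod_act M sl2_e l by apply: eq_bigr => l _; rewrite zE.
  by rewrite [Eop _]key zsum.
by exists (fun l => p`_l), c; rewrite [Eop _]key.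
Qed.

(** Orbit and closure are carried by [iota] into the tensor product, where [boundary_eq] applies;
    injectivity of [iota] on lines lets the set difference pass through the image. *)
Lemma sh_boundary :
  [set (iota @: L)%VS | L in sh MA `\` fp_orbit MA] =
  \bigcup_(alpha in [set a : nat | (0 < a < size ty)%N]) N_ M alpha.
Proof.
have clE : [set (iota @: L)%VS | L in sh MA] =
    zariski_closure (orb_lines (prod_vec M) Eop Fop).
  by rewrite /sh zariski_closure_inj; [rewrite fp_orbit_orb | exact: iota_inj].
have main L := boundary_eq char0 ty_gt1 N_pos N_decr phi_inj v_plucker Eop_slot Fop_slot
  (wa := waU) w_plucker L.
have img_inj (L L' : {vspace MA}) : (iota @: L = iota @: L')%VS -> L = L'.
  move=> e; have ik : lker iota == 0%VS by apply/lker0P; exact: iota_inj.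
  by rewrite -[L]lim1g -[L']lim1g -(lker0_compVf ik) !limg_comp e.
apply/seteqP; split=> [_ [L [shL nL] <-]|L [al /andP[al0 als] NL]].
  have [|al al0 NL] := (main (iota @: L)%VS).1; last first.
    by exists al; [rewrite /= al0 ltn_ord | rewrite N_lines_eq].
  split; first by rewrite -clE; exists L.
  rewrite -fp_orbit_orb => -[L' oL' /img_inj e]; apply: nL.
  by rewrite -e.
have [|cl nL] := (main L).2.
  by exists (Ordinal als) => //; rewrite -N_lines_eq.
move: cl; rewrite -clE => -[L' shL' e]; exists L' => //; split=> // oL'.
by apply: nL; rewrite -fp_orbit_orb; exists L'.
Qed.

End Boundary.

Local Open Scope classical_set_scope.
Local Open Scope complex_scope.

Theorem corollary3p2 (R : realType) (ty : seq nat)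
    (ty_pos : all (fun i => (0 < i)%N) ty) (ty_gt1 : (1 < size ty)%N)
    (MA : fusion_product R[i] (typeA ty))
    (M : forall k : 'I_(size ty), fusion_product R[i] (nseq (twos ty k) 2))
    (iota : 'Hom(MA, prod_space M)) (iota_emb : is_embedding iota) :
  [set (iota @: L)%VS | L in sh MA `\` fp_orbit MA] =
  \bigcup_(alpha in [set a : nat | (0 < a < size ty)%N]) N_ M alpha.
Proof. exact: (sh_boundary (Num.Theory.pchar_num _)). Qed.
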